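(* Let $d\ge 2$ be an integer. For each $n$, let $p=p_n$ be a positive integer, let $(X_i(k))_{1\le i\le n,\,1\le k\le p}$ be an array of i.i.d. random variables taking values in a measurable space $\mathcal S=\mathcal S_n$, and let $\phi=\phi_n:\mathcal S^d\to\mathbb R$ be an antisymmetric measurable function (everything except $d$ may depend on $n$). Let $\mathcal X_1,\dots,\mathcal X_d$ be independent copies of $X_1(1)$, and set $$\overline\phi(x)=\mathbb E\left[\phi(x,\mathcal X_2,\dots,\mathcal X_d)\right].$$ Suppose that: - the ratio $p/n$ tends to a finite limit $q\ge 0$ as $n\to\infty$; - $\mathbb E\left[\phi(\mathcal X_1,\dots,\mathcal X_d)^{2d+4}\right]$ is bounded by a finite constant independent of $n$; - the limits $$\alpha=\lim_{n\to\infty} d\,\mathbb E\left[\overline\phi(\mathcal X_1)^2\right],\qquad \beta=\lim_{n\to\infty}\mathbb E\left[\phi(\mathcal X_1,\dots,\mathcal X_d)^2\right]$$ exist and $\beta>0$. For $1\le j\le p$ write $X(j)=(X_i(j))_{1\le i\le n}$. Then, as $n\to\infty$, the empirical spectral distribution of the $p\times p$ matrix $\mathcal{COV}^{\phi}(X(1),\dots,X(p))$ converges weakly in probability to the probability measure $\mathbb{MP}_q^{\alpha,\beta-\alpha}$, and the empirical spectral distribution of the $p\times p$ matrix $\mathcal{COR}^{\phi}(X(1),\dots,X(p))$ converges weakly in probability to $\mathbb{MP}_q^{t,1-t}$ with $t=\alpha/\beta$.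
   Context: Antisymmetric: $\phi:\mathcal S^d\to\mathbb R$ is antisymmetric if $\phi(x_{\pi(1)},\dots,x_{\pi(d)})=\operatorname{sgn}(\pi)\,\phi(x_1,\dots,x_d)$ for all $(x_1,\dots,x_d)\in\mathcal S^d$ and all permutations $\pi$ of $\{1,\dots,d\}$. $\phi$-covariance and $\phi$-correlation: write $[n]=\{1,\dots,n\}$ and $[n]^d_<=\{(i_1,\dots,i_d)\in[n]^d: i_1<\cdots<i_d\}$ (with $n\ge d$). For $u,v\in\mathcal S^n$, $$\mathcal{COV}^\phi(u,v)=\frac1{\binom nd}\sum_{(i_1,\dots,i_d)\in[n]^d_<}\phi(u_{i_1},\dots,u_{i_d})\,\phi(v_{i_1},\dots,v_{i_d}),$$ and, when the denominator is nonzero, $$\mathcal{COR}^\phi(u,v)=\frac{\mathcal{COV}^\phi(u,v)}{\sqrt{\mathcal{COV}^\phi(u,u)\,\mathcal{COV}^\phi(v,v)}}.$$ For $u(1),\dots,u(p)\in\mathcal S^n$, $\mathcal{COV}^\phi(u(1),\dots,u(p))$ is the $p\times p$ matrix with $(k,l)$ entry $\mathcal{COV}^\phi(u(k),u(l))$, and $\mathcal{COR}^\phi(u(1),\dots,u(p))$ is the $p\times p$ matrix with $(k,l)$ entry $\mathcal{COR}^\phi(u(k),u(l))$, defined when all denominators are nonzero. Under the hypotheses of the theorem, with probability tending to one none of the $\mathcal{COV}^\phi(X(k),X(k))$, $1\le k\le p$, is zero, so the matrix $\mathcal{COR}^{\phi}(X(1),\dots,X(p))$ is well defined with probability tending to one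 (its value on the exceptional event is irrelevant). Empirical spectral distribution: the empirical spectral distribution of a Hermitian matrix is the uniform probability measure on its eigenvalues, counted with multiplicity. Marčenko–Pastur laws: for $q=0$, $\mathbb{MP}_0=\delta_1$. For $q>0$, with $\lambda_\pm=(1\pm\sqrt q)^2$, $$\mathbb{MP}_q=\frac{\sqrt{(\lambda_+-x)(x-\lambda_-)}}{2\pi q x}\,\mathbf 1_{[\lambda_-,\lambda_+]}(x)\,\mathrm dx+\mathbf 1_{q>1}(1-q^{-1})\,\delta_0.$$ For $a,b\in\mathbb R$, $\mathbb{MP}_q^{a,b}$ is the push-forward of $\mathbb{MP}_q$ by the map $x\mapsto ax+b$. *)

(* Defs.v *)
From HB Require Import structures.
From mathcomp Require Import all_boot all_order all_algebra all_fingroup.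
From mathcomp Require Import complex.
From mathcomp Require Import all_classical all_reals all_analysis measurable_realfun.

Set Implicit Arguments.
Unset Strict Implicit.
Unset Printing Implicit Defensive.

Import Order.TTheory GRing.Theory Num.Theory.
Import numFieldNormedType.Exports.

Local Open Scope classical_set_scope.
Local Open Scope ring_scope.

Section random_elements.
Context {R : realType} {d dS : measure_display}.
Context {Omega : measurableType d} {S : measurableType dS}.

Definition equal_in_law {d'} {Omega' : measurableType d'}
    (P : probability Omega R) (X : {RV P >-> S})
    (Q : probability Omega' R) (Y : {RV Q >-> S}) : Prop :=
  forall A, measurable A -> distribution P X A = distribution Q Y A.

Definition mutually_independent (P : probability Omega R) {I : finType}
    (X : I -> {RV P >-> S}) : Prop :=
  forall (J : {set I}) (A : I -> set S), (forall i, measurable (A i)) ->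
    P (\bigcap_(i in [set` J]) (X i @^-1` A i))
    = (\prod_(i in J) P (X i @^-1` A i))%E.

Definition iid (P : probability Omega R) {I : finType}
    (X : I -> {RV P >-> S}) : Prop :=
  mutually_independent X /\ forall i j, equal_in_law (X i) (X j).

End random_elements.

Definition antisymmetric_fun {R : realType} {T : Type} {d : nat}
    (phi : d.-tuple T -> R) : Prop :=
  forall (x : d.-tuple T) (s : {perm 'I_d}),
    phi [tuple tnth x (s i) | i < d] = (-1) ^+ s * phi x.

Section phi_covariance.
Context {R : realType} {T : Type} {d n : nat}.
Variable phi : d.-tuple T -> R.

Definition phi_cov (u v : n.-tuple T) : R :=
  'C(n, d)%:R^-1 *
  \sum_(i : d.-tuple 'I_n | sorted ltn (map val i))
     phi (map_tuple (tnth u) i) * phi (map_tuple (tnth v) i).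

(* Division by 0 gives 0, so this is 0 when the denominator vanishes. *)
Definition phi_cor (u v : n.-tuple T) : R :=
  phi_cov u v / Num.sqrt (phi_cov u u * phi_cov v v).

Definition phi_cov_mx {p} (u : 'I_p -> n.-tuple T) : 'M[R]_p :=
  \matrix_(k, l) phi_cov (u k) (u l).

Definition phi_cor_mx {p} (u : 'I_p -> n.-tuple T) : 'M[R]_p :=
  \matrix_(k, l) phi_cor (u k) (u l).

End phi_covariance.

(* x |-> E[phi(x, Y_2, ..., Y_d)]; the entry of index 0 of Y is ignored. *)
Definition phi_bar {R : realType} {d' dS} {Omega : measurableType d'}
    {S : measurableType dS} {d : nat} (phi : d.-tuple S -> R)
    (P : probability Omega R) (Y : 'I_d -> {RV P >-> S}) (x : S) : R :=
  fine 'E_P[fun w => phi [tuple if val j == 0%N then x else Y j w | j < d]].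

Lemma char_poly_conj {F : fieldType} {n} (P D : 'M[F]_n) : P \in unitmx ->
  char_poly (invmx P *m D *m P) = char_poly D.
Proof.
move=> uP; pose f M : 'M[{poly F}]_n := map_mx (@polyC F) M.
have fPP : f (invmx P) *m f P = 1%:M by rewrite -map_mxM mulVmx// map_mx1.
rewrite /char_poly.
have -> : char_poly_mx (invmx P *m D *m P) = f (invmx P) *m char_poly_mx D *m f P.
  rewrite /char_poly_mx mulmxBr mulmxBl /f !map_mxM; congr (_ - _).
  by rewrite scalar_mxC -mulmxA [_ *m map_mx _ P]fPP mulmx1.
by rewrite !det_mulmx mulrAC -det_mulmx fPP det1 mul1r.
Qed.

Lemma symmetric_split {R : rcfType} {p} (A : 'M[R]_p) : A^T = A ->
  exists s, char_poly A = \prod_(x <- s) ('X - x%:P).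
Proof.
move=> sA; pose f := real_complex R; pose Ac := map_mx f A.
have hA : Ac \is hermsymmx.
  apply: realsym_hermsym.
    by apply/is_hermitianmxP; rewrite expr0 scale1r map_mx_id// map_trmx sA.
  by apply/mxOverP => i j; rewrite mxE; apply/complex_realP; exists (A i j).
have dR := hermitian_spectral_diag_real hA.
have /orthomx_spectralP AE := hermitian_normalmx hA.
move: (spectral_diag Ac) dR AE => D dR AE.
exists [seq complex.Re (D ord0 i) | i : 'I_p].
apply: (map_poly_inj f); rewrite map_char_poly -/Ac {}AE.
rewrite char_poly_conj ?spectral_unit// char_poly_trig ?diag_mx_is_trig//.
rewrite rmorph_prod big_image/=; apply: eq_bigr => i _.
rewrite rmorphB/= map_polyX map_polyC/= mxE eqxx mulr1n RRe_real//.
by move/mxOverP: dR; exact.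
Qed.

Section empirical_spectral_distribution.
Context {R : realType} {p : nat}.

(* Eigenvalues with multiplicity, in an unspecified order; the default [::] is
   only used when char_poly A does not split over R. *)
Definition eigenvalues (A : 'M[R]_p) : seq R :=
  xget [::] [set s | char_poly A = \prod_(x <- s) ('X - x%:P)].

Lemma symmetric_eigenvaluesP (A : 'M[R]_p) : A^T = A ->
  char_poly A = \prod_(x <- eigenvalues A) ('X - x%:P).
Proof.
move=> /symmetric_split[s sE].
exact: (@xgetPex _ [::] [set s | char_poly A = \prod_(x <- s) ('X - x%:P)]
  (ex_intro _ s sE)).
Qed.

Definition esd (A : 'M[R]_p) : {measure set (measurableTypeR R) -> \bar R} :=
  let s := eigenvalues A in
  mscale ((p%:R : R)^-1)%:nng
    (msum (fun k => dirac (s`_k : measurableTypeR R)) (size s)).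

End empirical_spectral_distribution.

Section marchenko_pastur.
Context {R : realType}.
Variable q : R.
Let TR := measurableTypeR R.
Local Notation leb := (@lebesgue_measure R).

Definition mp_lower : R := (1 - Num.sqrt q) ^+ 2.
Definition mp_upper : R := (1 + Num.sqrt q) ^+ 2.

Definition mp_density (x : R) : R :=
  Num.sqrt ((mp_upper - x) * (x - mp_lower)) / (2 * pi * q * x)
  * \1_(`[mp_lower, mp_upper]) x.

Definition mp_atom : R := if 1 < q then 1 - q^-1 else 0.

(* The parameter q is meant to be nonnegative; for q < 0 this is dirac 1. *)
Definition marchenko_pastur (A : set TR) : \bar R :=
  if q <= 0 then dirac (1 : TR) A
  else (\int[leb]_(x in A) (mp_density x)%:E
        + mp_atom%:E * dirac (0%R : TR) A)%E.

Lemma mp_density_ge0 x : 0 < q -> 0 <= mp_density x.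
Proof.
move=> q0; rewrite /mp_density indicE; case: (boolP (x \in _)) => [|_]; last by rewrite mulr0.
rewrite inE/= in_itv/= mulr1 => /andP[lx _].
have x0 : 0 <= x by rewrite (le_trans _ lx)// sqr_ge0.
by rewrite divr_ge0 ?sqrtr_ge0// !mulr_ge0 ?pi_ge0// ltW.
Qed.

Lemma mp_atom_ge0 : 0 <= mp_atom.
Proof.
rewrite /mp_atom; case: ifPn => // q1.
rewrite subr_ge0 invf_le1; [exact: ltW | exact: lt_trans q1].
Qed.

Lemma measurable_mp_density : measurable_fun [set: TR] (mp_density : TR -> R).
Proof.
have mV : measurable_fun [set: TR] (@GRing.inv R : TR -> R).
  rewrite -(setvU ([set 0%R] : set R)); apply/measurable_funU;
    [exact: measurableC|by []|split; last exact: measurable_fun_set1].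
  apply: open_continuous_measurable_fun.
    exact/closed_openC/accessible_closed_set1/hausdorff_accessible/Rhausdorff.
  by move=> x; rewrite inE/= => /eqP x0; exact: inv_continuous.
apply: measurable_funM => //.
apply: measurable_funM.
  apply: (@measurableT_comp _ _ _ _ _ _ (@Num.sqrt R)).
    by apply: continuous_measurable_fun; exact: sqrt_continuous.
  by apply: measurable_funM; apply: measurable_funB.
by apply: (@measurableT_comp _ _ _ _ _ _ (@GRing.inv R)).
Qed.

Let mp0 : marchenko_pastur set0 = 0%E.
Proof.
rewrite /marchenko_pastur integral_set0 !measure0 mule0 adde0.
by case: ifP.
Qed.

Let mp_ge0 A : (0 <= marchenko_pastur A)%E.
Proof.
rewrite /marchenko_pastur; case: ifPn => [_|]; first exact: measure_ge0.
rewrite -ltNge => q0; apply: adde_ge0; last first.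
  by rewrite mule_ge0 ?lee_fin ?mp_atom_ge0.
by apply: integral_ge0 => x _; rewrite lee_fin mp_density_ge0.
Qed.

Let mp_sigma_additive : semi_sigma_additive marchenko_pastur.
Proof.
move=> F mF tF mUF; rewrite /marchenko_pastur; have [_|q0] := leP q 0.
  exact: measure_semi_sigma_additive.
under eq_fun do rewrite big_split/=.
have d0 x : (0 <= (mp_density x)%:E)%E by rewrite lee_fin mp_density_ge0.
apply: cvgeD.
- by rewrite ge0_adde_def// inE ?integral_ge0// mule_ge0 ?lee_fin ?mp_atom_ge0.
- rewrite ge0_integral_bigcup//=.
    apply: is_cvg_ereal_nneg_natsum_cond => n _ _.
    by apply: integral_ge0 => x _.
  apply: measurable_funTS; apply/measurable_EFinP; exact: measurable_mp_density.
- have := @measure_semi_sigma_additive _ _ _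
    (mscale (NngNum mp_atom_ge0) (dirac (0 : TR))) F mF tF mUF.
  exact.
Qed.

HB.instance Definition _ := isMeasure.Build _ TR R marchenko_pastur
  mp0 mp_ge0 mp_sigma_additive.

End marchenko_pastur.

Section marchenko_pastur_affine.
Context {R : realType}.
Variables q a b : R.
Let TR := measurableTypeR R.

Definition affine_map (x : TR) : TR := a * x + b.

Lemma measurable_affine_map : measurable_fun [set: TR] affine_map.
Proof. by apply: measurable_funD => //; exact: measurable_funM. Qed.

Definition marchenko_pastur_affine : set TR -> \bar R :=
  pushforward (marchenko_pastur q) affine_map.

Let mpa0 : marchenko_pastur_affine set0 = 0%E.
Proof.
by rewrite /marchenko_pastur_affine /pushforward preimage_set0 measure0.
Qed.

Let mpa_ge0 A : (0 <= marchenko_pastur_affine A)%E.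
Proof. by rewrite /marchenko_pastur_affine /pushforward measure_ge0. Qed.

Let mpa_sigma_additive : semi_sigma_additive marchenko_pastur_affine.
Proof.
have mpre (A : set TR) : measurable A -> measurable (affine_map @^-1` A).
  by move=> mA; rewrite -[X in measurable X]setTI; exact: measurable_affine_map.
move=> F mF tF mUF.
rewrite /marchenko_pastur_affine /pushforward preimage_bigcup.
apply: measure_semi_sigma_additive.
- by move=> n; exact: mpre.
- apply/trivIsetP => /= i j _ _ ij; rewrite -preimage_setI.
  by move/trivIsetP : tF => /(_ _ _ _ _ ij) ->//; rewrite preimage_set0.
- by rewrite -preimage_bigcup; exact: mpre.
Qed.

HB.instance Definition _ := isMeasure.Build _ TR R marchenko_pastur_affine
  mpa0 mpa_ge0 mpa_sigma_additive.

End marchenko_pastur_affine.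

Section convergence.
Context {R : realType} {d : nat -> measure_display}.
Context {Omega : forall n, measurableType (d n)}.
Variable P : forall n, probability (Omega n) R.

Definition cvg_in_probability (Y : forall n, Omega n -> R) (l : R) : Prop :=
  forall e : R, 0 < e ->
    P n [set w | e < `|Y n w - l|] @[n --> \oo] --> 0%E.

Definition weak_cvg_in_probability
    (mu : forall n, Omega n -> {measure set (measurableTypeR R) -> \bar R})
    (nu : {measure set (measurableTypeR R) -> \bar R}) : Prop :=
  forall f : R -> R, continuous f -> bounded_fun f ->
    cvg_in_probability (fun n w => \int[mu n w]_x f x) (\int[nu]_x f x).

End convergence.

(* Main.v *)
(* The p x p covariance matrix A is compared, in normalised Frobenius norm, with
   (beta - alpha) I + H, where H = Y^T Y is the Gram matrix of the n x p array
   with entries sqrt(d/n) phi-bar(X_i(k)): off the diagonal H_kl is the Hoeffding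
   projection of A_kl and the error is of order 1/n, while on the diagonal A_kk
   and H_kk concentrate around beta and alpha.  Dividing by beta handles the
   correlation matrix, since all A_kk are uniformly close to beta by a fourth
   moment bound.

   The entries phi-bar(X_i(k)) are i.i.d. and centred (antisymmetry), so removing
   one column of Y at a time gives an approximate quadratic equation for the
   normalised trace of (H + x)^-1, whose positive root is the Stieltjes transform
   at -x of the affine image of the Marchenko-Pastur law; the latter is computed
   from an explicit primitive of sqrt((B - s)(s - A)) / (s + c).

   Convergence of the Stieltjes transforms for all x > 0 gives weak convergence:
   the test functions for which the averages converge form a linear space closed
   under uniform limits; it contains the powers of 1/(1 + t) (difference quotients
   in x), hence, by Weierstrass, every continuous function of min(t, M), and the
   limit law has compact support. *)

From HB Require Import structures.
Require Import Defs.
From mathcomp Require Import all_boot all_order all_algebra.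
From mathcomp Require Import perm complex ring lra zify.
From mathcomp Require Import all_classical all_reals all_analysis measurable_realfun.

Set Implicit Arguments.
Unset Strict Implicit.
Unset Printing Implicit Defensive.

Import Order.TTheory GRing.Theory Num.Theory.
Import numFieldNormedType.Exports.

Local Open Scope classical_set_scope.
Local Open Scope ring_scope.

(** * Linear algebra of resolvents *)

Section frobenius.
Context {R : realFieldType}.

(** The Stieltjes transform is taken at real points [- x] with [x > 0]: the resolvent of a psd
    matrix is then real with norm at most [1 / x]. All matrix estimates are mean square bounds with
    explicit rates; probabilities enter only through Markov's inequality.

    The rates are dictated by [p] being at most of order [n]. The normalised Frobenius norm adds
    [p ^ 2] squared errors and divides by [p], so an off-diagonal entry must be approximated up to
    mean square [n ^ -2], although its own mean square may be of order [1 / n]: the first-order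
    terms have to cancel exactly. They do because, by antisymmetry, each one-coordinate projection
    of the kernel is phi-bar up to a sign, and this sign occurs once for each of the two columns.

    For correlations, all [p] diagonal entries must be close to [beta] simultaneously. The union
    bound needs tails that beat [1 / p], hence a fourth moment of phi squared; it is available since
    [2 d + 4 >= 8]. *)

Definition frob {m n} (A B : 'M[R]_(m, n)) : R := \tr (A^T *m B).

Lemma frobE m n (A B : 'M[R]_(m, n)) : frob A B = \sum_i \sum_j A i j * B i j.
Proof.
rewrite /frob /mxtrace exchange_big/=; apply: eq_bigr => j _; rewrite mxE.
by apply: eq_bigr => i _; rewrite mxE.
Qed.

Lemma frobC m n (A B : 'M[R]_(m, n)) : frob A B = frob B A.
Proof. by rewrite !frobE; do 2 (apply: eq_bigr => ? _); rewrite mulrC. Qed.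

Lemma frobDl m n (A B C : 'M[R]_(m, n)) : frob (A + B) C = frob A C + frob B C.
Proof. by rewrite /frob linearD mulmxDl linearD. Qed.

Lemma frobZl m n a (A B : 'M[R]_(m, n)) : frob (a *: A) B = a * frob A B.
Proof. by rewrite /frob linearZ -scalemxAl linearZ. Qed.

Lemma frobDr m n (A B C : 'M[R]_(m, n)) : frob C (A + B) = frob C A + frob C B.
Proof. by rewrite !(frobC C) frobDl. Qed.

Lemma frobZr m n a (A B : 'M[R]_(m, n)) : frob A (a *: B) = a * frob A B.
Proof. by rewrite !(frobC A) frobZl. Qed.

Lemma frob_ge0 m n (A : 'M[R]_(m, n)) : 0 <= frob A A.
Proof. by rewrite frobE; do 2 (apply: sumr_ge0 => ? _); rewrite -expr2 sqr_ge0. Qed.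

Lemma frob1 n : frob (1%:M : 'M[R]_n) 1%:M = n%:R.
Proof. by rewrite /frob trmx1 mul1mx mxtrace1. Qed.

Lemma frob_eq0 m n (A : 'M[R]_(m, n)) : frob A A = 0 -> A = 0.
Proof.
move=> a0; apply/matrixP => i j; rewrite mxE; apply/eqP; rewrite -sqrf_eq0 expr2.
move: a0; rewrite frobE => /eqP; rewrite psumr_eq0; last first.
  by move=> k _; apply: sumr_ge0 => l _; rewrite -expr2 sqr_ge0.
move=> /allP/(_ i (mem_index_enum _))/=; rewrite psumr_eq0; last first.
  by move=> l _; rewrite -expr2 sqr_ge0.
by move=> /allP/(_ j (mem_index_enum _)).
Qed.

Lemma frob_cs m n (A B : 'M[R]_(m, n)) : frob A B ^+ 2 <= frob A A * frob B B.
Proof.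
have [a0|] := eqVneq (frob A A) 0.
  by rewrite (frob_eq0 a0) /frob trmx0 !mul0mx mxtrace0 expr0n mul0r.
move=> an0; have a0 : 0 < frob A A by rewrite lt_neqAle eq_sym an0 frob_ge0.
have := frob_ge0 (frob A A *: B + (- frob A B) *: A).
rewrite !(frobDl, frobDr, frobZl, frobZr) (frobC B A).
set a := frob A A in a0 *; set b := frob A B; set c := frob B B => H.
have : 0 <= a * (a * c - b ^+ 2) by apply: le_trans H _; rewrite le_eqVlt; apply/orP; left; apply/eqP; ring.
by rewrite pmulr_rge0// subr_ge0.
Qed.

(** Test matrices of every width are allowed: width one gives vectors and the identity gives traces,
    both from the same inequality. *)
Definition psd n (A : 'M[R]_n) : Prop :=
  A^T = A /\ forall m (V : 'M[R]_(n, m)), 0 <= frob V (A *m V).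

Lemma psd_gram m n (Y : 'M[R]_(m, n)) : psd (Y^T *m Y).
Proof.
split; first by rewrite trmx_mul trmxK.
move=> k V; rewrite /frob !mulmxA -trmx_mul -mulmxA; exact: frob_ge0.
Qed.

Lemma psd_gramT m n (Y : 'M[R]_(m, n)) : psd (Y *m Y^T).
Proof. by rewrite -{1}(trmxK Y); exact: psd_gram. Qed.

Lemma psdD_scalar n (A : 'M[R]_n) (c : R) : psd A -> 0 <= c -> psd (c%:M + A).
Proof.
move=> [sA pA] c0; split; first by rewrite linearD/= tr_scalar_mx sA.
move=> m V; rewrite mulmxDl frobDr mul_scalar_mx frobZr addr_ge0//.
by rewrite mulr_ge0// frob_ge0.
Qed.

Lemma psdZ n (A : 'M[R]_n) (c : R) : psd A -> 0 <= c -> psd (c *: A).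
Proof.
move=> [sA pA] c0; split; first by rewrite linearZ/= sA.
by move=> m V; rewrite -scalemxAl frobZr mulr_ge0.
Qed.

(** The point is [- x], to the left of the spectrum of a psd matrix, so that no imaginary part is
    needed for invertibility. *)
Definition resolvent n (A : 'M[R]_n) (x : R) := invmx (A + x%:M).

Lemma resolvent_unit n (A : 'M[R]_n) (x : R) : psd A -> 0 < x -> A + x%:M \in unitmx.
Proof.
move=> [sA pA] x0; rewrite -row_free_unit -kermx_eq0; apply/eqP.
set K := kermx _; have := mulmx_ker (A + x%:M); rewrite -/K => K0.
have : frob K^T ((A + x%:M) *m K^T) = 0.
  have -> : (A + x%:M) *m K^T = (K *m (A + x%:M))^T.
    by rewrite [RHS]trmx_mul [in RHS]linearD/= tr_scalar_mx sA.
  by rewrite K0 trmx0 /frob mulmx0 mxtrace0.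
rewrite mulmxDl frobDr mul_scalar_mx frobZr => /eqP.
rewrite paddr_eq0//; last by rewrite mulr_ge0 ?frob_ge0// ltW.
move=> /andP[_]; rewrite mulf_eq0 gt_eqF//= => /eqP k0.
by rewrite -[K]trmxK (frob_eq0 k0) trmx0.
Qed.

Section resolvent_theory.
Variables (n : nat) (A : 'M[R]_n) (x : R).
Hypotheses (pA : psd A) (x0 : 0 < x).
Local Notation Q := (resolvent A x).

Lemma mulmx_resolvent : (A + x%:M) *m Q = 1%:M.
Proof. by rewrite mulmxV// resolvent_unit. Qed.

Lemma mul_resolvent_mx : Q *m (A + x%:M) = 1%:M.
Proof. by rewrite mulVmx// resolvent_unit. Qed.

Lemma resolvent_sym : Q^T = Q.
Proof. by rewrite trmx_inv linearD/= pA.1 tr_scalar_mx. Qed.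

(** With [W := Q *m V] one has [V = A *m W + x *: W], and the cross term of the square is
    nonnegative. The operator norm of [Q] is thus at most [1 / x]. *)
Lemma resolvent_norm m (V : 'M[R]_(n, m)) :
  x ^+ 2 * frob (Q *m V) (Q *m V) <= frob V V.
Proof.
set W := Q *m V; have -> : V = A *m W + x *: W.
  by rewrite -mul_scalar_mx -mulmxDl mulmxA mulmx_resolvent mul1mx.
rewrite !(frobDl, frobDr, frobZl, frobZr) (frobC (A *m W) W).
have := pA.2 _ W; have := frob_ge0 (A *m W); have := frob_ge0 W.
set a := frob _ _; set b := frob _ _; set c := frob _ _ => a0 b0 c0.
have := mulr_ge0 (ltW x0) c0; nra.
Qed.

Lemma resolvent_quad m (V : 'M[R]_(n, m)) :
  x * frob (Q *m V) (Q *m V) <= frob V (Q *m V).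
Proof.
set W := Q *m V; have -> : frob V W = frob (A *m W + x *: W) W.
  by rewrite -mul_scalar_mx -mulmxDl mulmxA mulmx_resolvent mul1mx.
by rewrite frobDl frobZl frobC lerDr pA.2.
Qed.

Lemma resolvent_quad_ge0 m (V : 'M[R]_(n, m)) : 0 <= frob V (Q *m V).
Proof.
by apply: le_trans (resolvent_quad V); rewrite mulr_ge0 ?frob_ge0// ltW.
Qed.

Lemma frob_resolvent : x ^+ 2 * frob Q Q <= n%:R.
Proof. by have := resolvent_norm 1%:M; rewrite mulmx1 frob1. Qed.

Lemma tr_resolvent_ge0 : 0 <= \tr Q.
Proof.
by have := resolvent_quad_ge0 1%:M; rewrite mulmx1 /frob trmx1 mul1mx.
Qed.

(** Cauchy-Schwarz against the identity turns the Frobenius bound into a bound on the trace, without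
    eigenvalues. *)
Lemma tr_resolvent_le : x * \tr Q <= n%:R.
Proof.
have h : \tr Q ^+ 2 <= n%:R * frob Q Q.
  by have := frob_cs 1%:M Q; rewrite frob1 {1}/frob trmx1 mul1mx.
have : (x * \tr Q) ^+ 2 <= n%:R ^+ 2.
  rewrite exprMn; apply: le_trans (ler_wpM2l (sqr_ge0 _) h) _.
  by rewrite mulrCA expr2 ler_wpM2l// frob_resolvent.
by rewrite ler_sqr// nnegrE ?mulr_ge0 ?tr_resolvent_ge0// ltW.
Qed.

End resolvent_theory.

(** By the resolvent identity the difference is [RA *m (B - A) *m RB], whose trace is the inner
    product of [B - A] with [RB *m RA]. Two powers of [x] come from the operator norm of [RB], two
    from [frob_resolvent]. After division by [n ^ 2] the right side is the normalised Frobenius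
    distance. *)
Lemma tr_resolvent_diff n (A B : 'M[R]_n) (x : R) : psd A -> psd B -> 0 < x ->
  x ^+ 4 * (\tr (resolvent A x) - \tr (resolvent B x)) ^+ 2
  <= n%:R * frob (A - B) (A - B).
Proof.
move=> pA pB x0; set RA := resolvent A x; set RB := resolvent B x.
have E : RA - RB = RA *m (B - A) *m RB.
  have -> : B - A = (B + x%:M) - (A + x%:M) by rewrite opprD addrACA subrr addr0.
  by rewrite mulmxBr mulmxBl mul_resolvent_mx// mul1mx -mulmxA mulmx_resolvent// mulmx1.
have -> : \tr RA - \tr RB = frob (B - A) (RB *m RA).
  by rewrite -linearB/= E -mulmxA mxtrace_mulC /frob linearB/= pA.1 pB.1 -mulmxA.
have h1 := frob_cs (B - A) (RB *m RA).
have -> : frob (A - B) (A - B) = frob (B - A) (B - A).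
  by rewrite -(opprB B A) -scaleN1r frobZl frobZr mulrA mulrNN mulr1 mul1r.
have h2 := resolvent_norm pB x0 RA; have h3 := frob_resolvent pA x0.
rewrite -/RA -/RB in h2 h3.
apply: le_trans (ler_wpM2l (exprn_ge0 4 (ltW x0)) h1) _.
rewrite mulrCA mulrC ler_wpM2r ?frob_ge0//.
apply: le_trans h3; rewrite (exprD _ 2 2) -mulrA ler_wpM2l ?sqr_ge0//.
Qed.

(** * Removal of one column, and the companion matrix [Y *m Y^T] *)

Section leave_one_out.
Variables (n p : nat) (Y : 'M[R]_(n, p)) (x : R).
Hypothesis x0 : 0 < x.

(** Zeroing the column instead of deleting it keeps the type; the product with the transpose is the
    same. *)
Definition zero_col (k : 'I_p) : 'M[R]_(n, p) :=
  \matrix_(i, l) if l == k then 0 else Y i l.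

Let Qx := resolvent (Y *m Y^T) x.
Let Qk k := resolvent (zero_col k *m (zero_col k)^T) x.

Definition loo_quad k := frob (col k Y) (Qk k *m col k Y).

Lemma gram_zero_col k :
  Y *m Y^T = zero_col k *m (zero_col k)^T + col k Y *m (col k Y)^T.
Proof.
apply/matrixP => i j; rewrite !mxE (bigD1 k)//= [X in _ = X + _](bigD1 k)//=.
rewrite !mxE eqxx mul0r add0r big_ord1 !mxE addrC; congr (_ + _).
by apply: eq_bigr => l lk; rewrite !mxE (negbTE lk).
Qed.

Let pQ : psd (Y *m Y^T) := psd_gramT Y.
Let pQk k : psd (zero_col k *m (zero_col k)^T) := psd_gramT (zero_col k).

Lemma loo_quad_ge0 k : 0 <= loo_quad k.
Proof. exact: resolvent_quad_ge0. Qed.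

Lemma resolvent_loo k : Qx = Qk k - Qx *m col k Y *m (col k Y)^T *m Qk k.
Proof.
have : Qx *m (Y *m Y^T + x%:M) *m Qk k =
       Qx *m (zero_col k *m (zero_col k)^T + x%:M) *m Qk k
       + Qx *m col k Y *m (col k Y)^T *m Qk k.
  by rewrite (gram_zero_col k) addrAC mulmxDr mulmxDl !mulmxA.
rewrite mul_resolvent_mx// mul1mx -mulmxA mulmx_resolvent// mulmx1 => E.
by rewrite [X in X - _]E addrK.
Qed.

(** The Sherman-Morrison formula applied to the removed column, written without division. *)
Lemma mul_resolvent_loo k :
  (1 + loo_quad k) *: (Qx *m col k Y) = Qk k *m col k Y.
Proof.
have := congr1 (mulmx^~ (col k Y)) (resolvent_loo k).
rewrite mulmxBl -!mulmxA.
have -> : (col k Y)^T *m (Qk k *m col k Y) = (loo_quad k)%:M.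
  by rewrite /loo_quad /frob /mxtrace big_ord1 -mx11_scalar.
by rewrite mul_mx_scalar -scalemxAr scalerDl scale1r => {1}->; rewrite subrK.
Qed.

Lemma quad_resolvent k :
  1 - frob (col k Y) (Qx *m col k Y) = (1 + loo_quad k)^-1.
Proof.
have t0 : 0 < 1 + loo_quad k by rewrite ltr_wpDr ?loo_quad_ge0.
have := congr1 (frob (col k Y)) (mul_resolvent_loo k).
rewrite frobZr -/(loo_quad k) => E; apply: (mulfI (lt0r_neq0 t0)).
by rewrite mulrBr E mulr1 addrK divff// lt0r_neq0.
Qed.

(** The difference of traces is [frob (Qk k *m y) (Qk k *m y) / (1 + loo_quad k)] with
    [y := col k Y], and [resolvent_quad] bounds [x] times the numerator by [loo_quad k]. A rank-one
    change costs at most [1 / x], whatever the dimension. *)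
Lemma tr_resolvent_loo k :
  0 <= x * (\tr (Qk k) - \tr Qx) <= 1.
Proof.
have t0 : 0 < 1 + loo_quad k by rewrite ltr_wpDr ?loo_quad_ge0.
have -> : \tr (Qk k) - \tr Qx =
    frob (Qk k *m col k Y) (Qk k *m col k Y) / (1 + loo_quad k).
  rewrite {1}(resolvent_loo k) linearB/= opprB addrC subrK -!mulmxA mulmxA mxtrace_mulC.
  rewrite -(mul_resolvent_loo k) frobZl frobC.
  rewrite [in RHS]mulrC mulrA mulVf ?lt0r_neq0// mul1r mul_resolvent_loo.
  by rewrite /frob trmx_mul resolvent_sym// mulmxA.
rewrite mulrA divr_ge0 ?mulr_ge0 ?frob_ge0 ?(ltW x0) ?(ltW t0)//=.
rewrite ler_pdivrMr// mul1r.
by apply: le_trans (resolvent_quad (pQk k) x0 _) _; rewrite lerDr.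
Qed.

Lemma push_through : Y *m resolvent (Y^T *m Y) x = Qx *m Y.
Proof.
have E : (Y *m Y^T + x%:M) *m Y = Y *m (Y^T *m Y + x%:M).
  by rewrite mulmxDl mulmxDr mul_scalar_mx mul_mx_scalar mulmxA.
rewrite -[LHS]mul1mx -(mul_resolvent_mx pQ x0) -/Qx -mulmxA; congr (_ *m _).
by rewrite mulmxA E -mulmxA mulmx_resolvent ?mulmx1//; exact: psd_gram.
Qed.

(** By [push_through], [x] times the resolvent of the Gram matrix is the identity minus
    [Y^T *m Qx *m Y], whose diagonal is given by [quad_resolvent]. This exact identity is the origin
    of the approximate quadratic equation. *)
Lemma tr_gram_resolvent :
  x * \tr (resolvent (Y^T *m Y) x) = \sum_k (1 + loo_quad k)^-1.
Proof.
have pG := psd_gram Y; have push := push_through.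
have -> : x * \tr (resolvent (Y^T *m Y) x) = p%:R - \tr (Y^T *m Qx *m Y).
  rewrite -mulmxA -push mulmxA -(mxtrace1 R p) -(mulmx_resolvent pG x0) -linearB/=.
  by rewrite -mulmxBl addrC addKr mul_scalar_mx linearZ.
transitivity (\sum_k (1 - frob (col k Y) (Qx *m col k Y))).
  rewrite big_split/= sumr_const card_ord sumrN; congr (_ - _).
  apply: eq_bigr => k _; rewrite /frob /mxtrace big_ord1 -mulmxA !mxE.
  apply: eq_bigr => i _; rewrite !mxE; congr (_ * _).
  by apply: eq_bigr => j _; rewrite mxE.
by apply: eq_bigr => k _; rewrite quad_resolvent.
Qed.

(** The two Gram matrices share their nonzero eigenvalues, and each surplus zero contributes 1;
    cyclicity of the trace replaces this count in the proof. *)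
Lemma tr_resolvent_gramT :
  x * \tr Qx = x * \tr (resolvent (Y^T *m Y) x) + n%:R - p%:R.
Proof.
have -> : x * \tr Qx = n%:R - \tr (Qx *m (Y *m Y^T)).
  rewrite -(mxtrace1 R n) -(mul_resolvent_mx pQ x0) -linearB/=.
  by rewrite -mulmxBr addrC addKr mul_mx_scalar linearZ.
have pG := psd_gram Y; have push := push_through.
rewrite mulmxA -push -mulmxA mxtrace_mulC -mulmxA.
have -> : x * \tr (resolvent (Y^T *m Y) x) =
    p%:R - \tr (resolvent (Y^T *m Y) x *m (Y^T *m Y)).
  rewrite -(mxtrace1 R p) -(mul_resolvent_mx pG x0) -linearB/=.
  by rewrite -mulmxBr addrC addKr mul_mx_scalar linearZ.
by ring.
Qed.

End leave_one_out.

End frobenius.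

(** * Eigenvalues of real symmetric matrices *)

Section spectrum.
Context {R : realType} {p : nat}.
Implicit Types A : 'M[R]_p.

(** [eigenvalues A] is known only through the characteristic polynomial, hence up to order. The
    spectral theorem is applied to the complexified matrix, whose diagonal form is real because the
    matrix is hermitian, and the identities are pulled back along the injective embedding [f]. *)
Lemma sym_spectral_seq A : A^T = A -> exists s : seq R,
  [/\ perm_eq (eigenvalues A) s, size s = p, \sum_(l <- s) l = \tr A
    & forall x, A + x%:M \in unitmx -> (forall l, l \in s -> l + x != 0) ->
      \sum_(l <- s) (l + x)^-1 = \tr (resolvent A x)].
Proof.
move=> sA; pose f := real_complex R; pose Ac := map_mx f A.
have hA : Ac \is hermsymmx.
  apply: realsym_hermsym.
    by apply/is_hermitianmxP; rewrite expr0 scale1r map_mx_id// map_trmx sA.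
  by apply/mxOverP => i j; rewrite mxE; apply/complex_realP; exists (A i j).
have fD (a b : R) : f (a + b) = f a + f b by exact: (rmorphD (real_complex R)).
have fM (a b : R) : f (a * b) = f a * f b by exact: (rmorphM (real_complex R)).
have f1 : f 1 = 1 by exact: (rmorph1 (real_complex R)).
have dR := hermitian_spectral_diag_real hA.
have /orthomx_spectralP AE := hermitian_normalmx hA.
have uP := spectral_unit Ac.
move: (spectral_diag Ac) (spectralmx Ac) uP dR AE => D P uP dR AE.
have DE i : D ord0 i = f (complex.Re (D ord0 i)).
  by rewrite /f RRe_real//; move/mxOverP: dR; exact.
exists [seq complex.Re (D ord0 i) | i : 'I_p]; split.
- apply: prod_XsubC_eq; rewrite -symmetric_eigenvaluesP//.
  apply: (map_poly_inj f); rewrite map_char_poly -/Ac {}AE.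
  rewrite char_poly_conj// char_poly_trig ?diag_mx_is_trig//.
  rewrite rmorph_prod big_image/=; apply: eq_bigr => i _.
  by rewrite rmorphB/= map_polyX map_polyC/= mxE eqxx mulr1n -/f -DE.
- by rewrite size_image card_ord.
- apply: (fmorph_inj f); rewrite -trace_map_mx -/Ac AE mxtrace_mulC mulmxA.
  rewrite mulmxV// mul1mx mxtrace_diag rmorph_sum big_image/=.
  by apply: eq_bigr => i _; rewrite [RHS]DE.
- move=> x uA lx; apply: (fmorph_inj f); rewrite -trace_map_mx map_invmx map_mxD.
  rewrite -/Ac map_scalar_mx/= AE.
  have -> : invmx P *m diag_mx D *m P + (f x)%:M =
     invmx P *m (diag_mx D + (f x)%:M) *m P.
    by rewrite mulmxDr mulmxDl scalar_mxC -[X in _ = _ + X]mulmxA mulVmx// mulmx1.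
  have E : diag_mx D + (f x)%:M = diag_mx (\row_i f (complex.Re (D ord0 i) + x)).
    apply/matrixP => i j; rewrite !mxE fD [in LHS]DE.
    by case: eqP => _; rewrite ?mulr1n ?mulr0n ?addr0.
  have E' : (diag_mx D + (f x)%:M) *m diag_mx (\row_i f (complex.Re (D ord0 i) + x)^-1) = 1%:M.
    rewrite E mulmx_diag; apply/matrixP => i j; rewrite !mxE -fM divff ?f1//.
    by apply: lx; apply/mapP; exists i => //; rewrite mem_enum.
  set M := invmx P *m _ *m P; set Di := diag_mx (\row__ _) in E'.
  have MZ : M *m (invmx P *m Di *m P) = 1%:M.
    rewrite !mulmxA -[_ *m P *m invmx P]mulmxA mulmxV// mulmx1.
    by rewrite -[_ *m _ *m Di]mulmxA E' mulmx1 mulVmx.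
  have -> : invmx M = invmx P *m Di *m P.
    by rewrite -[RHS]mul1mx -(mulVmx (mulmx1_unit MZ).1) -mulmxA MZ mulmx1.
  rewrite mxtrace_mulC mulmxA mulmxV// mul1mx.
  rewrite mxtrace_diag rmorph_sum big_image/=.
  by apply: eq_bigr => i _; rewrite mxE.
Qed.

Lemma psd_eigenvalues_ge0 A : psd A -> forall l, l \in eigenvalues A -> 0 <= l.
Proof.
move=> [sA pA] l ls.
have : root (char_poly A) l.
  rewrite symmetric_eigenvaluesP//; apply/rootP.
  by rewrite horner_prod (big_rem l)//= !hornerE subrr mul0r.
rewrite -eigenvalue_root_char => /eigenvalueP[v vA v0].
have := pA _ v^T; have -> : A *m v^T = (v *m A)^T by rewrite trmx_mul sA.
rewrite vA linearZ/= frobZr pmulr_lge0// lt_neqAle frob_ge0 andbT eq_sym.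
apply: contra v0 => /eqP/frob_eq0 v0; by rewrite -[v]trmxK v0 trmx0.
Qed.

Lemma size_eigenvalues A : A^T = A -> size (eigenvalues A) = p.
Proof. by move=> /sym_spectral_seq[s [/perm_size -> ->]]. Qed.

Lemma sum_inv_eigenvalues A x : psd A -> 0 < x ->
  \sum_(l <- eigenvalues A) (l + x)^-1 = \tr (resolvent A x).
Proof.
move=> pA x0; have [s [ps _ _ <-]] := sym_spectral_seq pA.1.
- exact: perm_big.
- exact: resolvent_unit.
- move=> l; rewrite -(perm_mem ps) => /(psd_eigenvalues_ge0 pA) l0.
  by rewrite gt_eqF// ltr_wpDl.
Qed.

End spectrum.

(** * Expectations and moments *)

Section expectation.
Context {dT : measure_display} {T : measurableType dT} {R : realType}.
Variable P : probability T R.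
Implicit Types f g h : T -> R.

Definition itg f := P.-integrable [set: T] (EFin \o f).
Definition EE f : R := \int[P]_x f x.

Lemma itg_mfun f : itg f -> measurable_fun [set: T] f.
Proof. by move=> /measurable_int /measurable_EFinP. Qed.

Lemma itg_cst (c : R) : itg (fun=> c).
Proof. exact: finite_measure_integrable_cst. Qed.

Lemma itgD f g : itg f -> itg g -> itg (fun x => f x + g x).
Proof. by move=> hf hg; exact: integrableD hf hg. Qed.

Lemma itgZ (c : R) f : itg f -> itg (fun x => c * f x).
Proof. by move=> hf; exact: (integrableZl measurableT c hf). Qed.

Lemma itgB f g : itg f -> itg g -> itg (fun x => f x - g x).
Proof. by move=> hf hg; exact: integrableB hf hg. Qed.

Lemma itg_sum (I : Type) (r : seq I) (Q : pred I) (F : I -> T -> R) :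
  (forall i, Q i -> itg (F i)) -> itg (fun x => \sum_(i <- r | Q i) F i x).
Proof.
move=> hF; have := @integrable_sum _ _ _ P setT measurableT _ r Q (fun i => EFin \o F i) hF.
by rewrite /itg; congr (_.-integrable _ _); apply/funext => x; rewrite /= sumEFin.
Qed.

Lemma itg_le f g : measurable_fun [set: T] f -> (forall x, `|f x| <= g x) ->
  itg g -> itg f.
Proof.
move=> mf fg; apply: le_integrable => //; first exact/measurable_EFinP.
move=> x _ /=; rewrite lee_fin; apply: le_trans (fg x) _; exact: ler_norm.
Qed.

Lemma itg_abs f : itg f -> itg (fun x => `|f x|).
Proof. by move=> hf; exact: integrable_abse hf. Qed.

Lemma itg_bounded f (c : R) : measurable_fun [set: T] f ->
  (forall x, `|f x| <= c) -> itg f.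
Proof. by move=> mf fc; apply: (@itg_le _ (fun=> c)) => //; exact: itg_cst. Qed.

Lemma EE_cst (c : R) : EE (fun=> c) = c.
Proof. rewrite /EE Rintegral_cst// [X in _ * X](_ : _ = 1) ?mulr1//.
by rewrite -[RHS]/(fine 1%E); congr fine; exact: probability_setT. Qed.

Lemma EED f g : itg f -> itg g -> EE (fun x => f x + g x) = EE f + EE g.
Proof. by move=> hf hg; exact: RintegralD. Qed.

Lemma EEB f g : itg f -> itg g -> EE (fun x => f x - g x) = EE f - EE g.
Proof. by move=> hf hg; exact: RintegralB. Qed.

(** One of the two parts has infinite integral, so their difference is infinite, by convention also
    when both are, and [fine] sends it to 0. *)
Lemma EE_nonitg f : measurable_fun [set: T] f -> ~ itg f -> EE f = 0.
Proof.
move=> mf nf; have mf' : measurable_fun [set: T] (EFin \o f) by exact/measurable_EFinP.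
rewrite /EE /Rintegral integralE.
set a := integral _ _ _; set b := integral _ _ _.
have a0 : (0 <= a)%E by apply: integral_ge0.
have b0 : (0 <= b)%E by apply: integral_ge0.
have : (a + b = +oo)%E.
  apply/eqP; rewrite -leye_eq leNgt; apply/negP => h; apply: nf.
  apply/integrableP; split => //.
  have -> : (fun x => `|(EFin \o f) x|)%E = (fun x => (EFin \o f)^\+ x + (EFin \o f)^\- x)%E.
    by apply/funext => x; rewrite -/((abse \o (EFin \o f)) x) fune_abse.
  rewrite ge0_integralD//; first exact: measurable_funepos.
  exact: measurable_funeneg.
by case: a a0 => [a| |]//; case: b b0 => [b| |].
Qed.

(** Free of integrability, so that it applies to sections of the kernel, which need not be
    integrable for every value of the fixed coordinates. *)
Lemma EEZ (c : R) f : measurable_fun [set: T] f -> EE (fun x => c * f x) = c * EE f.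
Proof.
move=> mf; have [->|c0] := eqVneq c 0.
  by rewrite mul0r -[RHS](EE_cst 0); congr EE; apply/funext => x; rewrite mul0r.
have [hf|nf] := pselect (itg f); first exact: RintegralZl.
rewrite (EE_nonitg mf nf) mulr0; apply: EE_nonitg; first exact: measurable_funM.
move=> /(itgZ c^-1) h; apply: nf; move: h; congr itg; apply/funext => x.
by rewrite mulKf.
Qed.

Lemma EE_sum (I : Type) (r : seq I) (Q : pred I) (F : I -> T -> R) :
  (forall i, Q i -> itg (F i)) ->
  EE (fun x => \sum_(i <- r | Q i) F i x) = \sum_(i <- r | Q i) EE (F i).
Proof.
move=> hF; elim: r => [|i r ih].
  by rewrite big_nil -[RHS](EE_cst 0); congr EE; apply/funext => x; rewrite big_nil.
rewrite big_cons; under [in LHS]eq_fun do rewrite big_cons.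
have [Qi|_] := boolP (Q i); last exact: ih.
by rewrite EED ?ih//; [exact: hF|exact: itg_sum].
Qed.

Lemma EE_le f g : itg f -> itg g -> (forall x, f x <= g x) -> EE f <= EE g.
Proof. by move=> hf hg fg; apply: le_Rintegral. Qed.

Lemma EE_ge0 f : (forall x, 0 <= f x) -> 0 <= EE f.
Proof. by move=> f0; exact: Rintegral_ge0. Qed.

Lemma EE_EFin f : itg f -> (EE f)%:E = (\int[P]_x (f x)%:E)%E.
Proof. by move=> hf; rewrite /EE /Rintegral fineK// integrable_fin_num. Qed.

Lemma EE_markov f (e : R) : itg f -> (forall x, 0 <= f x) -> 0 < e ->
  (P [set x | (e < f x)%R] <= (e^-1 * EE f)%:E)%E.
Proof.
move=> hf f0 e0; have mf := itg_mfun hf.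
have mA : measurable [set x | e < f x].
  rewrite -[X in measurable X]setTI; have := mf measurableT `]e, +oo[%classic (measurable_itv _).
  by congr measurable; apply/seteqP; split => x /=; rewrite in_itv/= andbT.
have hI : itg (fun x => \1_[set x | e < f x] x : R).
  apply: (@itg_bounded _ 1); first exact: measurable_indic.
  by move=> x; rewrite indicE normr_nat lern1 leq_b1.
have E : P [set x | e < f x] = (EE (fun x => \1_[set x | e < f x] x))%:E.
  by rewrite EE_EFin// integral_indic// setIT.
rewrite E lee_fin -EEZ//; apply: EE_le => //; first exact: itgZ.
move=> x; rewrite indicE ler_pdivlMl//; case: (boolP (x \in _)) => [|_].
  by rewrite inE/= mulr1 => /ltW.
by rewrite mulr0.
Qed.

Lemma sqr_EE_le f : measurable_fun [set: T] f -> itg (fun x => f x ^+ 2) ->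
  EE f ^+ 2 <= EE (fun x => f x ^+ 2).
Proof.
move=> mf h2; have hf : itg f.
  apply: (@itg_le _ (fun x => 1 + f x ^+ 2)) => //; last by apply: itgD => //; exact: itg_cst.
  move=> x; have -> : f x ^+ 2 = `|f x| ^+ 2 by rewrite real_normK// num_real.
  have := sqr_ge0 (`|f x| - 1); have := normr_ge0 (f x); nra.
have : 0 <= EE (fun x => f x ^+ 2 + (- (EE f *+ 2)) * f x + EE f ^+ 2).
  by apply: EE_ge0 => x; have := sqr_ge0 (f x - EE f); congr (_ <= _); ring.
rewrite EED; [|by apply: itgD => //; exact: itgZ|exact: itg_cst].
rewrite EED//; [|exact: itgZ].
rewrite EEZ// EE_cst; set a := EE f; set b := EE _; nra.
Qed.

(* Orders are powers of 2, so that products are controlled by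
   [2 * x * y <= x ^+ 2 + y ^+ 2] alone. *)
Definition mom k f := measurable_fun [set: T] f /\ itg (fun x => f x ^+ (2 ^ k)).

Lemma mom0 f : mom 0 f <-> itg f.
Proof.
rewrite /mom expn0; split=> [[_]//|hf]; split => //; exact: itg_mfun.
Qed.

Lemma pow2_expS (x : R) k : x ^+ (2 ^ k.+1) = (x ^+ (2 ^ k)) ^+ 2.
Proof. by rewrite expnSr exprM. Qed.

Lemma pow2_expS_ge0 (x : R) k : 0 <= x ^+ (2 ^ k.+1).
Proof. by rewrite pow2_expS sqr_ge0. Qed.

Lemma momM k f g : mom k.+1 f -> mom k.+1 g -> mom k (fun x => f x * g x).
Proof.
move=> [mf hf] [mg hg]; split; first exact: measurable_funM.
apply: (@itg_le _ (fun x => f x ^+ (2 ^ k.+1) + g x ^+ (2 ^ k.+1))).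
- by apply: measurable_funX; exact: measurable_funM.
- move=> x; rewrite exprMn !pow2_expS normrM.
  set a := f x ^+ _; set b := g x ^+ _.
  rewrite -(ger0_norm (sqr_ge0 a)) -(ger0_norm (sqr_ge0 b)) !normrX.
  have := sqr_ge0 (`|a| - `|b|); have := normr_ge0 a; have := normr_ge0 b; nra.
- exact: itgD.
Qed.

Lemma momS k f : mom k.+1 f -> mom k f.
Proof.
move=> h; suff : mom k (fun x => f x * 1) by under eq_fun do rewrite mulr1.
apply: momM => //; split => //; exact: itg_cst.
Qed.

Lemma momZ k (c : R) f : mom k f -> mom k (fun x => c * f x).
Proof.
move=> [mf hf]; split; first exact: measurable_funM.
by under eq_fun do rewrite exprMn; exact: itgZ.
Qed.

Lemma momD k f g : mom k f -> mom k g -> mom k (fun x => f x + g x).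
Proof.
move=> [mf hf] [mg hg]; split; first exact: measurable_funD.
(* For [k = 0] the exponent is 1 and the powers need not be nonnegative; integrability is then
   additive directly. *)
case: k hf hg => [|k] hf hg; first by rewrite expn0; exact: itgD.
apply: (@itg_le _ (fun x => 2 ^+ (2 ^ k.+1) * (f x ^+ (2 ^ k.+1) + g x ^+ (2 ^ k.+1)))).
- by apply: measurable_funX; exact: measurable_funD.
- move=> x; rewrite -[X in `|X|]ger0_norm ?pow2_expS_ge0// normr_id normrX.
  have [fg|/ltW gf] := leP `|f x| `|g x|.
    apply: (@le_trans _ _ ((2 * `|g x|) ^+ (2 ^ k.+1))).
      rewrite lerXn2r// ?nnegrE ?mulr_ge0// (le_trans (ler_normD _ _))//; lra.
    rewrite exprMn ler_wpM2l ?exprn_ge0// -normrX ger0_norm ?pow2_expS_ge0//.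
    by rewrite lerDr pow2_expS_ge0.
  apply: (@le_trans _ _ ((2 * `|f x|) ^+ (2 ^ k.+1))).
    rewrite lerXn2r// ?nnegrE ?mulr_ge0// (le_trans (ler_normD _ _))//; lra.
  rewrite exprMn ler_wpM2l ?exprn_ge0// -normrX ger0_norm ?pow2_expS_ge0//.
  by rewrite lerDl pow2_expS_ge0.
- by apply: itgZ; exact: itgD.
Qed.

Lemma mom_cst k (c : R) : mom k (fun=> c).
Proof. by split => //; exact: itg_cst. Qed.

Lemma momB k f g : mom k f -> mom k g -> mom k (fun x => f x - g x).
Proof.
move=> hf hg; suff : mom k (fun x => f x + (-1) * g x).
  by under eq_fun do rewrite mulN1r.
by apply: momD => //; exact: momZ.
Qed.

Lemma mom_sum k (I : Type) (r : seq I) (Q : pred I) (F : I -> T -> R) :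
  (forall i, Q i -> mom k (F i)) -> mom k (fun x => \sum_(i <- r | Q i) F i x).
Proof.
move=> hF; elim: r => [|i r ih].
  by under eq_fun do rewrite big_nil; exact: mom_cst.
under eq_fun do rewrite big_cons.
by have [Qi|//] := boolP (Q i); apply: momD => //; exact: hF.
Qed.

Lemma momMb k f g (c : R) : mom k f -> measurable_fun [set: T] g ->
  (forall x, `|g x| <= c) -> mom k (fun x => g x * f x).
Proof.
move=> [mf hf] mg gc; split; first exact: measurable_funM.
apply: (@itg_le _ (fun x => c ^+ (2 ^ k) * `|f x ^+ (2 ^ k)|)).
- by apply: measurable_funX; exact: measurable_funM.
- move=> x; rewrite exprMn normrM ler_wpM2r// normrX lerXn2r// nnegrE//.
  exact: le_trans (gc x).
- by apply: itgZ; exact: itg_abs.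
Qed.

Lemma mom_bounded k f (c : R) : measurable_fun [set: T] f ->
  (forall x, `|f x| <= c) -> mom k f.
Proof.
move=> mf fc; suff : mom k (fun x => f x * 1) by under eq_fun do rewrite mulr1.
exact: (momMb (mom_cst k 1) mf fc).
Qed.

Lemma mom_itg k f : mom k f -> itg f.
Proof. by elim: k => [/mom0//|k ih /momS]. Qed.

Lemma mom1_sqr f : mom 1 f -> itg (fun x => f x ^+ 2).
Proof. by case. Qed.

End expectation.

(** * Independence by resampling *)

Section law.
Context {dX dY : measure_display} {X : measurableType dX} {Y : measurableType dY}.
Context {R : realType}.
Variables (P : probability X R) (Q : probability Y R) (h : X -> Y).
Hypothesis mh : measurable_fun [set: X] h.
Hypothesis lawh : forall A, measurable A -> P (h @^-1` A) = Q A.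

Lemma law_integral (f : Y -> \bar R) : measurable_fun [set: Y] f ->
  (\int[P]_x f (h x) = \int[Q]_y f y)%E.
Proof.
move=> mf; pose hm : {mfun X >-> Y} := HB.pack h (isMeasurableFun.Build _ _ _ _ h mh).
have ge0 (f' : Y -> \bar R) : measurable_fun [set: Y] f' -> (forall y, (0 <= f' y)%E) ->
    (\int[P]_x f' (h x) = \int[Q]_y f' y)%E.
  move=> mf' f0; have <- := @ge0_integral_distribution _ _ _ _ _ P hm f' mf' f0.
  by apply: eq_measure_integral => A mA _; exact: lawh.
rewrite integralE [RHS]integralE; congr (_ - _)%E.
  rewrite -ge0//; last exact: measurable_funepos.
  by apply: eq_integral => x _; rewrite -/((f \o h) x) funepos_comp.
rewrite -ge0//; last exact: measurable_funeneg.
by apply: eq_integral => x _; rewrite -/((f \o h) x) funeneg_comp.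
Qed.

Lemma law_EE (f : Y -> R) : measurable_fun [set: Y] f ->
  EE P (fun x => f (h x)) = EE Q f.
Proof.
move=> mf; rewrite /EE /Rintegral -(@law_integral (EFin \o f))//.
exact/measurable_EFinP.
Qed.

Lemma law_itg (f : Y -> R) : measurable_fun [set: Y] f ->
  itg P (fun x => f (h x)) <-> itg Q f.
Proof.
move=> mf; have mf' : measurable_fun [set: Y] (EFin \o f) by exact/measurable_EFinP.
have E := @law_integral (fun y => `|(f y)%:E|)%E (measurableT_comp (@abse_measurable _ _) mf').
split=> /integrableP[_ fi]; apply/integrableP; split => //.
- by rewrite -E.
- exact: measurableT_comp mf' mh.
- by move: fi; rewrite -E.
Qed.

Lemma law_mom k (f : Y -> R) : measurable_fun [set: Y] f ->
  mom P k (fun x => f (h x)) <-> mom Q k f.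
Proof.
move=> mf; split=> -[m1 i1]; split => //.
- by apply/(@law_itg (fun y => f y ^+ _)) => //; exact: measurable_funX.
- exact: measurableT_comp mf mh.
- by apply/(@law_itg (fun y => f y ^+ _)) => //; exact: measurable_funX.
Qed.

End law.

(** * Product laws on tuples *)

Section iid_tuples.
Context {dS : measure_display} {S : measurableType dS} {R : realType}.
Variable m : probability S R.

Definition box N (A : 'I_N -> set S) : set (N.-tuple S) :=
  [set t | forall i, A i (tnth t i)].

Lemma measurable_box N (A : 'I_N -> set S) : (forall i, measurable (A i)) ->
  measurable (box A).
Proof.
move=> mA; have -> : box A = \bigcap_(i in [set: 'I_N]) ((@tnth _ S)^~ i @^-1` A i).
  by apply/seteqP; split => [t h i _|t h i]; [exact: h|exact: (h i I)].
apply: fin_bigcap_measurable => // i _; rewrite -[X in measurable X]setTI.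
by apply: measurable_tnth.
Qed.

(** The joint law is prescribed on boxes only. With [h := id] it says that the measure on tuples is
    itself the product law, which is thus characterised instead of constructed. *)
Definition iid_map {dX} {X : measurableType dX} (P : probability X R) N
    (h : X -> N.-tuple S) :=
  measurable_fun [set: X] h /\ forall A : 'I_N -> set S,
    (forall i, measurable (A i)) -> P (h @^-1` box A) = (\prod_i m (A i))%E.

(** Boxes are stable under intersection and generate the sigma-algebra of tuples, so laws that agree
    on them coincide. *)
Lemma iid_map_law {dX} {X : measurableType dX} (P : probability X R) N
    (h : X -> N.-tuple S) (mu : probability (N.-tuple S) R) :
  iid_map P h -> iid_map mu id ->
  forall A, measurable A -> P (h @^-1` A) = mu A.
Proof.
move=> [mh hP] [_ hmu] A mA.
pose hm : {mfun X >-> (N.-tuple S)} := HB.pack h (isMeasurableFun.Build _ _ _ _ h mh).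
pose G := [set B | exists2 A : 'I_N -> set S, (forall i, measurable (A i)) & B = box A].
have boxT : box (fun=> setT) = setT :> set (N.-tuple S) by apply/seteqP; split.
apply: (@g_sigma_algebra_measure_unique _ _ _ G _ (fun=> setT) _ _
  (distribution P hm) mu).
- by move=> _ [B mB ->]; exact: measurable_box.
- by move=> _; exists (fun=> setT).
- by rewrite bigcup_const//; exists 0%N.
- move=> _ _ [B mB ->] [C mC ->]; exists (fun i => B i `&` C i).
    by move=> i; exact: measurableI.
  apply/seteqP; split => [t [hB hC] i|t hBC]; first by split; [exact: hB|exact: hC].
  by split => i; case: (hBC i).
- by move=> _ [B mB ->]; rewrite [LHS]hP// -hmu.
- by move=> _; rewrite ltey_eq fin_num_measure.
- move: A mA; apply: smallest_sub; first exact: smallest_sigma_algebra.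
  case: N => [|N] in mu hmu h hP mh hm G boxT *; first by rewrite big_ord0.
  rewrite -bigcup_mkord_ord => _ [i _ [B mB <-]]; apply: sub_sigma_algebra.
  exists (fun j => if j == inord i then B else setT).
    by move=> j; case: ifP.
  rewrite setTI; apply/seteqP; split => [t Bt j|t /(_ (inord i))]; last by rewrite eqxx.
  by case: eqP => // ->.
Qed.

(* Resampling: with [z'] an independent copy of [z], averaging over [z'] is the
   conditional expectation given the coordinates in [J]. *)
Definition mix N (J : pred 'I_N) (z z' : N.-tuple S) : N.-tuple S :=
  [tuple if J i then tnth z i else tnth z' i | i < N].

Lemma iid_mix N (mu : probability (N.-tuple S) R) (J : pred 'I_N) :
  iid_map mu id ->
  iid_map (mu \x mu)%E (fun zz : N.-tuple S * N.-tuple S => mix J zz.1 zz.2).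
Proof.
move=> [_ hmu]; split.
  apply/measurable_fun_tnthP => i.
  rewrite (_ : _ \o _ = fun zz => if J i then tnth zz.1 i else tnth zz.2 i); last first.
    by apply/funext => zz; rewrite /= tnth_mktuple.
  by case: (J i); apply: measurableT_comp (measurable_tnth i) _.
(* The preimage of a box is a rectangle: [A1] constrains the kept coordinates in the first tuple,
   [A2] the others in the second. *)
move=> A mA; pose A1 i := if J i then A i else setT.
pose A2 i := if J i then setT else A i.
have mA1 i : measurable (A1 i) by rewrite /A1; case: ifP.
have mA2 i : measurable (A2 i) by rewrite /A2; case: ifP.
have -> : (fun zz : N.-tuple S * N.-tuple S => mix J zz.1 zz.2) @^-1` box A =
          box A1 `*` box A2.
  apply/seteqP; split => [[z z'] /= h|[z z'] /= [h1 h2] i].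
    by split => i; have /= := h i; rewrite tnth_mktuple /A1 /A2; case: ifP.
  rewrite tnth_mktuple; have := h1 i; have := h2 i; rewrite /A1 /A2.
  by case: ifP.
transitivity (mu (box A1) * mu (box A2))%E.
  by apply: product_measure1E; exact: measurable_box.
rewrite -[box A1]/(id @^-1` box A1) -[box A2]/(id @^-1` box A2) !hmu//.
rewrite -big_split/=; apply: eq_bigr => i _; rewrite /A1 /A2.
by case: ifP => _; rewrite probability_setT ?mul1e ?mule1.
Qed.

Lemma iid_sub {dX} {X : measurableType dX} (P : probability X R) N k
    (h : X -> N.-tuple S) (f : 'I_k -> 'I_N) : injective f -> iid_map P h ->
  iid_map P (fun x => [tuple tnth (h x) (f j) | j < k]).
Proof.
move=> fI [mh hP]; split.
  apply/measurable_fun_tnthP => j.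
  rewrite (_ : _ \o _ = fun x => tnth (h x) (f j)); last first.
    by apply/funext => zz; rewrite /= tnth_mktuple.
  exact: measurableT_comp (measurable_tnth _) mh.
(* Coordinates outside the image of [f] are left free and contribute factors 1. *)
move=> A mA; pose A' i := if [pick j | f j == i] is Some j then A j else setT.
have mA' i : measurable (A' i) by rewrite /A'; case: pickP.
have A'f j : A' (f j) = A j.
  by rewrite /A'; case: pickP => [k' /eqP/fI->//|/(_ j)]; rewrite eqxx.
have -> : (fun x => [tuple tnth (h x) (f j) | j < k]) @^-1` box A = h @^-1` box A'.
  apply/seteqP; split => [x /= hx i|x /= hx j].
    by rewrite /A'; case: pickP => // j /eqP <-; have := hx j; rewrite tnth_mktuple.
  by rewrite tnth_mktuple -A'f; exact: hx.
rewrite hP// (bigID (mem (codom f)))/= [X in (_ * X)%E]big1 ?mule1; last first.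
  move=> i /negP fi; rewrite /A'; case: pickP => [j /eqP fj|_].
    by exfalso; apply: fi; rewrite -fj codom_f.
  exact: probability_setT.
rewrite -(big_uniq _)/=; last by rewrite map_inj_uniq ?enum_uniq.
rewrite big_map; rewrite big_enum/=; apply: eq_bigr => j _; by rewrite A'f.
Qed.

Lemma iid_coord {dX} {X : measurableType dX} (P : probability X R) N
    (h : X -> N.-tuple S) (i : 'I_N) : iid_map P h ->
  measurable_fun [set: X] (fun x => tnth (h x) i) /\
  forall A, measurable A -> P ((fun x => tnth (h x) i) @^-1` A) = m A.
Proof.
move=> [mh hP]; split; first exact: measurableT_comp (measurable_tnth _) mh.
move=> A mA; rewrite (_ : _ @^-1` _ = h @^-1` box (fun j => if j == i then A else setT)).
  rewrite hP; last by move=> j; case: ifP.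
  rewrite (bigD1 i)//= eqxx big1 ?mule1// => j /negbTE ->; exact: probability_setT.
apply/seteqP; split => [x /= Ax j|x /= /(_ i)]; last by rewrite eqxx.
by case: eqP => // ->.
Qed.

End iid_tuples.

Section independence.
Context {dS : measure_display} {S : measurableType dS} {R : realType}.
Variables (m : probability S R) (N : nat) (mu : probability (N.-tuple S) R).
Hypothesis hmu : iid_map m mu id.
Local Notation T := (N.-tuple S).

(** Measurability with respect to the coordinates in [J], in pointwise form: together with [mix] it
    replaces sub-sigma-algebras. *)
Definition depends_on (J : pred 'I_N) (U : Type) (f : T -> U) :=
  forall z z', (forall i, J i -> tnth z i = tnth z' i) -> f z = f z'.

Lemma depends_onS (J K : pred 'I_N) (U : Type) (f : T -> U) :
  {subset J <= K} -> depends_on J f -> depends_on K f.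
Proof. by move=> JK Jf z z' h; apply: Jf => i Ji; apply: h; exact: JK. Qed.

Lemma depends_on2 (J : pred 'I_N) (U V W : Type) (f : T -> U) (g : T -> V)
    (h : U -> V -> W) :
  depends_on J f -> depends_on J g -> depends_on J (fun z => h (f z) (g z)).
Proof. by move=> Jf Jg z z' e; rewrite (Jf z z')// (Jg z z'). Qed.

Lemma depends_on_mix (J : pred 'I_N) (U : Type) (f : T -> U) z z' :
  depends_on J f -> f (mix J z z') = f z.
Proof. by move=> Jf; apply: Jf => i Ji; rewrite tnth_mktuple Ji. Qed.

Lemma depends_off_mix (J K : pred 'I_N) (U : Type) (f : T -> U) z z' :
  (forall i, J i -> K i -> False) -> depends_on K f -> f (mix J z z') = f z'.
Proof.
by move=> JK Kf; apply: Kf => i Ki; rewrite tnth_mktuple; case: ifP => // /JK/(_ Ki).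
Qed.

Let mix_law (J : pred 'I_N) := iid_map_law (iid_mix J hmu) hmu.
Let mix_mes (J : pred 'I_N) := (iid_mix J hmu).1.

Lemma EE_mix (J : pred 'I_N) (f : T -> R) : itg mu f ->
  EE mu f = EE mu (fun z => EE mu (fun z' => f (mix J z z'))).
Proof.
move=> fi; have mf := itg_mfun fi.
rewrite -(law_EE (mix_mes J) (mix_law J) mf).
have fJ := (law_itg (mix_mes J) (mix_law J) mf).2 fi.
have Gi := integrable_fubini_F fJ.
rewrite /EE /Rintegral -(fubini1 fJ); congr fine.
(* The inner integral is finite for almost every [z] only; elsewhere [fine] inside [EE] turns it
   into 0. *)
apply: ae_eq_integral => //.
- by case/integrableP: Gi.
- apply/measurable_EFinP; apply: measurableT_comp; first exact: fine_measurable.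
  by case/integrableP: Gi.
- have := integrable_ae measurableT Gi; apply: filterS => z h _.
  by rewrite /= fineK//; exact: h.
Qed.

(** After [mix J], [f] reads only the first tuple and [g] only the second, so the double integral
    factorises. Tonelli gives integrability of the product from first moments alone. *)
Lemma itg_EE_indep (J K : pred 'I_N) (f g : T -> R) :
  (forall i, J i -> K i -> False) -> depends_on J f -> depends_on K g ->
  itg mu f -> itg mu g ->
  itg mu (fun z => f z * g z) /\ EE mu (fun z => f z * g z) = EE mu f * EE mu g.
Proof.
move=> JK Jf Kg fi gi; have mf := itg_mfun fi; have mg := itg_mfun gi.
have mfg : measurable_fun [set: T] (fun z => f z * g z) by exact: measurable_funM.
have fgi : itg mu (fun z => f z * g z).
  apply/(law_itg (mix_mes J) (mix_law J) mfg).
  have mF := measurableT_comp mfg (mix_mes J).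
  apply/integrableP; split; first exact/measurable_EFinP.
  rewrite fubini_tonelli1//; last first.
    by apply/measurableT_comp => //; exact/measurable_EFinP.
  rewrite (_ : fubini_F _ _ = fun z => (`|f z|%:E * (EE mu (fun z' => `|g z'|))%:E)%E).
    rewrite ge0_integralZr//; last 2 first.
    - exact/measurable_EFinP/measurableT_comp.
    - by rewrite lee_fin EE_ge0.
    - by rewrite -EE_EFin ?ltry//; exact: itg_abs.
  apply/funext => z; rewrite /fubini_F EE_EFin; last exact: itg_abs.
  rewrite -ge0_integralZl//; last exact/measurable_EFinP/measurableT_comp.
  apply: eq_integral => z' _ /=.
  by rewrite (depends_on_mix _ _ Jf) (depends_off_mix _ _ JK Kg) normrM.
split => //; rewrite (EE_mix J fgi).
under eq_fun => z.
  rewrite (_ : (fun z' => _) = fun z' => f z * g z'); last first.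
    by apply/funext => z'; rewrite (depends_on_mix _ _ Jf) (depends_off_mix _ _ JK Kg).
  rewrite EEZ// mulrC; over.
by rewrite EEZ// mulrC.
Qed.

End independence.

(** * Projection of the kernel on one coordinate *)

Section kernel_projection.
Context {dS : measure_display} {S : measurableType dS} {R : realType}.
Variables (m : probability S R) (d : nat) (nu : probability (d.-tuple S) R).
Hypothesis hnu : iid_map m nu id.
Hypothesis d2 : (2 <= d)%N.
Variable phi : d.-tuple S -> R.
Hypothesis mphi : measurable_fun [set: d.-tuple S] phi.
Hypothesis aphi : antisymmetric_fun phi.
Let i0 : 'I_d := Ordinal (ltnW d2).

Definition gbar (x : S) : R :=
  EE nu (fun t => phi [tuple if val j == 0%N then x else tnth t j | j < d]).

Lemma val_i0 (j : 'I_d) : (val j == 0%N) = (j == i0).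
Proof. by []. Qed.

Definition set_coord (xt : S * d.-tuple S) : d.-tuple S :=
  [tuple if val j == 0%N then xt.1 else tnth xt.2 j | j < d].

Lemma measurable_set_coord : measurable_fun setT set_coord.
Proof.
apply/measurable_fun_tnthP => i.
rewrite (_ : _ \o _ = fun xt => if val i == 0%N then xt.1 else tnth xt.2 i); last first.
  by apply/funext => zz; rewrite /= tnth_mktuple.
case: (_ == _); first exact: measurable_fst.
exact: measurableT_comp (measurable_tnth i) measurable_snd.
Qed.

(** No moment of [phi] is assumed here, so Tonelli is applied to the positive and the negative part
    separately. *)
Lemma measurable_gbar : measurable_fun [set: S] gbar.
Proof.
have mF := measurableT_comp mphi measurable_set_coord.
have mF' : measurable_fun setT (EFin \o (phi \o set_coord)) by exact/measurable_EFinP.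
apply: measurableT_comp; first exact: fine_measurable.
rewrite (_ : (fun x => _) = fun x => (fubini_F nu ((EFin \o (phi \o set_coord))^\+) x
   - fubini_F nu ((EFin \o (phi \o set_coord))^\-) x)%E).
  apply: emeasurable_funB; apply: measurable_fun_fubini_tonelli_F => //.
  - exact: measurable_funepos.
  - exact: measurable_funeneg.
rewrite funeqE => x /=.
rewrite -[LHS]/(\int[nu]_t ((EFin \o (phi \o set_coord)) \o pair x) t)%E.
by rewrite integralE funepos_comp funeneg_comp.
Qed.

(* Signature of the transposition of [0] and [j]. *)
Definition coord_sign (j : 'I_d) : R := if val j == 0%N then 1 else -1.

Lemma coord_sign_sqr j : coord_sign j ^+ 2 = 1.
Proof. by rewrite /coord_sign; case: ifP; rewrite ?expr1n ?sqrrN ?expr1n. Qed.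

Lemma phi_tperm0 (j : 'I_d) (y : d.-tuple S) :
  phi [tuple tnth y (tperm i0 j i) | i < d] = coord_sign j * phi y.
Proof.
rewrite aphi odd_tperm /coord_sign val_i0 eq_sym.
by case: eqP => _ /=; rewrite ?expr0 ?expr1.
Qed.

(** Exchanging coordinates 0 and 1, distinct since [d] is at least 2, preserves the law and changes
    the sign. *)
Lemma EE_phi : EE nu phi = 0.
Proof.
pose j : 'I_d := Ordinal d2.
have := law_EE (iid_sub (@perm_inj _ (tperm i0 j)) hnu).1
  (iid_map_law (iid_sub (@perm_inj _ (tperm i0 j)) hnu) hnu) mphi.
under eq_fun do rewrite phi_tperm0.
by rewrite /coord_sign/= EEZ// => h; lra.
Qed.

(** The transposition of 0 and [j] moves the fixed argument to slot 0 at the price of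
    [coord_sign j]; the other slots, read through the injection [f], are again i.i.d. *)
Lemma EE_section N (mu : probability (N.-tuple S) R) (f : 'I_d -> 'I_N) j x :
  iid_map m mu id -> injective f ->
  EE mu (fun z => phi [tuple if i == j then x else tnth z (f i) | i < d])
  = coord_sign j * gbar x.
Proof.
move=> hmu fI; pose s := tperm i0 j; pose h z := [tuple tnth z (f (s i)) | i < d] : d.-tuple S.
have hh : iid_map m mu h.
  by apply: (iid_sub _ hmu) => a b /fI /perm_inj.
have mx : measurable_fun setT (fun t => phi (set_coord (x, t))).
  apply: measurableT_comp => //; apply: measurableT_comp measurable_set_coord _.
  exact: measurable_pair1.
rewrite -[gbar x]/(EE nu (fun t => phi (set_coord (x, t)))) -(law_EE hh.1 (iid_map_law hh hnu) mx).
rewrite -EEZ; last exact: measurableT_comp mx hh.1.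
congr EE; apply/funext => z; rewrite -[LHS]mul1r -(coord_sign_sqr j) expr2 -mulrA; congr (_ * _).
rewrite -phi_tperm0; congr phi; apply: eq_from_tnth => i; rewrite !tnth_mktuple val_i0.
by rewrite -[X in _ == X](tpermL i0 j) (inj_eq perm_inj).
Qed.

(** All positions are kept except the [f l] with [l != j], which are resampled: [H] does not move
    and [phi] averages to a section, evaluated by [EE_section]. *)
Lemma EE_project N (mu : probability (N.-tuple S) R) (f : 'I_d -> 'I_N) j
    (K : pred 'I_N) (H : N.-tuple S -> R) :
  iid_map m mu id -> injective f ->
  measurable_fun [set: N.-tuple S] H -> depends_on K H ->
  (forall i, i != j -> ~~ K (f i)) ->
  itg mu (fun z => phi [tuple tnth z (f i) | i < d] * H z) ->
  EE mu (fun z => phi [tuple tnth z (f i) | i < d] * H z)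
  = coord_sign j * EE mu (fun z => gbar (tnth z (f j)) * H z).
Proof.
move=> hmu fI mH KH Kf hi; pose J : pred 'I_N := fun i => [forall l, (f l == i) ==> (l == j)].
have Jf i : J (f i) = (i == j).
  apply/forallP/idP => [/(_ i)|/eqP -> l]; first by rewrite eqxx.
  by apply/implyP => /eqP/fI ->.
have JH : depends_on J H.
  apply: depends_onS KH => i Ki; apply/forallP => l; apply/implyP => /eqP fli.
  by apply/negPn/negP => /Kf; rewrite fli; apply/negP; rewrite negbK.
have mG : measurable_fun setT (fun z : N.-tuple S => gbar (tnth z (f j))).
  exact: measurableT_comp measurable_gbar (measurable_tnth _).
rewrite (EE_mix hmu J hi).
transitivity (EE mu (fun z => coord_sign j * (gbar (tnth z (f j)) * H z))).
  congr EE; apply/funext => z.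
  rewrite (_ : (fun z' => _) = (fun z' => H z * phi
      [tuple if i == j then tnth z (f j) else tnth z' (f i) | i < d])).
    rewrite EEZ ?EE_section//; first by ring.
    apply: measurableT_comp => //; apply/measurable_fun_tnthP => i.
    rewrite (_ : _ \o _ = fun t => if i == j then tnth z (f j) else tnth t (f i)); last first.
      by apply/funext => t; rewrite /= tnth_mktuple.
    by case: (_ == _); [exact: measurable_cst|exact: measurable_tnth].
  apply/funext => z'; rewrite (depends_on_mix _ _ JH) mulrC; congr (_ * phi _).
  apply: eq_from_tnth => i; rewrite !tnth_mktuple Jf.
  by case: eqP => // ->.
by rewrite EEZ//; exact: measurable_funM.
Qed.

(** Conditional Jensen for the fourth power, by two uses of [sqr_EE_le] in the resampled variables.
    The comparison is first made in the extended reals, because integrability of [gbar ^+ 4] is part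
    of the conclusion. *)
Lemma gbar4_le : mom nu 2 phi ->
  mom m 2 gbar /\ EE m (fun x => gbar x ^+ 4) <= EE nu (fun t => phi t ^+ 4).
Proof.
move=> h4; have mg := measurable_gbar.
have [mc lc] := iid_coord i0 hnu.
pose J : pred 'I_d := fun i => val i == 0%N.
have i4 : itg nu (fun t => phi t ^+ 4) by case: h4.
have m4 := itg_mfun i4.
have mmix := (iid_mix J hnu).1.
have E : (\int[nu]_t (gbar (tnth t i0) ^+ 4)%:E <= \int[nu]_t (phi t ^+ 4)%:E)%E.
  rewrite -(law_integral mmix (iid_map_law (iid_mix J hnu) hnu) (f := fun t => (phi t ^+ 4)%:E)); last exact/measurable_EFinP.
  have mF : measurable_fun setT (fun zz : d.-tuple S * d.-tuple S =>
      (phi (mix J zz.1 zz.2) ^+ 4)%:E) by apply/measurable_EFinP; exact: measurableT_comp m4 mmix.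
  rewrite fubini_tonelli1//; last by move=> x; rewrite lee_fin (exprM _ 2 2) sqr_ge0.
  apply: ge0_le_integral => //.
  - by move=> x _; rewrite lee_fin (exprM _ 2 2) sqr_ge0.
  - apply/measurable_EFinP; apply: measurable_funX; exact: measurableT_comp mg mc.
  - apply: measurable_fun_fubini_tonelli_F => //.
    by move=> x; rewrite lee_fin (exprM _ 2 2) sqr_ge0.
  - move=> t _; rewrite /fubini_F /=.
    pose F t' := phi (mix J t t').
    have mFt : measurable_fun setT F.
      exact: measurableT_comp mphi (measurableT_comp mmix (pair1_measurable t)).
    have -> : gbar (tnth t i0) = EE nu F.
      congr EE; apply/funext => t'; congr phi; apply: eq_from_tnth => i.
      by rewrite !tnth_mktuple /J; case: eqP => // i00; congr tnth; exact: val_inj.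
    (* For exceptional [t] the inner fourth moment is infinite and the inequality is trivial. *)
    have [iF|nF] := pselect (itg nu (fun t' => F t' ^+ 4)); last first.
      rewrite (_ : integral _ _ _ = +oo%E) ?leey//; apply/eqP.
      rewrite -leye_eq leNgt; apply/negP => lt; apply: nF.
      apply/integrableP; split; first by apply/measurable_EFinP; exact: measurable_funX.
      rewrite (eq_integral (fun t' => (phi (mix J t t') ^+ 4)%:E))// => t' _ /=.
      by rewrite ger0_norm// (exprM _ 2 2) sqr_ge0.
    rewrite -EE_EFin// lee_fin (exprM _ 2 2).
    have m2F : mom nu 2 F by split.
    have h1 := sqr_EE_le mFt (mom1_sqr (momS m2F)).
    have i22 : itg nu (fun t => (F t ^+ 2) ^+ 2).
      by under eq_fun do rewrite -exprM.
    have h2 := sqr_EE_le (measurable_funX 2 mFt) i22.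
    rewrite (_ : (fun x => _) = fun x => (F x ^+ 2) ^+ 2); last first.
      by apply/funext => x; rewrite -exprM.
    apply: le_trans h2; rewrite ler_sqr ?nnegrE ?sqr_ge0//.
    by apply: EE_ge0 => x; exact: sqr_ge0.
have ig : itg nu (fun t => gbar (tnth t i0) ^+ 4).
  apply/integrableP; split.
    apply/measurable_EFinP; apply: measurable_funX; exact: measurableT_comp mg mc.
  rewrite (eq_integral (fun t => (gbar (tnth t i0) ^+ 4)%:E)); last first.
    by move=> t _ /=; rewrite ger0_norm// (exprM _ 2 2) sqr_ge0.
  by apply: le_lt_trans E _; rewrite -EE_EFin ?ltry.
split.
  split => //.
  by apply/(law_itg mc lc (f := fun x => gbar x ^+ 4)) => //; exact: measurable_funX.
rewrite -(law_EE mc lc (f := fun x => gbar x ^+ 4)); last exact: measurable_funX.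
by rewrite -lee_fin !EE_EFin.
Qed.

Lemma EE_gbar : mom nu 2 phi -> EE m gbar = 0.
Proof.
move=> h4; have [mc lc] := iid_coord i0 hnu; rewrite -(law_EE mc lc measurable_gbar).
have := @EE_project d nu id i0 pred0 (fun=> 1) hnu (@inj_id _).
have E : (fun z : d.-tuple S => phi [tuple tnth z i  | i < d] * 1) = phi.
  by apply/funext => z; rewrite mulr1; congr phi; apply: eq_from_tnth => i; rewrite tnth_mktuple.
rewrite E EE_phi /coord_sign eqxx mul1r => h.
under eq_fun do rewrite -[gbar _]mulr1.
rewrite -h//.
exact: mom_itg h4.
Qed.

End kernel_projection.

(** * Moments of the covariances *)

Section increasing_tuples.
Local Close Scope classical_set_scope.
Local Open Scope set_scope.
Variables (n d : nat).
Definition inc (I : d.-tuple 'I_n) : bool := sorted ltn (map val I).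

Lemma inc_uniq I : inc I -> uniq I.
Proof.
move=> sI; have : uniq (map val I) := sorted_uniq ltn_trans ltnn sI.
by rewrite map_inj_uniq//; exact: val_inj.
Qed.

Lemma inc_tuple_inj I : inc I -> injective (tnth I).
Proof. by move=> /inc_uniq/tuple_uniqP. Qed.

Lemma card_inc : #|[set I | inc I]| = 'C(n, d).
Proof. exact: card_ltn_sorted_tuples. Qed.

(** An increasing tuple is determined by its set of values, so these tuples correspond to the
    [d]-subsets of [B]. *)
Lemma card_inc_sub (B : {set 'I_n}) :
  #|[set I : d.-tuple 'I_n | inc I & [set x in I] \subset B]| = 'C(#|B|, d).
Proof.
rewrite -cards_draws.
have sinj : {in [set I : d.-tuple 'I_n | inc I & [set x in I] \subset B] &,
    injective (fun I : d.-tuple 'I_n => [set x in I])}.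
  move=> I J; rewrite !inE => /andP[sI _] /andP[sJ _] /setP IJ.
  apply: val_inj; apply: (inj_map val_inj).
  apply: (irr_sorted_eq ltn_trans ltnn) => // x.
  by apply/mapP/mapP => -[y yI ->]; exists y => //; have := IJ y; rewrite !inE ?yI// => /esym.
rewrite -(card_in_imset sinj); apply: eq_card => A; rewrite inE.
apply/imsetP/andP => [[I]|[AB /eqP Ad]].
  rewrite inE => /andP[sI IB] ->; split => //.
  by rewrite cardsE (card_uniqP (inc_uniq sI)) size_tuple.
have sA : size (enum A) == d by rewrite -cardE Ad.
exists (Tuple sA); last by apply/setP => x; rewrite !inE mem_enum.
rewrite inE; apply/andP; split; last first.
  by apply/fintype.subsetP => x; rewrite inE mem_enum => /(fintype.subsetP AB).
rewrite /inc /= -[enum _](eq_filter (mem_enum _)).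
rewrite -(eq_filter (mem_map val_inj _)) -filter_map.
by rewrite (sorted_filter ltn_trans) // unlock val_ord_enum iota_ltn_sorted.
Qed.

Lemma sum_inc_notin (B : {set 'I_n}) :
  (\sum_(I : d.-tuple 'I_n | inc I) [forall j, (tnth I j) \in B] = 'C(#|B|, d))%N.
Proof.
rewrite -card_inc_sub -sum1dep_card big_mkcondr/=; apply: eq_bigr => I _.
rewrite (_ : [forall j, _] = ([set x in I] \subset B)); first by case: (_ \subset _).
apply/forallP/fintype.subsetP => [h x|h j]; last by apply: h; rewrite inE mem_tnth.
by rewrite inE => /tnthP[j ->].
Qed.

Lemma forall_notin1 (I : d.-tuple 'I_n) i :
  [forall j, tnth I j \in [set~ i]] = (i \notin I).
Proof.
apply/forallP/idP => [h|iI j].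
  by apply/negP => /tnthP[j E]; have := h j; rewrite !inE E eqxx.
by rewrite !inE; apply: contra iI => /eqP <-; exact: mem_tnth.
Qed.

Lemma sum_inc_mem i : (\sum_(I : d.-tuple 'I_n | inc I) (i \in I) + 'C(n.-1, d) = 'C(n, d))%N.
Proof.
have <- : #|[set~ i]| = n.-1 by rewrite cardsC1 card_ord.
rewrite -sum_inc_notin -big_split/= -card_inc -sum1dep_card.
apply: eq_big => [//|I _]; rewrite forall_notin1.
by case: (i \in I).
Qed.

(** Inclusion-exclusion over the tuples avoiding [i], [i'] or both, arranged with sums only because
    subtraction of naturals truncates. *)
Lemma sum_inc_mem2 i i' : i != i' ->
  (\sum_(I : d.-tuple 'I_n | inc I) ((i \in I) && (i' \in I)) + 'C(n.-1, d) + 'C(n.-1, d)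
   = 'C(n, d) + 'C(n.-2, d))%N.
Proof.
move=> ii'.
have E1 : #|[set~ i]| = n.-1 by rewrite cardsC1 card_ord.
have E2 : #|[set~ i']| = n.-1 by rewrite cardsC1 card_ord.
have E3 : #|[set~ i] :&: [set~ i']| = n.-2.
  have := cardsD1 i' [set~ i]; rewrite E1 !inE eq_sym ii' add1n finset.setDE => ->.
  by [].
rewrite -E3 -{1}E1 -E2 -!sum_inc_notin -!big_split/= -card_inc -sum1dep_card.
rewrite -big_split/=; apply: eq_bigr => I _; rewrite !forall_notin1.
have -> : [forall j, tnth I j \in [set~ i] :&: [set~ i']] = (i \notin I) && (i' \notin I).
  rewrite -!forall_notin1; apply/forallP/andP => [h|[/forallP h1 /forallP h2] j].
    by split; apply/forallP => j; have := h j; rewrite inE => /andP[].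
  by rewrite inE h1 h2.
by case: (i \in I); case: (i' \in I).
Qed.

End increasing_tuples.

Section counting.
Context {R : realFieldType}.
Variables (n d : nat).
Hypotheses (d2 : (2 <= d)%N) (dn : (d <= n)%N).
Local Notation N := ('C(n, d)%:R : R).

Lemma bin_gt0r : 0 < N.
Proof. by rewrite ltr0n bin_gt0. Qed.

Lemma ratio_inc_mem i :
  N^-1 * \sum_(I : d.-tuple 'I_n | inc I) (i \in I)%:R = d%:R / n%:R :> R.
Proof.
have n0 : (n%:R : R) != 0 by rewrite pnatr_eq0; lia.
apply: (mulfI (lt0r_neq0 bin_gt0r)); rewrite mulrA divff ?(lt0r_neq0 bin_gt0r)// mul1r.
apply: (mulIf n0); rewrite mulrA -[RHS]mulrA mulVf// mulr1.
have := congr1 (fun k => (k * n)%:R : R) (sum_inc_mem d i).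
rewrite natrM natrD natr_sum mulrDl -natrM [('C(_, d) * n)%N]mulnC mul_bin_down.
rewrite !natrM natrB//; lra.
Qed.

Lemma ratio_inc_mem2 i i' : i != i' ->
  N^-1 * \sum_(I : d.-tuple 'I_n | inc I) ((i \in I) && (i' \in I))%:R
  = (d%:R * (d%:R - 1)) / (n%:R * (n%:R - 1)) :> R.
Proof.
move=> ii'; have n0 : (n%:R : R) * (n%:R - 1) != 0.
  by rewrite -[1]/(1%:R) -natrB ?mulf_neq0 ?pnatr_eq0//; lia.
apply: (mulfI (lt0r_neq0 bin_gt0r)); rewrite mulrA divff ?(lt0r_neq0 bin_gt0r)// mul1r.
apply: (mulIf n0); rewrite -[RHS]mulrA divfK//.
have := congr1 (fun k => k%:R : R) (sum_inc_mem2 d ii').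
rewrite !natrD natr_sum.
have := congr1 (fun k => k%:R : R) (mul_bin_down n d).
have : (n%:R - 1) * ('C(n.-2, d))%:R = (n%:R - 1 - d%:R) * 'C(n.-1, d)%:R :> R.
  (* For [n = d] both binomials vanish; the subtraction [n.-1 - d] used otherwise is exact only for
     [d < n]. *)
  have [nd|nd] := eqVneq n d.
    by rewrite nd !bin_small ?mulr0//; lia.
  have -> : n%:R - 1 = n.-1%:R :> R by rewrite -[1]/(1%:R) -natrB ?subn1//; lia.
  by rewrite -natrM (mul_bin_down n.-1 d) natrM natrB//; lia.
rewrite !natrM natrB//; set c := \sum_(_ | _) _; set A := 'C(n, d)%:R.
set B := 'C(n.-1, d)%:R; set C := 'C(n.-2, d)%:R => E3 E2 E1.
have -> : c = A + C - 2 * B by lra.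
have -> : (A + C - 2 * B) * (n%:R * (n%:R - 1)) =
   A * (n%:R * (n%:R - 1)) + n%:R * ((n%:R - 1) * C) - 2 * (n%:R - 1) * (n%:R * B) by ring.
rewrite E3 [n%:R * (_ * B)]mulrCA E2; ring.
Qed.

(** The size of the intersection of the two index sets, as a sum of products of indicators so that
    averages over [I] and over [J] factorise. *)
Definition overlap (I J : d.-tuple 'I_n) : R := \sum_i (i \in I)%:R * (i \in J)%:R.

Lemma overlapC I J : overlap I J = overlap J I.
Proof. by apply: eq_bigr => i _; rewrite mulrC. Qed.

Lemma overlap_ge0 I J : 0 <= overlap I J.
Proof. by apply: sumr_ge0 => i _; rewrite mulr_ge0// ler0n. Qed.

Lemma overlap_ge1 I J i : i \in I -> i \in J -> 1 <= overlap I J.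
Proof.
move=> iI iJ; rewrite /overlap (bigD1 i)//= iI iJ mulr1 lerDl.
by apply: sumr_ge0 => j _; rewrite mulr_ge0// ler0n.
Qed.

(** Both sides count ordered pairs of distinct common indices. This quantity is at least 1 as soon
    as two indices are shared, and its average is of order [n ^ -2]. *)
Lemma overlap_sqrB I J : overlap I J ^+ 2 - overlap I J =
  \sum_(i : 'I_n) \sum_(i' | i' != i) ((i \in I) && (i' \in I))%:R * ((i \in J) && (i' \in J))%:R.
Proof.
rewrite expr2 {1 3}/overlap mulr_suml -sumrB; apply: eq_bigr => i _.
rewrite /overlap mulr_sumr (bigD1 i)//= addrAC.
have -> : (i \in I)%:R * (i \in J)%:R * ((i \in I)%:R * (i \in J)%:R)
   = (i \in I)%:R * (i \in J)%:R :> R.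
  by case: (i \in I); case: (i \in J); rewrite ?mulr0 ?mulr1 ?mul0r.
rewrite subrr add0r; apply: eq_bigr => i' _.
by rewrite -!mulnb !natrM; ring.
Qed.

Lemma overlap_ge2 I J i i' : i \in I -> i \in J -> i' \in I -> i' \in J -> i' != i ->
  1 <= overlap I J ^+ 2 - overlap I J.
Proof.
move=> iI iJ i'I i'J ii'; rewrite overlap_sqrB (bigD1 i)//= (bigD1 i')//=.
rewrite iI iJ i'I i'J mulr1 -addrA lerDl addr_ge0//.
  by apply: sumr_ge0 => j _; rewrite mulr_ge0// ler0n.
by do 2 (apply: sumr_ge0 => ? _); rewrite mulr_ge0// ler0n.
Qed.

Lemma overlap_sqrB_ge0 I J : 0 <= overlap I J ^+ 2 - overlap I J.
Proof.
by rewrite overlap_sqrB; do 2 (apply: sumr_ge0 => ? _); rewrite mulr_ge0// ler0n.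
Qed.

Lemma sum_mem_inc (I : d.-tuple 'I_n) : inc I -> \sum_i (i \in I)%:R = d%:R :> R.
Proof.
move=> /inc_uniq uI; rewrite -natr_sum; congr _%:R.
by rewrite -big_mkcond/= sum1_card (card_uniqP uI) size_tuple.
Qed.

Lemma sum_overlap (I : d.-tuple 'I_n) : inc I ->
  N^-1 * \sum_(J | inc J) overlap I J = d%:R ^+ 2 / n%:R.
Proof.
move=> sI; rewrite /overlap exchange_big/= mulr_sumr.
transitivity (\sum_(i : 'I_n) (i \in I)%:R * (d%:R / n%:R) : R).
  by apply: eq_bigr => i _; rewrite -mulr_sumr mulrCA ratio_inc_mem.
by rewrite -mulr_suml sum_mem_inc// expr2 mulrA.
Qed.

Lemma card_inc_sum : \sum_(I : d.-tuple 'I_n | inc I) (1 : R) = N.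
Proof. by rewrite sumr_const -card_inc; congr (_ *+ _); rewrite cardsE. Qed.

Lemma sum_inc_cst (x : R) : \sum_(I : d.-tuple 'I_n | inc I) x = x * N.
Proof. by rewrite -card_inc_sum mulr_sumr; apply: eq_bigr => I _; rewrite mulr1. Qed.

Lemma sum_overlap2 :
  N^-2 * \sum_(I | inc I) \sum_(J | inc J) overlap I J = d%:R ^+ 2 / n%:R.
Proof.
rewrite expr2 invfM -mulrA mulr_sumr.
rewrite (eq_bigr (fun=> (d%:R ^+ 2 / n%:R) * 1)); last first.
  by move=> I sI; rewrite sum_overlap// mulr1.
by rewrite -mulr_sumr card_inc_sum mulrCA mulVf ?mulr1// lt0r_neq0// bin_gt0r.
Qed.

Lemma sum_overlap_sqrB :
  N^-2 * \sum_(I | inc I) \sum_(J | inc J) (overlap I J ^+ 2 - overlap I J)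
  = (d%:R * (d%:R - 1)) ^+ 2 / (n%:R * (n%:R - 1)).
Proof.
have n0 : (n%:R : R) * (n%:R - 1) != 0.
  by rewrite -[1]/(1%:R) -natrB ?mulf_neq0 ?pnatr_eq0//; lia.
transitivity (\sum_(i : 'I_n) \sum_(i' | i' != i)
   ((d%:R * (d%:R - 1)) / (n%:R * (n%:R - 1))) ^+ 2 : R).
  under eq_bigr => I _ do under eq_bigr => J _ do rewrite overlap_sqrB.
  under eq_bigr => I _ do rewrite exchange_big/=.
  rewrite exchange_big/= mulr_sumr; apply: eq_bigr => i _.
  under eq_bigr => I _ do rewrite exchange_big/=.
  rewrite exchange_big/= mulr_sumr; apply: eq_bigr => i' ii'.
  rewrite eq_sym in ii'; rewrite -(ratio_inc_mem2 ii') exprMn exprVn; congr (_ * _).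
  by rewrite expr2 mulr_suml; apply: eq_bigr => I _; rewrite mulr_sumr.
under eq_bigr => i _.
  rewrite sumr_const (_ : #|_| = n.-1); last by rewrite cardC1 card_ord.
  over.
rewrite sumr_const card_ord -[_ *+ n.-1]mulr_natr -[LHS]mulr_natr.
have -> : n.-1%:R = n%:R - 1 :> R by rewrite -[1]/(1%:R) -natrB ?subn1//; lia.
have [n1 n2] : n%:R != 0 :> R /\ n%:R - 1 != 0 :> R by move: n0; rewrite mulf_eq0 negb_or => /andP.
by field; rewrite n1 n2.
Qed.

End counting.

(** * Moments of the kernel along the columns of the array *)

Section array.
Context {dS : measure_display} {S : measurableType dS} {R : realType}.
Variables (m : probability S R) (N n p : nat) (mu : probability (N.-tuple S) R).
Hypothesis hmu : iid_map m mu id.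
Variable idx : 'I_n -> 'I_p -> 'I_N.
Hypothesis idx_inj : forall i k i' k', idx i k = idx i' k' -> i = i' /\ k = k'.
Variables (d : nat) (nu : probability (d.-tuple S) R).
Hypothesis hnu : iid_map m nu id.
Hypothesis d2 : (2 <= d)%N.
Variable phi : d.-tuple S -> R.
Hypothesis mphi : measurable_fun [set: d.-tuple S] phi.
Hypothesis aphi : antisymmetric_fun phi.
Hypothesis phi8 : mom nu 3 phi.
Local Notation T := (N.-tuple S).
Local Notation g := (gbar nu phi).
Local Notation E := (EE mu).

Let phi4 : mom nu 2 phi := momS phi8.
Let g4 := gbar4_le hnu d2 mphi phi4.
Let mg : measurable_fun [set: S] g := measurable_gbar nu mphi.

Definition pos k (A : pred 'I_n) : pred 'I_N :=
  fun x => [exists i, A i && (idx i k == x)].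

Lemma posE k A i l : pos k A (idx i l) = (l == k) && A i.
Proof.
apply/existsP/andP => [[i' /andP[Ai' /eqP/idx_inj[<- <-]]]|[/eqP -> Ai]] //.
by exists i; rewrite Ai eqxx.
Qed.

Lemma pos_col k l A B : k != l -> forall x, pos k A x -> pos l B x -> False.
Proof.
move=> kl x /existsP[i /andP[_ /eqP <-]]; rewrite posE => /andP[/eqP kl' _].
by rewrite kl' eqxx in kl.
Qed.

Lemma pos_disj k (A B : pred 'I_n) : (forall i, A i -> B i -> False) ->
  forall x, pos k A x -> pos k B x -> False.
Proof.
move=> AB x /existsP[i /andP[Ai /eqP <-]]; rewrite posE => /andP[_]; exact: AB.
Qed.

Lemma posS k (A B : pred 'I_n) : (forall i, A i -> B i) -> {subset pos k A <= pos k B}.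
Proof.
move=> AB x /existsP[i /andP[Ai ix]]; apply/existsP; exists i.
by rewrite AB.
Qed.

(* [tnth z (idx i k)] is the observation X_i(k); [aI k I] and [yi k i] are then
   phi(X_I(k)) and phi-bar(X_i(k)). *)
Definition aI k (I : d.-tuple 'I_n) (z : T) : R :=
  phi [tuple tnth z (idx (tnth I j) k) | j < d].

Definition yi k (i : 'I_n) (z : T) : R := g (tnth z (idx i k)).

Lemma dep_aI k I : depends_on (pos k (mem I)) (aI k I).
Proof.
move=> z z' zz'; congr phi; apply: eq_from_tnth => j; rewrite !tnth_mktuple.
by apply: zz'; rewrite posE eqxx; exact: mem_tnth.
Qed.

Lemma dep_yi k i : depends_on (pos k (pred1 i)) (yi k i).
Proof. by move=> z z' zz'; congr g; apply: zz'; rewrite posE eqxx /= eqxx. Qed.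

Section law_aI.
Variables (k : 'I_p) (I : d.-tuple 'I_n).
Hypothesis sI : inc I.

Lemma idx_col_inj : injective (fun j => idx (tnth I j) k).
Proof. by move=> j j' /idx_inj[/(inc_tuple_inj sI)]. Qed.

Let h := iid_sub idx_col_inj hmu.

Lemma EE_aI (F : R -> R) : measurable_fun [set: R] F ->
  E (fun z => F (aI k I z)) = EE nu (fun t => F (phi t)).
Proof.
move=> mF; rewrite -(law_EE h.1 (iid_map_law h hnu))//.
exact: measurableT_comp mF mphi.
Qed.

Lemma mom_aI r : mom nu r phi -> mom mu r (aI k I).
Proof. by move=> hr; apply/(law_mom h.1 (iid_map_law h hnu)). Qed.

End law_aI.

Lemma EE_yi k i (F : R -> R) : measurable_fun [set: R] F ->
  E (fun z => F (yi k i z)) = EE m (fun x => F (g x)).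
Proof.
move=> mF; have [mc lc] := iid_coord (idx i k) hmu.
rewrite -(law_EE mc lc (f := fun x => F (g x)))//; exact: measurableT_comp mF mg.
Qed.

Lemma mom_yi k i : mom mu 2 (yi k i).
Proof.
have [mc lc] := iid_coord (idx i k) hmu.
exact: ((law_mom mc lc 2 mg).2 g4.1).
Qed.

(** In the limit [d%:R * s2] becomes alpha and [b2] becomes beta, whereas [gg4] only has to stay
    bounded. *)
Definition s2 : R := EE m (fun x => g x ^+ 2).
Definition b2 : R := EE nu (fun t => phi t ^+ 2).
Definition gg4 : R := EE m (fun x => g x ^+ 4).

Lemma s2_ge0 : 0 <= s2. Proof. by apply: EE_ge0 => x; exact: sqr_ge0. Qed.
Lemma b2_ge0 : 0 <= b2. Proof. by apply: EE_ge0 => x; exact: sqr_ge0. Qed.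

Lemma EE_yi2 k i : E (fun z => yi k i z * yi k i z) = s2.
Proof.
rewrite /s2 -(EE_yi k i (F := fun x => x ^+ 2)); last exact: exprn_measurable.
by congr EE; apply/funext => z; rewrite expr2.
Qed.

Lemma EE_yi0 k i : E (yi k i) = 0.
Proof.
rewrite -(EE_gbar hnu d2 mphi aphi phi4) -(EE_yi k i (F := id))//.
Qed.

(** A centred factor independent of the rest kills the expectation; the vanishing mixed moments of
    [yi] below reduce to this. *)
Lemma EE_yi_isolated k i (K : pred 'I_N) (F : T -> R) :
  (forall x, pos k (pred1 i) x -> K x -> False) -> depends_on K F -> itg mu F ->
  E (fun z => yi k i z * F z) = 0.
Proof.
move=> iK KF Fi; have [_ ->] := itg_EE_indep hmu iK (@dep_yi k i) KF (mom_itg (mom_yi k i)) Fi.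
by rewrite EE_yi0 mul0r.
Qed.

Lemma EE_yiyj k i j : i != j -> E (fun z => yi k i z * yi k j z) = 0.
Proof.
move=> ij; apply: (EE_yi_isolated (K := pos k (pred1 j))).
- by apply: pos_disj => l /= /eqP -> /eqP ij'; rewrite ij' eqxx in ij.
- exact: dep_yi.
- exact: mom_itg (mom_yi k j).
Qed.

Lemma EE_aI_yi k I i : inc I -> i \notin I -> E (fun z => aI k I z * yi k i z) = 0.
Proof.
move=> sI iI; under eq_fun do rewrite mulrC.
apply: (EE_yi_isolated (K := pos k (mem I))).
- by apply: pos_disj => l /= /eqP -> ; apply/negP.
- exact: dep_aI.
- exact: mom_itg (mom_aI k sI phi8).
Qed.

(** [EE_project] inside column [k]: if the rows read by [H] meet [I] at most in its [j]-th entry,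
    the kernel may be replaced by its signed projection on that entry. *)
Lemma EE_aI_H k I j (K : pred 'I_n) H : inc I -> depends_on (pos k K) H ->
  mom mu 1 H -> (forall l, K (tnth I l) -> l = j) ->
  E (fun z => aI k I z * H z) = (coord_sign j : R) * E (fun z => yi k (tnth I j) z * H z).
Proof.
move=> sI KH H1 Kj; have := EE_project hnu d2 mphi aphi (j := j) hmu (idx_col_inj (k := k) sI) H1.1 KH; apply.
  by move=> l lj; rewrite posE eqxx/=; apply: contra lj => /Kj ->.
by apply/mom0; apply: momM => //; apply: mom_aI => //; exact: momS.
Qed.

Lemma EE_aI_yi_mem k I j : inc I ->
  E (fun z => aI k I z * yi k (tnth I j) z) = (coord_sign j : R) * s2.
Proof.
move=> sI; rewrite (EE_aI_H (j := j) (K := pred1 (tnth I j)))//.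
- by rewrite EE_yi2.
- exact: dep_yi.
- exact: momS (mom_yi _ _).
- by move=> l /= /eqP /(inc_tuple_inj sI).
Qed.

Lemma EE_aI_le k I J : inc I -> inc J ->
  `|E (fun z => aI k I z * aI k J z)| <= b2.
Proof.
move=> sI sJ.
have mI := mom_aI k sI phi4; have mJ := mom_aI k sJ phi4.
have i2 L : inc L -> itg mu (fun z => aI k L z ^+ 2).
  by move=> sL; apply: mom1_sqr; apply: mom_aI => //; exact: momS.
have iM : itg mu (fun z => aI k I z * aI k J z).
  by apply/mom0; apply: momM; exact: momS.
have EL L : inc L -> E (fun z => aI k L z ^+ 2) = b2.
  move=> sL; exact: (EE_aI k sL (exprn_measurable 2)).
have h : E (fun z => 2^-1 * (aI k I z ^+ 2 + aI k J z ^+ 2)) = b2.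
  rewrite EEZ ?EED ?EL//; try exact: i2; first by lra.
  by apply: measurable_funD; apply: itg_mfun; exact: i2.
have hi : itg mu (fun z => 2^-1 * (aI k I z ^+ 2 + aI k J z ^+ 2)).
  by apply: itgZ; apply: itgD; exact: i2.
rewrite ler_norml -h; apply/andP; split; last first.
  by apply: EE_le => // z; have := sqr_ge0 (aI k I z - aI k J z); nra.
rewrite -mulN1r -EEZ; last exact: (itg_mfun hi).
apply: EE_le => //; first exact: itgZ.
by move=> z; have := sqr_ge0 (aI k I z + aI k J z); nra.
Qed.

(** Disjoint [I] and [J] give 0. With one common row, each expectation is [s2] times two signs that
    are the same in both columns, so the product is [s2 ^+ 2]. With more common rows the crude bound
    [b2] suffices. Polynomials in the overlap cover the three cases at once and have explicit
    averages. *)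
Lemma EE_aI_aJ k l I J : inc I -> inc J ->
  E (fun z => aI k I z * aI k J z) * E (fun z => aI l I z * aI l J z)
  <= s2 ^+ 2 * (overlap I J : R) + b2 ^+ 2 * ((overlap I J : R) ^+ 2 - (overlap I J : R)).
Proof.
move=> sI sJ.
have rhs0 : 0 <= s2 ^+ 2 * (overlap I J : R) by rewrite mulr_ge0 ?sqr_ge0 ?overlap_ge0.
have rhs1 : 0 <= b2 ^+ 2 * ((overlap I J : R) ^+ 2 - (overlap I J : R)).
  by rewrite mulr_ge0 ?sqr_ge0 ?overlap_sqrB_ge0.
have [/existsP[j jJ]|/existsPn nIJ] := boolP [exists j, tnth I j \in J]; last first.
  suff -> : E (fun z => aI k I z * aI k J z) = 0 by rewrite mul0r addr_ge0.
  have iK : forall x, pos k (mem I) x -> pos k (mem J) x -> False.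
    by apply: pos_disj => i /= /tnthP[j ->] jJ; have := nIJ j; rewrite jJ.
  have [_ ->] := itg_EE_indep hmu iK (@dep_aI k I) (@dep_aI k J)
    (mom_itg (mom_aI k sI phi4)) (mom_itg (mom_aI k sJ phi4)).
  have -> : E (aI k I) = 0.
    rewrite -(EE_phi hnu d2 mphi aphi) -(EE_aI k sI (F := id))//.
  by rewrite mul0r.
have [/existsP[j' /andP[jj' j'J]]|/existsPn h1] := boolP [exists j', (j' != j) && (tnth I j' \in J)].
  apply: (@le_trans _ _ (b2 ^+ 2)).
    apply: le_trans (ler_norm _) _; rewrite normrM expr2.
    by apply: ler_pM => //; exact: EE_aI_le.
  apply: (@le_trans _ _ (b2 ^+ 2 * ((overlap I J : R) ^+ 2 - (overlap I J : R)))); last by rewrite lerDr.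
  rewrite ler_peMr ?sqr_ge0// (@overlap_ge2 _ _ _ _ _ (tnth I j) (tnth I j'))// ?mem_tnth//.
  by apply: contra jj' => /eqP/(inc_tuple_inj sI) ->.
have [j' j'E] := tnthP _ _ jJ.
(* Project first [I], then [J], on their only common row. *)
have Ek r : E (fun z => aI r I z * aI r J z) = (coord_sign j : R) * (coord_sign j' : R) * s2.
  rewrite (EE_aI_H (j := j) (K := mem J))//.
  - under [X in EE _ X]eq_fun do rewrite mulrC.
    by rewrite j'E EE_aI_yi_mem// mulrA.
  - exact: dep_aI.
  - by apply: mom_aI => //; exact: momS.
  - move=> i lJ; have := h1 i; rewrite negb_and negbK => /orP[/eqP//|].
    by move/negP; case.
rewrite !Ek.
have -> : (coord_sign j : R) * (coord_sign j' : R) * s2 * ((coord_sign j : R) * (coord_sign j' : R) * s2)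
   = (coord_sign j : R) ^+ 2 * (coord_sign j' : R) ^+ 2 * s2 ^+ 2 by ring.
rewrite !coord_sign_sqr !mul1r.
apply: (@le_trans _ _ (s2 ^+ 2 * (overlap I J : R))); last by rewrite lerDl.
by rewrite ler_peMr ?sqr_ge0// (@overlap_ge1 _ _ _ _ _ (tnth I j))// mem_tnth.
Qed.

(** Expanding the square, the [x] factors separate from the [y] factors by independence. It serves
    for two distinct columns, and for a random matrix against a column that it does not read. *)
Lemma EE_sqr_bilinear (A : finType) (Q : pred A) (w : A -> R) (x y : A -> T -> R)
    (J K : pred 'I_N) :
  (forall i, J i -> K i -> False) ->
  (forall c, Q c -> depends_on J (x c)) -> (forall c, Q c -> depends_on K (y c)) ->
  (forall c, Q c -> mom mu 1 (x c)) -> (forall c, Q c -> mom mu 1 (y c)) ->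
  itg mu (fun z => (\sum_(c | Q c) w c * (x c z * y c z)) ^+ 2) /\
  E (fun z => (\sum_(c | Q c) w c * (x c z * y c z)) ^+ 2) =
  \sum_(c | Q c) \sum_(c' | Q c') w c * w c' *
    (E (fun z => x c z * x c' z) * E (fun z => y c z * y c' z)).
Proof.
move=> JK Jx Ky mx my.
have -> : (fun z => (\sum_(c | Q c) w c * (x c z * y c z)) ^+ 2) =
   (fun z => \sum_(c | Q c) \sum_(c' | Q c') w c * w c' * ((x c z * x c' z) * (y c z * y c' z))).
  apply/funext => z; rewrite expr2 mulr_suml; apply: eq_bigr => c _.
  by rewrite mulr_sumr; apply: eq_bigr => c' _; ring.
have h c c' : Q c -> Q c' ->
    itg mu (fun z => (x c z * x c' z) * (y c z * y c' z)) /\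
    E (fun z => (x c z * x c' z) * (y c z * y c' z)) =
    E (fun z => x c z * x c' z) * E (fun z => y c z * y c' z).
  move=> Qc Qc'; apply: (itg_EE_indep hmu JK).
  - by apply: depends_on2 => //; exact: Jx.
  - by apply: depends_on2 => //; exact: Ky.
  - by apply/mom0; apply: momM; exact: mx.
  - by apply/mom0; apply: momM; exact: my.
split.
  apply: itg_sum => c Qc; apply: itg_sum => c' Qc'; apply: itgZ.
  by have [] := h _ _ Qc Qc'.
rewrite EE_sum => [|c Qc]; last first.
  by apply: itg_sum => c' Qc'; apply: itgZ; have [] := h _ _ Qc Qc'.
apply: eq_bigr => c Qc; rewrite EE_sum => [|c' Qc']; last first.
  by apply: itgZ; have [] := h _ _ Qc Qc'.
apply: eq_bigr => c' Qc'; have [hi he] := h _ _ Qc Qc'.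
by rewrite EEZ ?he//; exact: (itg_mfun hi).
Qed.

(** * Off-diagonal covariances against their linear parts *)

Section off_diagonal.
Variables (k l : 'I_p).
Hypotheses (kl : k != l) (dn : (d <= n)%N).

(* First-order (Hoeffding) projection of the covariance. *)
Definition lin_cov (z : T) : R := d%:R / n%:R * \sum_i yi k i z * yi l i z.

Definition cov_sum (z : T) : R :=
  'C(n, d)%:R^-1 * \sum_(I : d.-tuple 'I_n | inc I) aI k I z * aI l I z.

(** The cross moment of the two sums and the mean square of the linear part both equal
    [d ^ 2 / n * s2 ^ 2]. The left side is therefore the mean square of [cov_sum] minus this value,
    and the [s2] term of [EE_aI_aJ] averages to exactly the same value. Only shared pairs of rows
    remain, whence the order [n ^ -2]. *)
Lemma EE_cov_lin :
  itg mu (fun z => (cov_sum z - lin_cov z) ^+ 2) /\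
  E (fun z => (cov_sum z - lin_cov z) ^+ 2)
  <= b2 ^+ 2 * ((d%:R * (d%:R - 1)) ^+ 2 / (n%:R * (n%:R - 1))).
Proof.
have n0 : (n%:R : R) != 0 by rewrite pnatr_eq0; lia.
have C0 : 0 < 'C(n, d)%:R :> R := bin_gt0r dn; set c := ('C(n, d)%:R^-1 : R).
(* Tuples and single rows are merged into one index type, so that a single expansion yields all
   three kinds of terms. *)
pose Q (c : (d.-tuple 'I_n + 'I_n)%type) := if c is inl L then inc L else true.
pose w (e : (d.-tuple 'I_n + 'I_n)%type) : R := if e is inl _ then c else - (d%:R / n%:R).
pose x r (e : (d.-tuple 'I_n + 'I_n)%type) : T -> R := match e with inl L => aI r L | inr i => yi r i end.
have dx r e : Q e -> depends_on (pos r predT) (x r e).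
  case: e => [I|i] _; [apply: depends_onS (@dep_aI r I)|apply: depends_onS (@dep_yi r i)];
    exact: posS.
have mx r e : Q e -> mom mu 1 (x r e).
  case: e => [I|i] /= sI; last exact: momS (mom_yi _ _).
  by apply: mom_aI => //; exact: momS.
have := EE_sqr_bilinear w (pos_col kl) (dx k) (dx l) (mx k) (mx l).
have -> : (fun z => (\sum_(e | Q e) w e * (x k e z * x l e z)) ^+ 2) =
          (fun z => (cov_sum z - lin_cov z) ^+ 2).
  apply/funext => z; congr (_ ^+ 2); rewrite big_sumType/= -!mulr_sumr.
  by rewrite mulNr.
move=> [hi ->]; split => //.
pose M r e e' := E (fun z => x r e z * x r e' z).
rewrite -[X in X <= _]/(\sum_(e | Q e) \sum_(e' | Q e') w e * w e' * (M k e e' * M l e e')).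
have MC r e e' : M r e e' = M r e' e.
  by congr EE; apply/funext => z; rewrite mulrC.
have Mi r I i : inc I -> i \notin I -> M r (inl I) (inr i) = 0.
  by move=> sI iI; exact: EE_aI_yi.
(* The sign of the projection appears once per column and squares to 1. *)
have Mm I i : inc I -> M k (inl I) (inr i) * M l (inl I) (inr i) = s2 ^+ 2 * (i \in I)%:R.
  move=> sI; have [/tnthP[j ->]|iI] := boolP (i \in I); last first.
    by rewrite Mi// mul0r mulr0.
  rewrite [M k _ _]EE_aI_yi_mem// [M l _ _]EE_aI_yi_mem//.
  by rewrite mulrACA -expr2 coord_sign_sqr mul1r mulr1 expr2.
rewrite big_sumType/=.
rewrite (eq_bigr (fun I => \sum_(J | inc J) c * c * (M k (inl I) (inl J) * M l (inl I) (inl J))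
   - c * (d%:R / n%:R) * d%:R * s2 ^+ 2)); last first.
  move=> I sI; rewrite big_sumType/=; congr (_ + _).
  rewrite (eq_bigr (fun i => (- (c * (d%:R / n%:R) * s2 ^+ 2)) * (i \in I)%:R)); last first.
    by move=> i _; rewrite Mm//; ring.
  by rewrite -mulr_sumr sum_mem_inc//; ring.
rewrite [X in _ + X <= _](eq_bigr (fun i : 'I_n => \sum_(J : d.-tuple 'I_n | inc J) (- (c * (d%:R / n%:R) * s2 ^+ 2)) * (i \in J)%:R
   + (d%:R / n%:R) ^+ 2 * s2 ^+ 2)); last first.
  move=> i _; rewrite big_sumType/=; congr (_ + _).
    by apply: eq_bigr => J sJ; rewrite MC [M l _ _]MC Mm//; ring.
  rewrite (bigD1 i)//= big1 ?addr0; last first.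
    by move=> j ji; rewrite [M k _ _]EE_yiyj 1?eq_sym// mul0r mulr0.
  rewrite [M k _ _]EE_yi2 [M l _ _]EE_yi2; ring.
rewrite sumrB [X in _ + X <= _]big_split/= [X in _ + (X + _) <= _]exchange_big/=.
rewrite [X in _ + (_ + X) <= _]sumr_const card_ord.
rewrite [X in _ + (X + _) <= _](eq_bigr (fun J : d.-tuple 'I_n => - (c * (d%:R / n%:R) * s2 ^+ 2 * d%:R) * 1)); last first.
  by move=> J sJ; rewrite -mulr_sumr sum_mem_inc//; ring.
rewrite [X in _ - X + _](eq_bigr (fun J : d.-tuple 'I_n => (c * (d%:R / n%:R) * d%:R * s2 ^+ 2) * 1)); last first.
  by move=> J sJ; rewrite mulr1.
rewrite -!mulr_sumr card_inc_sum//.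
apply: (@le_trans _ _ (c ^+ 2 * \sum_(I | inc I) \sum_(J | inc J)
   (s2 ^+ 2 * (overlap I J : R) + b2 ^+ 2 * ((overlap I J : R) ^+ 2 - overlap I J)) -
   d%:R ^+ 2 / n%:R * s2 ^+ 2)); last first.
  have h1 := @sum_overlap2 R n d d2 dn; have h2 := @sum_overlap_sqrB R n d d2 dn.
  have e1 : c ^+ 2 * (\sum_(I : d.-tuple 'I_n | inc I) \sum_(J | inc J) (overlap I J : R)) = d%:R ^+ 2 / n%:R.
    by rewrite -h1 /c exprVn.
  have e2 : c ^+ 2 * (\sum_(I : d.-tuple 'I_n | inc I) \sum_(J | inc J) ((overlap I J : R) ^+ 2 - overlap I J)) = (d%:R * (d%:R - 1)) ^+ 2 / (n%:R * (n%:R - 1)).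
    by rewrite -h2 /c exprVn.
  rewrite [X in c ^+ 2 * X](_ : _ = s2 ^+ 2 * (\sum_(I : d.-tuple 'I_n | inc I) \sum_(J | inc J) (overlap I J : R))
    + b2 ^+ 2 * \sum_(I : d.-tuple 'I_n | inc I) \sum_(J | inc J) ((overlap I J : R) ^+ 2 - overlap I J)).
    by rewrite mulrDr [c ^+ 2 * (s2 ^+ 2 * _)]mulrCA e1 [c ^+ 2 * (b2 ^+ 2 * _)]mulrCA e2; lra.
  rewrite !mulr_sumr -big_split/=; apply: eq_bigr => I _.
  by rewrite !mulr_sumr -big_split.
rewrite -addrA; apply: lerD.
  rewrite mulr_sumr; apply: ler_sum => I sI; rewrite mulr_sumr; apply: ler_sum => J sJ.
  by rewrite -expr2 ler_wpM2l ?sqr_ge0//; exact: EE_aI_aJ.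
rewrite -[_ *+ n]mulr_natr le_eqVlt; apply/orP; left; apply/eqP.
rewrite /c; field; rewrite n0/=; exact: lt0r_neq0.
Qed.

End off_diagonal.

(** * Fourth moment of a diagonal covariance *)

Section diagonal.
Variable k : 'I_p.
Hypothesis dn : (d <= n)%N.

Definition hI (I : d.-tuple 'I_n) (z : T) : R := aI k I z ^+ 2 - b2.

Definition h4 : R := EE nu (fun t => (phi t ^+ 2 - b2) ^+ 4).

Lemma mom_hI I : inc I -> mom mu 2 (hI I).
Proof.
move=> sI; apply: momB; last exact: mom_cst.
by rewrite /=; under eq_fun do rewrite expr2; apply: momM; exact: mom_aI.
Qed.

Lemma EE_hI I : inc I -> E (hI I) = 0.
Proof.
move=> sI; have i2 : itg mu (fun z => aI k I z ^+ 2).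
  by apply: mom1_sqr; apply: mom_aI => //; exact: momS.
rewrite EEB//; last exact: itg_cst.
by rewrite EE_cst (EE_aI k sI (exprn_measurable 2)) subrr.
Qed.

Lemma EE_hI4 I : inc I -> E (fun z => hI I z ^+ 4) = h4.
Proof.
move=> sI; rewrite /h4 -(EE_aI k sI (F := fun x => (x ^+ 2 - b2) ^+ 4))//.
apply: measurable_funX; apply: measurable_funB => //; exact: exprn_measurable.
Qed.

Lemma h4_ge0 : 0 <= h4.
Proof. by apply: EE_ge0 => t; rewrite (exprM _ 2 2) sqr_ge0. Qed.

Lemma dep_hI I : depends_on (pos k (mem I)) (hI I).
Proof. by move=> z z' zz'; rewrite /hI (dep_aI zz'). Qed.

Lemma itg_hI I1 I2 I3 I4 : inc I1 -> inc I2 -> inc I3 -> inc I4 ->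
  itg mu (fun z => hI I1 z * (hI I2 z * hI I3 z * hI I4 z)).
Proof.
move=> s1 s2' s3 s4.
under eq_fun do rewrite -mulrA mulrA.
by apply/mom0; apply: momM; apply: momM; exact: mom_hI.
Qed.

Lemma EE_hI_isolated I J K L : inc I -> inc J -> inc K -> inc L ->
  (forall i, i \in I -> [|| i \in J, i \in K | i \in L] -> False) ->
  E (fun z => hI I z * (hI J z * hI K z * hI L z)) = 0.
Proof.
move=> sI sJ sK sL H.
pose B := fun i => [|| i \in J, i \in K | i \in L].
have IB : forall x, pos k (mem I) x -> pos k B x -> False by exact: pos_disj.
have dB : depends_on (pos k B) (fun z => hI J z * hI K z * hI L z).
  apply: depends_on2; first apply: depends_on2.
  - by apply: depends_onS (@dep_hI J); apply: posS => i iJ; rewrite /B; apply/orP; left.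
  - by apply: depends_onS (@dep_hI K); apply: posS => i iK; apply/or3P/Or32.
  - by apply: depends_onS (@dep_hI L); apply: posS => i iL; apply/or3P/Or33.
have := @itg_EE_indep _ _ _ _ _ _ hmu _ _ _ _ IB (@dep_hI I) dB (mom_itg (mom_hI sI)).
have hf : (hI J \* hI K) \* hI L = (fun z => hI J z * hI K z * hI L z) by [].
have i3 : itg mu (fun z => hI J z * hI K z * hI L z).
  apply/mom0; apply: momM; last by apply: momS; exact: mom_hI.
  by apply: momM; exact: mom_hI.
by move=> /(_ i3)[_ ->]; rewrite EE_hI// mul0r.
Qed.

(** Pointwise [4 a b c e <= a ^ 4 + b ^ 4 + c ^ 4 + e ^ 4], where each fourth power has mean
    [h4]. *)
Lemma EE_hI_le I J K L : inc I -> inc J -> inc K -> inc L ->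
  E (fun z => hI I z * (hI J z * hI K z * hI L z)) <= h4.
Proof.
move=> sI sJ sK sL.
have i4 I' : inc I' -> itg mu (fun z => hI I' z ^+ 4).
  by move=> s; case: (mom_hI s).
have m4 I' : inc I' -> measurable_fun setT (fun z => hI I' z ^+ 4).
  by move=> s; apply: itg_mfun; exact: i4.
have e2 := EED (i4 _ sI) (i4 _ sJ); have j2 := itgD (i4 _ sI) (i4 _ sJ).
have e3 := EED j2 (i4 _ sK); have j3 := itgD j2 (i4 _ sK).
have e4 := EED j3 (i4 _ sL); have j4 := itgD j3 (i4 _ sL).
have -> : h4 = E (fun z => 4^-1 * (hI I z ^+ 4 + hI J z ^+ 4 + hI K z ^+ 4 + hI L z ^+ 4)).
  by rewrite (EEZ _ _ (itg_mfun j4)) e4 e3 e2 !EE_hI4//; lra.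
apply: EE_le.
- exact: itg_hI.
- exact: itgZ.
- move=> z; move: (hI I z) (hI J z) (hI K z) (hI L z) => a b c e.
  have -> : forall x : R, x ^+ 4 = (x ^+ 2) ^+ 2 by move=> x; rewrite -exprM.
  have -> : forall x : R, x ^+ 4 = (x ^+ 2) ^+ 2 by move=> x; rewrite -exprM.
  have -> : forall x : R, x ^+ 4 = (x ^+ 2) ^+ 2 by move=> x; rewrite -exprM.
  have -> : forall x : R, x ^+ 4 = (x ^+ 2) ^+ 2 by move=> x; rewrite -exprM.
  have := sqr_ge0 (a * b - c * e); have := sqr_ge0 (a ^+ 2 - b ^+ 2).
  have := sqr_ge0 (c ^+ 2 - e ^+ 2); nra.
Qed.

Local Notation o A B := (overlap A B : R).

(* In a quadruple without isolated member, [I] meets another set, and each of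
   [J] and [K] meets another set. *)
Lemma EE_hI_overlap I J K L : inc I -> inc J -> inc K -> inc L ->
  E (fun z => hI I z * (hI J z * hI K z * hI L z)) <= h4 *
    (o I J * (o K I + o K J + o K L) + o I K * (o J I + o J K + o J L)
     + o I L * (o J I + o J K + o J L)).
Proof.
move=> sI sJ sK sL.
have o0 (A B : d.-tuple 'I_n) : 0 <= o A B by exact: overlap_ge0.
have meet (A B : d.-tuple 'I_n) : (forall i, i \in A -> i \in B -> False) \/ 1 <= o A B.
  have [/existsP[i /andP[iA iB]]|/existsPn h] := boolP [exists i, (i \in A) && (i \in B)].
    by right; exact: overlap_ge1 iA iB.
  by left => i iA iB; have := h i; rewrite iA iB.
have iso A B C D : inc A -> inc B -> inc C -> inc D ->
    E (fun z => hI A z * (hI B z * hI C z * hI D z)) = 0 \/ 1 <= o A B + o A C + o A D.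
  move=> sA sB sC sD; have := o0 A B; have := o0 A C; have := o0 A D.
  have [hB|] := meet A B; last by right; lra.
  have [hC|] := meet A C; last by right; lra.
  have [hD|] := meet A D; last by right; lra.
  move=> _ _ _; left; apply: EE_hI_isolated => // i iA /or3P[]; [exact: hB|exact: hC|exact: hD].
set W := (X in h4 * X).
have W0 : 0 <= W by rewrite /W !addr_ge0 ?mulr_ge0 ?addr_ge0.
have H0 := h4_ge0.
suff [->|W1] : E (fun z => hI I z * (hI J z * hI K z * hI L z)) = 0 \/ 1 <= W.
- by rewrite mulr_ge0.
- apply: le_trans (EE_hI_le sI sJ sK sL) _; by rewrite ler_peMr.
have [h|nI] := iso I J K L sI sJ sK sL; first by left.
have [h|nJ] := iso J I K L sJ sI sK sL.
  by left; rewrite -h; congr EE; apply/funext => z; ring.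
have [h|nK] := iso K I J L sK sI sJ sL.
  by left; rewrite -h; congr EE; apply/funext => z; ring.
(* When [I] meets [J], the bracket of [K] is used; when it meets [K] or [L], that of [J]. The two
   overlaps in each product are then distinct pairs, so that each product averages to
   [(d ^ 2 / n) ^ 2]. *)
right; apply: le_trans nI _; rewrite /W !lerD// ler_peMr//.
Qed.

Definition cov_diag (z : T) : R :=
  'C(n, d)%:R^-1 * \sum_(I : d.-tuple 'I_n | inc I) aI k I z * aI k I z.

Lemma cov_diag_b2 z : cov_diag z - b2 = 'C(n, d)%:R^-1 * \sum_(I | inc I) hI I z.
Proof.
rewrite /hI sumrB sum_inc_cst mulrBr mulrCA mulVf ?mulr1; last first.
  by rewrite lt0r_neq0// bin_gt0r.
by congr (_ - _); congr (_ * _); apply: eq_bigr => I _; rewrite expr2.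
Qed.

(** Quadruples with an isolated member vanish; the others are dominated by nine products of two
    overlaps, each of mean [(d ^ 2 / n) ^ 2], whence the constant 9. The order [n ^ -2], and not
    merely [1 / n], is what survives a union bound over [p] columns. *)
Lemma EE_cov_diag4 :
  mom mu 2 (fun z => cov_diag z - b2) /\
  E (fun z => (cov_diag z - b2) ^+ 4) <= 9 * h4 * d%:R ^+ 4 / n%:R ^+ 2.
Proof.
have C0 : 0 < 'C(n, d)%:R :> R := bin_gt0r dn; set c := ('C(n, d)%:R^-1 : R).
have cE : c * 'C(n, d)%:R = 1 by rewrite mulVf// lt0r_neq0.
split.
  under eq_fun do rewrite cov_diag_b2.
  by apply: momZ; apply: mom_sum => I sI; exact: mom_hI.
have -> : (fun z => (cov_diag z - b2) ^+ 4) = (fun z =>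
    c ^+ 4 * \sum_(I | inc I) \sum_(J | inc J) \sum_(K | inc K) \sum_(L | inc L)
      hI I z * (hI J z * hI K z * hI L z)).
  apply/funext => z; rewrite cov_diag_b2 exprMn; congr (_ * _).
  set s := \sum_(I | inc I) hI I z.
  transitivity (s * (s * s * s)); first by ring.
  rewrite {1}/s mulr_suml; apply: eq_bigr => I _.
  transitivity (\sum_(J | inc J) hI I z * (hI J z * s * s)).
    by rewrite -mulr_sumr -!mulr_suml.
  apply: eq_bigr => J _; transitivity (\sum_(K | inc K) hI I z * (hI J z * hI K z * s)).
    by rewrite -mulr_sumr -mulr_suml -mulr_sumr.
  by apply: eq_bigr => K _; rewrite -!mulr_sumr.
have i4 I J K L : inc I -> inc J -> inc K -> inc L ->
  itg mu (fun z => hI I z * (hI J z * hI K z * hI L z)) by exact: itg_hI.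
rewrite EEZ; last first.
  apply: itg_mfun; apply: itg_sum => I sI; apply: itg_sum => J sJ; apply: itg_sum => K sK.
  by apply: itg_sum => L sL; exact: i4.
rewrite EE_sum; last first.
  move=> I sI; apply: itg_sum => J sJ; apply: itg_sum => K sK.
  by apply: itg_sum => L sL; exact: i4.
pose t : R := d%:R ^+ 2 / n%:R; pose NN : R := 'C(n, d)%:R.
have so (x : R) (I : d.-tuple 'I_n) : inc I -> \sum_(J | inc J) x * o I J = x * (NN * t).
  move=> sI; rewrite -mulr_sumr; congr (_ * _).
  by rewrite /t -(@sum_overlap R n d d2 dn I sI) mulrA divff ?mul1r// lt0r_neq0.
have so' (x : R) (I : d.-tuple 'I_n) : inc I -> \sum_(J | inc J) x * o J I = x * (NN * t).
  by move=> sI; rewrite -(so x I sI); apply: eq_bigr => J _; rewrite overlapC.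
have sc (x : R) : \sum_(I : d.-tuple 'I_n | inc I) x = x * NN by exact: sum_inc_cst.
have -> : 9 * h4 * d%:R ^+ 4 / n%:R ^+ 2 = c ^+ 4 * (h4 * (9 * NN ^+ 4 * t ^+ 2)).
  rewrite /t /NN /c; have n0 : n%:R != 0 :> R by rewrite pnatr_eq0; lia.
  by field; rewrite n0 lt0r_neq0.
rewrite ler_wpM2l ?exprn_ge0 ?invr_ge0 ?(ltW C0)//.
apply: (@le_trans _ _ (\sum_(I | inc I) \sum_(J | inc J) \sum_(K | inc K) \sum_(L | inc L)
   h4 * (o I J * (o K I + o K J + o K L) + o I K * (o J I + o J K + o J L)
     + o I L * (o J I + o J K + o J L)))).
  apply: ler_sum => I sI; rewrite EE_sum; last first.
    move=> J sJ; apply: itg_sum => K sK.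
    by apply: itg_sum => L sL; exact: i4.
  apply: ler_sum => J sJ; rewrite EE_sum; last first.
    by move=> K sK; apply: itg_sum => L sL; exact: i4.
  apply: ler_sum => K sK; rewrite EE_sum; last by move=> L sL; exact: i4.
  by apply: ler_sum => L sL; exact: EE_hI_overlap.
pose S4 (F : d.-tuple 'I_n -> d.-tuple 'I_n -> d.-tuple 'I_n -> R) :=
  \sum_(J | inc J) \sum_(K | inc K) \sum_(L | inc L) F J K L.
have S4D F G : S4 (fun J K L => F J K L + G J K L) = S4 F + S4 G.
  rewrite /S4 -big_split/=; apply: eq_bigr => J _; rewrite -big_split/=.
  by apply: eq_bigr => K _; rewrite -big_split/=.
suff T I : inc I -> S4 (fun J K L => o I J * (o K I + o K J + o K L) +
    o I K * (o J I + o J K + o J L) + o I L * (o J I + o J K + o J L)) = 9 * NN ^+ 3 * t ^+ 2.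
  rewrite (eq_bigr (fun=> h4 * (9 * NN ^+ 3 * t ^+ 2))); last first.
    move=> I sI; rewrite -(T I sI) /S4 mulr_sumr; apply: eq_bigr => J _; rewrite mulr_sumr.
    by apply: eq_bigr => K _; rewrite mulr_sumr.
  by rewrite sc le_eqVlt; apply/orP; left; apply/eqP; ring.
move=> sI.
have -> : (fun J K L => o I J * (o K I + o K J + o K L) +
    o I K * (o J I + o J K + o J L) + o I L * (o J I + o J K + o J L)) =
  (fun J K L => o I J * o K I + (o I J * o K J + (o I J * o K L + (o I K * o J I + (o I K * o J K
    + (o I K * o J L + (o I L * o J I + (o I L * o J K + o I L * o J L)))))))).
  by apply/funext => J; apply/funext => K; apply/funext => L; ring.
(* Two distinct pairs form a forest on the four tuples: with [I] fixed, each sum is evaluated from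
   the leaves, every pair giving [NN * t] and the remaining tuple [NN]. *)
rewrite !S4D.
have -> : S4 (fun J K L => o I J * o K I) = NN ^+ 3 * t ^+ 2.
  transitivity (\sum_(J | inc J) (NN * (NN * t)) * o I J); last by rewrite so//; ring.
  apply: eq_bigr => J sJ; transitivity (\sum_(K | inc K) (NN * o I J) * o K I).
    by apply: eq_bigr => K sK; rewrite sc; ring.
  by rewrite so'//; ring.
have -> : S4 (fun J K L => o I J * o K J) = NN ^+ 3 * t ^+ 2.
  transitivity (\sum_(J | inc J) (NN * (NN * t)) * o I J); last by rewrite so//; ring.
  apply: eq_bigr => J sJ; transitivity (\sum_(K | inc K) (NN * o I J) * o K J).
    by apply: eq_bigr => K sK; rewrite sc; ring.
  by rewrite so'//; ring.
have -> : S4 (fun J K L => o I J * o K L) = NN ^+ 3 * t ^+ 2.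
  transitivity (\sum_(J | inc J) (NN * (NN * t)) * o I J); last by rewrite so//; ring.
  apply: eq_bigr => J sJ; transitivity (\sum_(K : d.-tuple 'I_n | inc K) (o I J * (NN * t))).
    by apply: eq_bigr => K sK; rewrite so.
  by rewrite sc; ring.
have -> : S4 (fun J K L => o I K * o J I) = NN ^+ 3 * t ^+ 2.
  transitivity (\sum_(J | inc J) (NN * (NN * t)) * o J I); last by rewrite so'//; ring.
  apply: eq_bigr => J sJ; transitivity (\sum_(K | inc K) (NN * o J I) * o I K).
    by apply: eq_bigr => K sK; rewrite sc; ring.
  by rewrite so//; ring.
have -> : S4 (fun J K L => o I K * o J K) = NN ^+ 3 * t ^+ 2.
  rewrite /S4 exchange_big/=.
  transitivity (\sum_(K | inc K) (NN * (NN * t)) * o I K); last by rewrite so//; ring.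
  apply: eq_bigr => K sK; transitivity (\sum_(J | inc J) (NN * o I K) * o J K).
    by apply: eq_bigr => J sJ; rewrite sc; ring.
  by rewrite so'//; ring.
have -> : S4 (fun J K L => o I K * o J L) = NN ^+ 3 * t ^+ 2.
  transitivity (\sum_(J : d.-tuple 'I_n | inc J) (NN * t * (NN * t))); last by rewrite sc; ring.
  apply: eq_bigr => J sJ; transitivity (\sum_(K | inc K) (NN * t) * o I K).
    by apply: eq_bigr => K sK; rewrite so// mulrC.
  by rewrite so.
have -> : S4 (fun J K L => o I L * o J I) = NN ^+ 3 * t ^+ 2.
  transitivity (\sum_(J | inc J) (NN * (NN * t)) * o J I); last by rewrite so'//; ring.
  apply: eq_bigr => J sJ; transitivity (\sum_(K : d.-tuple 'I_n | inc K) (NN * t * o J I)).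
    apply: eq_bigr => K sK; rewrite [RHS]mulrC -(so _ I sI).
    by apply: eq_bigr => L _; rewrite mulrC.
  by rewrite sc; ring.
have -> : S4 (fun J K L => o I L * o J K) = NN ^+ 3 * t ^+ 2.
  transitivity (\sum_(J : d.-tuple 'I_n | inc J) (NN * t * (NN * t))); last by rewrite sc; ring.
  apply: eq_bigr => J sJ; transitivity (\sum_(K | inc K) (NN * t) * o J K); last by rewrite so.
  apply: eq_bigr => K sK; rewrite [RHS]mulrC -(so _ I sI).
  by apply: eq_bigr => L _; rewrite mulrC.
have -> : S4 (fun J K L => o I L * o J L) = NN ^+ 3 * t ^+ 2.
  rewrite /S4 exchange_big/=.
  transitivity (\sum_(K : d.-tuple 'I_n | inc K) (NN * t * (NN * t))); last by rewrite sc; ring.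
  apply: eq_bigr => K sK; rewrite exchange_big/=.
  transitivity (\sum_(L | inc L) (NN * t) * o I L); last by rewrite so.
  by apply: eq_bigr => L sL; rewrite so'// mulrC.
ring.
Qed.

End diagonal.

(** * Concentration of quadratic forms in one column *)

Section quadratic_form.
Variables (k : 'I_p) (K : pred 'I_N) (Q : 'I_n -> 'I_n -> T -> R) (C : R).
Hypothesis K_off : forall x, K x -> pos k predT x -> False.
Hypothesis Q_sym : forall i j z, Q i j z = Q j i z.
Hypothesis Q_mes : forall i j, measurable_fun [set: T] (Q i j).
Hypothesis Q_bnd : forall i j z, `|Q i j z| <= C.
Hypothesis Q_dep : forall i j, depends_on K (Q i j).

Let mQ r i j : mom mu r (Q i j).
Proof. exact: mom_bounded. Qed.

Let dep_col (A : pred 'I_n) (f : T -> R) : depends_on (pos k A) f -> depends_on (pos k predT) f.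
Proof. by apply: depends_onS; exact: posS. Qed.

Lemma s2_gg4 : s2 ^+ 2 <= gg4.
Proof.
have [_ [_ i4]] := (g4.2, g4.1); rewrite /s2 /gg4.
rewrite (_ : (fun x => g x ^+ 4) = (fun x => (g x ^+ 2) ^+ 2)); last first.
  by apply/funext => x; rewrite -exprM.
apply: sqr_EE_le; first exact: measurable_funX.
by under eq_fun do rewrite -exprM.
Qed.

Let dv i (z : T) := yi k i z ^+ 2 - s2.

Let itg_yi2 i : itg mu (fun z => yi k i z ^+ 2).
Proof. by apply: mom1_sqr; apply: momS; exact: mom_yi. Qed.

Let mom_dv i : mom mu 1 (dv i).
Proof.
apply: momB; last exact: mom_cst.
by rewrite /=; under eq_fun do rewrite expr2; apply: momM; exact: mom_yi.
Qed.

Let dep_dv i : depends_on (pos k (pred1 i)) (dv i).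
Proof. by move=> z z' zz'; rewrite /dv (dep_yi zz'). Qed.

Let EE_dv i : E (dv i) = 0.
Proof.
rewrite EEB//; last exact: itg_cst.
rewrite EE_cst -[X in X - _](_ : s2 = _) ?subrr// -(EE_yi2 k i).
by congr EE; apply/funext => z; rewrite expr2.
Qed.

Lemma EE_dv_ij i j : i != j -> E (fun z => dv i z * dv j z) = 0.
Proof.
move=> ij; have D : forall x, pos k (pred1 i) x -> pos k (pred1 j) x -> False.
  by apply: pos_disj => l /= /eqP -> /eqP ij'; rewrite ij' eqxx in ij.
have [_ ->] := itg_EE_indep hmu D (@dep_dv i) (@dep_dv j) (mom_itg (mom_dv i)) (mom_itg (mom_dv j)).
by rewrite EE_dv mul0r.
Qed.

Lemma EE_dv_le i : E (fun z => dv i z * dv i z) <= gg4.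
Proof.
have i4 : itg mu (fun z => yi k i z ^+ 4) by case: (mom_yi k i).
have j2 := itgZ (2 * s2) (itg_yi2 i).
have -> : (fun z => dv i z * dv i z) = (fun z => yi k i z ^+ 4 - 2 * s2 * yi k i z ^+ 2 + s2 ^+ 2).
  by apply/funext => z; rewrite /dv; ring.
rewrite (EED (itgB i4 j2) (itg_cst _ _)) (EEB i4 j2) (EEZ _ _ (itg_mfun (itg_yi2 i))) EE_cst.
have -> : E (fun z => yi k i z ^+ 2) = s2.
  by rewrite -(EE_yi2 k i); congr EE; apply/funext => z; rewrite expr2.
rewrite (EE_yi k i (exprn_measurable 4)) -/gg4; have := sqr_ge0 s2; nra.
Qed.

Definition qdiag z := \sum_i Q i i z * dv i z.
Definition qoff z := \sum_(ij : 'I_n * 'I_n | ij.1 != ij.2)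
  Q ij.1 ij.2 z * (yi k ij.1 z * yi k ij.2 z).

Lemma EE_qdiag : itg mu (fun z => qdiag z ^+ 2) /\
  E (fun z => qdiag z ^+ 2) <= gg4 * \sum_i E (fun z => Q i i z ^+ 2).
Proof.
have [] := @EE_sqr_bilinear _ predT (fun=> 1) (fun i => Q i i) dv K (pos k predT) K_off.
- by move=> i _; exact: Q_dep.
- by move=> i _; apply: dep_col (@dep_dv i).
- by move=> i _; exact: mQ.
- by move=> i _; exact: mom_dv.
have -> : (fun z => (\sum_i 1 * (Q i i z * dv i z)) ^+ 2) = (fun z => qdiag z ^+ 2).
  by apply/funext => z; congr (_ ^+ 2); apply: eq_bigr => i _; rewrite mul1r.
move=> hi ->; split => //; rewrite mulr_sumr; apply: ler_sum => i _.
rewrite (bigD1 i)//= big1 ?addr0; last first.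
  by move=> j ji; rewrite EE_dv_ij 1?eq_sym// !mulr0.
rewrite !mul1r mulrC (_ : (fun z => Q i i z * Q i i z) = (fun z => Q i i z ^+ 2)); last first.
  by apply/funext => z; rewrite expr2.
by rewrite ler_wpM2r ?EE_dv_le// EE_ge0// => z; exact: sqr_ge0.
Qed.

(** An index occurring only once gives 0 by [EE_yi_isolated], so just the two pairings of [(i, j)]
    with [(i', j')] survive. *)
Lemma EE_y4 i j i' j' : i != j -> i' != j' ->
  E (fun z => (yi k i z * yi k j z) * (yi k i' z * yi k j' z)) =
  s2 ^+ 2 * (((i', j') == (i, j))%:R + ((i', j') == (j, i))%:R).
Proof.
have mp a b : mom mu 1 (fun z => yi k a z * yi k b z) by apply: momM; exact: mom_yi.
have iso a b c e : b != a -> c != a -> e != a ->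
    E (fun z => yi k a z * (yi k b z * (yi k c z * yi k e z))) = 0.
  move=> ba ca ea; apply: (EE_yi_isolated (K := pos k (predC1 a))).
  - by apply: pos_disj => l /= ->.
  - have hc u : u != a -> depends_on (pos k (predC1 a)) (yi k u).
      by move=> ua; apply: depends_onS (@dep_yi k u); apply: posS => l /= /eqP ->.
    by apply: depends_on2; [exact: hc|apply: depends_on2; exact: hc].
  - by apply/mom0; apply: momM; [exact: momS (mom_yi _ _)|exact: mp].
have two a b : a != b -> E (fun z => (yi k a z * yi k b z) * (yi k a z * yi k b z)) = s2 ^+ 2.
  move=> ab; have D : forall x, pos k (pred1 a) x -> pos k (pred1 b) x -> False.
    by apply: pos_disj => l /= /eqP -> /eqP ij'; rewrite ij' eqxx in ab.
  have da u : depends_on (pos k (pred1 u)) (fun z => yi k u z * yi k u z).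
    by apply: depends_on2; exact: dep_yi.
  have iu u : itg mu (fun z => yi k u z * yi k u z) by apply: mom_itg (mp u u).
  have [_ h] := itg_EE_indep hmu D (da a) (da b) (iu a) (iu b).
  rewrite expr2 -{1}(EE_yi2 k a) -(EE_yi2 k b) -h; congr EE.
  by apply/funext => z; ring.
move=> ij ij'; rewrite !xpair_eqE.
have [ii'|ii'] := eqVneq i' i; have [jj'|jj'] := eqVneq j' j => /=.
- rewrite ii' jj' (negbTE ij) /= addr0 mulr1; exact: two.
- subst i'; rewrite (negbTE ij) /= addr0 mulr0 -[RHS](iso j' i j i)//; last by rewrite eq_sym.
  by congr EE; apply/funext => z; ring.
- subst j'; rewrite [j == i]eq_sym (negbTE ij) andbF addr0 mulr0 -[RHS](iso i' i j j)//.
  + by congr EE; apply/funext => z; ring.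
  + by rewrite eq_sym.
  + by rewrite eq_sym.
  + by rewrite eq_sym.
- have [e|e] := eqVneq i' j; have [e'|e'] := eqVneq j' i => /=.
  + subst i' j'; rewrite add0r mulr1 -(two i j ij); congr EE; apply/funext => z; ring.
  + subst i'; rewrite addr0 mulr0 -[RHS](iso i j j j'); first by congr EE; apply/funext => z; ring.
    * by rewrite eq_sym.
    * by rewrite eq_sym.
    * by [].
  + subst j'; rewrite addr0 mulr0 -[RHS](iso j i i i'); first by congr EE; apply/funext => z; ring.
    * by [].
    * by [].
    * by [].
  + rewrite addr0 mulr0 -[RHS](iso i j i' j'); first by congr EE; apply/funext => z; ring.
    * by rewrite eq_sym.
    * by [].
    * by [].
Qed.

(** Symmetry of [Q] makes the two pairings contribute the same square, hence the 2; [s2 ^+ 2 <= gg4]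
    aligns the constant with the diagonal part. *)
Lemma EE_qoff : itg mu (fun z => qoff z ^+ 2) /\
  E (fun z => qoff z ^+ 2) <= 2 * gg4 * \sum_i \sum_(j | i != j) E (fun z => Q i j z ^+ 2).
Proof.
have [] := @EE_sqr_bilinear _ (fun ij : 'I_n * 'I_n => ij.1 != ij.2) (fun=> 1)
  (fun ij => Q ij.1 ij.2) (fun ij z => yi k ij.1 z * yi k ij.2 z) K (pos k predT) K_off.
- by move=> ij _; exact: Q_dep.
- by move=> ij _; apply: depends_on2; apply: dep_col (@dep_yi k _).
- by move=> ij _; exact: mQ.
- by move=> ij _; apply: momM; exact: mom_yi.
have -> : (fun z => (\sum_(ij : 'I_n * 'I_n | ij.1 != ij.2) 1 * (Q ij.1 ij.2 z *
    (yi k ij.1 z * yi k ij.2 z))) ^+ 2) = (fun z => qoff z ^+ 2).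
  by apply/funext => z; congr (_ ^+ 2); apply: eq_bigr => i _; rewrite mul1r.
move=> hi ->; split => //.
rewrite [X in _ <= _ * X]pair_big_dep/= mulr_sumr; apply: ler_sum => -[i j] /= ij.
set q := E _; have q0 : 0 <= q by apply: EE_ge0 => z; exact: sqr_ge0.
rewrite (eq_bigr (fun ij' : 'I_n * 'I_n => s2 ^+ 2 * q * ((ij' == (i, j))%:R + (ij' == (j, i))%:R))); last first.
  move=> [i' j'] /= ij'; rewrite EE_y4//.
  have [E1|_] := eqVneq (i', j') (i, j).
    by case: E1 => -> ->; rewrite !mul1r mulrA [X in X * _]mulrC; congr (_ * _ * _).
  have [E1|_] := eqVneq (i', j') (j, i).
    case: E1 => -> ->; rewrite !mul1r mulrA [X in X * _]mulrC; congr (_ * _ * _).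
    by congr EE; apply/funext => z; rewrite expr2 (Q_sym j i).
  by rewrite addr0 !mulr0.
rewrite -mulr_sumr big_split/=.
have c1 (x : 'I_n * 'I_n) : x.1 != x.2 ->
    \sum_(y : 'I_n * 'I_n | y.1 != y.2) ((y == x)%:R : R) = 1.
  move=> hx; rewrite (bigD1 x)//= eqxx big1 ?addr0// => y /andP[_ /negbTE ->] //.
rewrite !c1//=; last by rewrite eq_sym.
have := s2_gg4; have : s2 ^+ 2 * q <= gg4 * q by rewrite ler_wpM2r// s2_gg4.
lra.
Qed.

Definition quad_form z := \sum_i \sum_j Q i j z * (yi k i z * yi k j z).

(** The matrix does not read column [k], so the form concentrates at [s2] times its trace. The 4 is
    the 2 of [(u + v) ^ 2 <= 2 u ^ 2 + 2 v ^ 2] times the 2 of [EE_qoff]. *)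
Lemma EE_quad_form : itg mu (fun z => (quad_form z - s2 * \sum_i Q i i z) ^+ 2) /\
  E (fun z => (quad_form z - s2 * \sum_i Q i i z) ^+ 2)
  <= 4 * gg4 * \sum_i \sum_j E (fun z => Q i j z ^+ 2).
Proof.
have qE z : quad_form z - s2 * \sum_i Q i i z = qdiag z + qoff z.
  rewrite /qdiag /qoff /dv -(pair_big_dep predT (fun i j => i != j)
    (fun i j => Q i j z * (yi k i z * yi k j z)))/= mulr_sumr -sumrB -big_split/=.
  apply: eq_bigr => i _; rewrite (bigD1 i)//=.
  rewrite [X in _ + X - _](eq_bigl (fun j => i != j)); last by move=> j; rewrite eq_sym.
  ring.
have [i1 h1] := EE_qdiag; have [i2 h2] := EE_qoff.
have mq : measurable_fun setT (fun z => quad_form z - s2 * \sum_i Q i i z).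
  apply: measurable_funB; last first.
    by apply: measurable_funM => //; apply: measurable_sum => i.
  apply: measurable_sum => i; apply: measurable_sum => j.
  by apply: measurable_funM => //; apply: measurable_funM; exact: (mom_yi _ _).1.
have bnd z : (quad_form z - s2 * \sum_i Q i i z) ^+ 2 <= 2 * qdiag z ^+ 2 + 2 * qoff z ^+ 2.
  by rewrite qE; have := sqr_ge0 (qdiag z - qoff z); nra.
have iR := itgD (itgZ 2 i1) (itgZ 2 i2).
have iq : itg mu (fun z => (quad_form z - s2 * \sum_i Q i i z) ^+ 2).
  apply: itg_le iR; first exact: measurable_funX.
  by move=> z; rewrite ger0_norm ?sqr_ge0.
split => //; apply: le_trans (EE_le iq iR bnd) _.
rewrite (EED (itgZ 2 i1) (itgZ 2 i2)) (EEZ _ _ (itg_mfun i1)) (EEZ _ _ (itg_mfun i2)).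
rewrite (eq_bigr (fun i => E (fun z => Q i i z ^+ 2) + \sum_(j | i != j) E (fun z => Q i j z ^+ 2))); last first.
  move=> i _; rewrite (bigD1 i)//=; congr (_ + _); apply: eq_bigl => j; by rewrite eq_sym.
rewrite big_split/= mulrDr.
have d0 : 0 <= gg4 * \sum_i E (fun z => Q i i z ^+ 2).
  rewrite mulr_ge0 ?(le_trans (sqr_ge0 s2) s2_gg4)//; apply: sumr_ge0 => i _.
  by apply: EE_ge0 => z; exact: sqr_ge0.
lra.
Qed.

End quadratic_form.

End array.

(** * Stieltjes transform of the Gram matrix *)

Section measurable_matrix.
Context {dT : measure_display} {T : measurableType dT} {R : realType}.

Lemma measurable_funV (f : T -> R) : measurable_fun [set: T] f ->
  measurable_fun [set: T] (fun z => (f z)^-1).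
Proof.
move=> mf; apply: (@measurableT_comp _ _ _ _ _ _ (@GRing.inv R)) => //.
rewrite -(setvU ([set 0%R] : set R)); apply/measurable_funU;
  [exact: measurableC|by []|split; last exact: measurable_fun_set1].
apply: open_continuous_measurable_fun.
  exact/closed_openC/accessible_closed_set1/hausdorff_accessible/Rhausdorff.
by move=> x; rewrite inE/= => /eqP x0; exact: inv_continuous.
Qed.

Definition mx_measurable {p q : nat} (A : T -> 'M[R]_(p, q)) :=
  forall i j, measurable_fun [set: T] (fun z => A z i j).

Lemma measurable_fun_sum (I : Type) (r : seq I) (Q : pred I) (F : I -> T -> R) :
  (forall i, measurable_fun [set: T] (F i)) ->
  measurable_fun [set: T] (fun z => \sum_(i <- r | Q i) F i z).
Proof.
move=> mF; elim: r => [|i r ih].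
  by under eq_fun do rewrite big_nil; exact: measurable_cst.
under eq_fun do rewrite big_cons.
by have [Qi|//] := boolP (Q i); apply: measurable_funD.
Qed.

Lemma mx_measurable_mul p q r (A : T -> 'M[R]_(p, q)) (B : T -> 'M[R]_(q, r)) :
  mx_measurable A -> mx_measurable B -> mx_measurable (fun z => A z *m B z).
Proof.
move=> mA mB i j; under eq_fun do rewrite mxE.
by apply: measurable_fun_sum => k; apply: measurable_funM.
Qed.

Lemma mx_measurable_tr p q (A : T -> 'M[R]_(p, q)) :
  mx_measurable A -> mx_measurable (fun z => (A z)^T).
Proof. by move=> mA i j; under eq_fun do rewrite mxE; exact: mA. Qed.

Lemma mx_measurableD p q (A B : T -> 'M[R]_(p, q)) :
  mx_measurable A -> mx_measurable B -> mx_measurable (fun z => A z + B z).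
Proof. by move=> mA mB i j; under eq_fun do rewrite mxE; exact: measurable_funD. Qed.

Lemma mx_measurable_cst p q (A : 'M[R]_(p, q)) : mx_measurable (fun=> A).
Proof. by move=> i j; exact: measurable_cst. Qed.

Lemma measurable_det p (A : T -> 'M[R]_p) : mx_measurable A ->
  measurable_fun [set: T] (fun z => \det (A z)).
Proof.
move=> mA; apply: measurable_fun_sum => s; apply: measurable_funM => //.
by apply: measurable_prod => i _; exact: mA.
Qed.

Lemma measurable_trace p (A : T -> 'M[R]_p) : mx_measurable A ->
  measurable_fun [set: T] (fun z => \tr (A z)).
Proof. by move=> mA; apply: measurable_fun_sum => i; exact: mA. Qed.

(** Cramer's rule: the entries are cofactors over a determinant, hence measurable. *)
Lemma mx_measurable_resolvent p (A : T -> 'M[R]_p) (x : R) : 0 < x ->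
  (forall z, psd (A z)) -> mx_measurable A ->
  mx_measurable (fun z => resolvent (A z) x).
Proof.
move=> x0 pA mA i j.
have mB : mx_measurable (fun z => A z + x%:M).
  by apply: mx_measurableD => //; exact: mx_measurable_cst.
have -> : (fun z => resolvent (A z) x i j) =
    (fun z => (\det (A z + x%:M))^-1 * cofactor (A z + x%:M) j i).
  apply/funext => z; rewrite /resolvent /invmx resolvent_unit//.
  by rewrite !mxE.
apply: measurable_funM; first by apply: measurable_funV; exact: measurable_det.
apply: measurable_funM => //; apply: measurable_det => k l.
have -> : (fun z => row' j (col' i (A z + x%:M)) k l) =
    (fun z => (A z + x%:M) (lift j k) (lift i l)) by apply/funext => z; rewrite !mxE.
exact: mB.
Qed.

End measurable_matrix.

Section mp_root.
Context {R : realFieldType}.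

(* [ms] plays the role of the limiting Stieltjes transform at [- x], [mm] that of
   the empirical one and [M] that of its companion for [Y *m Y^T]. *)
Lemma mp_root_stable (x al q ms a c mm M : R) :
  0 < x -> 0 <= al -> 0 <= q -> 0 < ms -> 0 <= a -> 0 <= c ->
  al * q * x * ms ^+ 2 + (x + al * (1 - q)) * ms = 1 ->
  0 <= mm -> x * mm <= 1 -> 0 <= M -> x * M = c * (x * mm) + 1 - c ->
  (mm - ms) ^+ 2 <= 2 * ms ^+ 2 * ((1 + a / x) ^+ 2 * (x * mm - (1 + a * M)^-1) ^+ 2
    + ((al * `|q - c| + `|al - a|) / x) ^+ 2).
Proof.
move=> x0 al0 q0 ms0 a0 c0 root mm0 xmm M0 ME.
have xM : x * M <= 1 \/ 1 < x * M by case: (leP (x * M) 1); [left|right].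
set r := x * mm - (1 + a * M)^-1; set e := (al * `|q - c| + `|al - a|) / x.
have aM0 : 0 < 1 + a * M by rewrite ltr_wpDr ?mulr_ge0.
(* [f] is the limiting equation evaluated at [mm]. Subtracting [mm] times the equation of [ms]
   factors [f * ms] as [mm - ms] times a quantity at least 1, so the positive root is stable with an
   explicit constant. *)
pose f := al * q * x * mm ^+ 2 + (x + al * (1 - q)) * mm - 1.
have F : f * ms = (mm - ms) * (1 + al * q * x * mm * ms).
  have : f * ms = f * ms - mm * (al * q * x * ms ^+ 2 + (x + al * (1 - q)) * ms - 1).
    by rewrite root subrr mulr0 subr0.
  by move=> ->; rewrite /f; ring.
have G : 1 <= 1 + al * q * x * mm * ms by rewrite lerDl !mulr_ge0// ltW.
have B : (mm - ms) ^+ 2 <= ms ^+ 2 * f ^+ 2.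
  rewrite -exprMn mulrC F exprMn ler_peMr ?sqr_ge0//.
  exact: exprn_ege1.
have xm0 : 0 <= x * mm by rewrite mulr_ge0// ltW.
have M1 : x * M <= 1.
  by rewrite ME -subr_ge0 (_ : _ - _ = c * (1 - x * mm)); [rewrite mulr_ge0 ?subr_ge0|ring].
have Mx : M <= x^-1 by rewrite -[leLHS]mulr1 -(divff (lt0r_neq0 x0)) mulrA ler_piMl ?invr_ge0 ?(ltW x0)// mulrC.
(* The defect splits into the residual [r] of the finite equation and the drift of [c] and [a] from
   [q] and [al]. *)
have E : f = (1 + a * M) * r + x * mm * (al * ((q - c) * (mm - x^-1)) + (al - a) * M).
  have -> : (1 + a * M) * r = (1 + a * M) * (x * mm) - 1.
    by rewrite /r mulrBr divff ?lt0r_neq0.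
  have -> : M = (c * (x * mm) + 1 - c) / x by rewrite -ME mulrAC divff ?mul1r// lt0r_neq0.
  rewrite /f; field; exact: lt0r_neq0.
have E2 : `|x * mm * (al * ((q - c) * (mm - x^-1)) + (al - a) * M)| <= e.
  have h1 : `|mm - x^-1| <= x^-1.
    rewrite ler_norml lerBrDr addrC subrr mm0/= lerBlDr.
    have : mm <= x^-1 by rewrite -[leLHS]mulr1 -(divff (lt0r_neq0 x0)) mulrA ler_piMl ?invr_ge0 ?(ltW x0)// mulrC.
    have : 0 <= x^-1 by rewrite invr_ge0 ltW.
    lra.
  rewrite normrM (ger0_norm xm0); apply: le_trans (ler_piMl (normr_ge0 _) xmm) _.
  apply: le_trans (ler_normD _ _) _; rewrite !normrM (ger0_norm al0) (ger0_norm M0) /e mulrDl.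
  apply: lerD; last by rewrite ler_wpM2l.
  by rewrite -!mulrA ler_wpM2l// ler_wpM2l.
have e0 : 0 <= e by apply: le_trans E2.
have E3 : f ^+ 2 <= 2 * ((1 + a / x) ^+ 2 * r ^+ 2 + e ^+ 2).
  set u := (1 + a * M) * r in E; set v := x * mm * _ in E E2.
  have h3 : u ^+ 2 <= (1 + a / x) ^+ 2 * r ^+ 2.
    rewrite /u exprMn ler_wpM2r ?sqr_ge0// lerXn2r// ?nnegrE ?(ltW aM0)//.
      by rewrite addr_ge0// divr_ge0// ltW.
    by rewrite lerD2l ler_wpM2l.
  have h4' : v ^+ 2 <= e ^+ 2 by rewrite -[v ^+ 2]real_normK ?num_real// lerXn2r// nnegrE.
  by rewrite E; have := sqr_ge0 (u - v); nra.
apply: le_trans B _; set W := (X in 2 * _ * X).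
have -> : 2 * ms ^+ 2 * W = ms ^+ 2 * (2 * W) by ring.
by apply: ler_wpM2l => //; exact: sqr_ge0.
Qed.

End mp_root.

(** * Approximate quadratic equation for the Gram matrix *)

Section gram_stieltjes.
Context {dS : measure_display} {S : measurableType dS} {R : realType}.
Variables (m : probability S R) (N n p : nat) (mu : probability (N.-tuple S) R).
Hypothesis hmu : iid_map m mu id.
Variable idx : 'I_n -> 'I_p -> 'I_N.
Hypothesis idx_inj : forall i k i' k', idx i k = idx i' k' -> i = i' /\ k = k'.
Variables (d : nat) (nu : probability (d.-tuple S) R).
Hypothesis hnu : iid_map m nu id.
Hypothesis d2 : (2 <= d)%N.
Variable phi : d.-tuple S -> R.
Hypothesis mphi : measurable_fun [set: d.-tuple S] phi.
Hypothesis aphi : antisymmetric_fun phi.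
Hypothesis phi8 : mom nu 3 phi.
Hypotheses (n0 : (0 < n)%N) (p0 : (0 < p)%N).
Local Notation T := (N.-tuple S).
Local Notation E := (EE mu).
Local Notation s := (s2 m nu phi).
Local Notation g4 := (gg4 m nu phi).
Local Notation y := (yi idx nu phi).

Definition Ymx (z : T) : 'M[R]_(n, p) :=
  \matrix_(i, k) (Num.sqrt (d%:R / n%:R) * y k i z).

Lemma Ymx_gram z k l : ((Ymx z)^T *m Ymx z) k l = lin_cov idx nu phi k l z.
Proof.
rewrite !mxE /lin_cov mulr_sumr; apply: eq_bigr => i _; rewrite !mxE.
by rewrite mulrACA -expr2 sqr_sqrtr// divr_ge0 ?ler0n.
Qed.

Lemma mx_measurable_Y : mx_measurable Ymx.
Proof.
move=> i k; under eq_fun do rewrite mxE; apply: measurable_funM => //.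
exact: (mom_yi hmu idx hnu d2 mphi phi8 k i).1.
Qed.

Variable x : R.
Hypothesis x0 : 0 < x.

Let Z k (z : T) := zero_col (Ymx z) k.
Let Qk k (z : T) := resolvent (Z k z *m (Z k z)^T) x.

Let mQk k : mx_measurable (Qk k).
Proof.
apply: mx_measurable_resolvent => //; first by move=> z; exact: psd_gramT.
have mZ : mx_measurable (Z k).
  move=> i l; under eq_fun do rewrite mxE; case: (l == k); first exact: measurable_cst.
  exact: mx_measurable_Y.
by apply: mx_measurable_mul => //; exact: mx_measurable_tr.
Qed.

Let Qk_frob k z : \sum_i \sum_j Qk k z i j ^+ 2 <= n%:R / x ^+ 2.
Proof.
have := frob_resolvent (psd_gramT (Z k z)) x0; rewrite frobE.
by rewrite mulrC -ler_pdivlMr ?exprn_gt0.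
Qed.

(** From [|u| <= u ^ 2 + 1]. A crude constant is enough: it serves integrability and does not enter
    the moment bounds. *)
Let Qk_bnd k i j z : `|Qk k z i j| <= n%:R / x ^+ 2 + 1.
Proof.
have h : Qk k z i j ^+ 2 <= n%:R / x ^+ 2.
  apply: le_trans (Qk_frob k z); rewrite (bigD1 i)//= (bigD1 j)//= -addrA lerDl.
  by rewrite addr_ge0//; do ?(apply: sumr_ge0 => ? _); rewrite sqr_ge0.
rewrite -(real_normK (num_real (Qk k z i j))) in h.
have := sqr_ge0 (`|Qk k z i j| - 1); have := normr_ge0 (Qk k z i j); nra.
Qed.

Let off k : pred 'I_N := fun u => [exists l, (l != k) && pos idx l predT u].

Let Qk_dep k i j : depends_on (off k) (fun z => Qk k z i j).
Proof.
move=> z z' zz'; rewrite /Qk (_ : Z k z = Z k z')//.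
apply/matrixP => a l; rewrite !mxE; case: eqP => // /eqP lk; congr (_ * _).
apply: (@dep_yi _ _ _ _ _ _ _ idx_inj) => u hu; apply: zz'; apply/existsP; exists l.
by rewrite lk; move: hu; apply: posS.
Qed.

Let Qk_sym k i j z : Qk k z i j = Qk k z j i.
Proof. by have := resolvent_sym x (psd_gramT (Z k z)); move/matrixP/(_ j i); rewrite mxE. Qed.

Let off_col k : forall u, off k u -> pos idx k predT u -> False.
Proof. by move=> u /existsP[l /andP[lk]]; exact: pos_col. Qed.

Definition theta k z := loo_quad (Ymx z) x k.

Lemma theta_quad k z :
  theta k z = d%:R / n%:R * quad_form idx nu phi k (fun i j z => Qk k z i j) z.
Proof.
rewrite /theta /loo_quad frobE /quad_form mulr_sumr; apply: eq_bigr => i _.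
rewrite big_ord1 !mxE !mulr_sumr; apply: eq_bigr => j _; rewrite !mxE.
have c2 : d%:R / n%:R = Num.sqrt (d%:R / n%:R) * Num.sqrt (d%:R / n%:R) :> R.
  by rewrite -expr2 sqr_sqrtr// divr_ge0 ?ler0n.
rewrite [X in _ = X * _]c2 -/(Z k z) -/(Qk k z); ring.
Qed.

Local Notation a := (d%:R * s).

(** [Qk k] ignores column [k], so [EE_quad_form] applies. Its squared entries sum to at most
    [n / x ^ 2], against the prefactor [(d / n) ^ 2]: the order is [1 / n]. *)
Lemma EE_theta k : itg mu (fun z => (theta k z - a / n%:R * \tr (Qk k z)) ^+ 2) /\
  E (fun z => (theta k z - a / n%:R * \tr (Qk k z)) ^+ 2)
  <= 4 * d%:R ^+ 2 * g4 / (n%:R * x ^+ 2).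
Proof.
have [iq hq] := EE_quad_form hmu idx_inj hnu d2 mphi aphi phi8 (@off_col k)
   (Qk_sym k) (@mQk k) (Qk_bnd k) (@Qk_dep k).
have eqf : (fun z => (theta k z - a / n%:R * \tr (Qk k z)) ^+ 2) = (fun z =>
    (d%:R / n%:R) ^+ 2 * (quad_form idx nu phi k (fun i j z => Qk k z i j) z - s * \sum_i Qk k z i i) ^+ 2).
  by apply/funext => z; rewrite theta_quad -exprMn; congr (_ ^+ 2); rewrite /mxtrace; ring.
rewrite eqf; split; first exact: itgZ.
rewrite (EEZ _ _ (itg_mfun iq)).
have n0r : 0 < n%:R :> R by rewrite ltr0n.
have g40 : 0 <= g4 by apply: EE_ge0 => ?; rewrite (exprM _ 2 2) sqr_ge0.
have hs : \sum_i \sum_j E (fun z => Qk k z i j ^+ 2) <= n%:R / x ^+ 2.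
  have iQ i j : itg mu (fun z => Qk k z i j ^+ 2).
    by apply: mom1_sqr; apply: mom_bounded (mQk k i j) (Qk_bnd k i j).
  rewrite (eq_bigr (fun i => E (fun z => \sum_j Qk k z i j ^+ 2))); last by move=> i _; rewrite EE_sum.
  rewrite -EE_sum; last by move=> i _; apply: itg_sum.
  rewrite -[leRHS](EE_cst mu); apply: EE_le => //; last exact: itg_cst.
  by apply: itg_sum => i _; apply: itg_sum.
apply: le_trans (ler_wpM2l (sqr_ge0 _) hq) _.
apply: le_trans (ler_wpM2l (sqr_ge0 _) (ler_wpM2l _ hs)) _; first by rewrite mulr_ge0.
rewrite le_eqVlt; apply/orP; left; apply/eqP; field.
by rewrite !lt0r_neq0.
Qed.

Definition gram_m z : R := \tr (resolvent ((Ymx z)^T *m Ymx z) x) / p%:R.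

Lemma mx_measurable_gram : mx_measurable (fun z => (Ymx z)^T *m Ymx z).
Proof. by apply: mx_measurable_mul; [apply: mx_measurable_tr|]; exact: mx_measurable_Y. Qed.

Lemma measurable_gram_m : measurable_fun setT gram_m.
Proof.
apply: measurable_funM => //; apply: measurable_trace; apply: mx_measurable_resolvent => //.
  by move=> z; exact: psd_gram.
exact: mx_measurable_gram.
Qed.

Lemma gram_m_bounds z : 0 <= gram_m z /\ x * gram_m z <= 1.
Proof.
have pr : 0 < p%:R :> R by rewrite ltr0n.
rewrite /gram_m divr_ge0 ?ler0n ?tr_resolvent_ge0//; last exact: psd_gram.
by rewrite mulrA ler_pdivrMr// mul1r tr_resolvent_le//; exact: psd_gram.
Qed.

Let MQ z := \tr (resolvent (Ymx z *m (Ymx z)^T) x) / n%:R.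

(** By [tr_gram_resolvent], [x * gram_m z] is the average of the [1 / (1 + theta k z)]. The map
    [t |-> 1 / (1 + t)] is 1-Lipschitz on nonnegative reals, [theta k] is close to [a / n] times the
    trace of [Qk k], and passing to the full resolvent costs at most [a / (n x)] by
    [tr_resolvent_loo]. *)
Lemma EE_gram_residual : itg mu (fun z => (x * gram_m z - (1 + a * MQ z)^-1) ^+ 2) /\
  E (fun z => (x * gram_m z - (1 + a * MQ z)^-1) ^+ 2)
  <= 8 * d%:R ^+ 2 * g4 / (n%:R * x ^+ 2) + 2 * (a / (n%:R * x)) ^+ 2.
Proof.
have pr : 0 < p%:R :> R by rewrite ltr0n.
have nr : 0 < n%:R :> R by rewrite ltr0n.
have a0 : 0 <= a by rewrite mulr_ge0 ?ler0n// s2_ge0.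
have M0 z : 0 <= MQ z by rewrite divr_ge0 ?ler0n ?tr_resolvent_ge0//; exact: psd_gramT.
have mM : measurable_fun setT MQ.
  apply: measurable_funM => //; apply: measurable_trace; apply: mx_measurable_resolvent => //.
    by move=> z; exact: psd_gramT.
  by apply: mx_measurable_mul; [|apply: mx_measurable_tr]; exact: mx_measurable_Y.
pose K := a / (n%:R * x).
pose U k z := 2 * (theta k z - a / n%:R * \tr (Qk k z)) ^+ 2 + 2 * K ^+ 2.
have iU k : itg mu (U k).
  by apply: itgD; [apply: itgZ; exact: (EE_theta k).1|exact: itg_cst].
have bnd z : (x * gram_m z - (1 + a * MQ z)^-1) ^+ 2 <= p%:R^-1 * \sum_k U k z.
  have -> : x * gram_m z - (1 + a * MQ z)^-1 =
      p%:R^-1 * \sum_k ((1 + theta k z)^-1 - (1 + a * MQ z)^-1).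
    rewrite /gram_m mulrA (tr_gram_resolvent (Ymx z) x0) mulrC -/theta sumrB sumr_const card_ord.
    by rewrite mulrBr -[(1 + a * MQ z)^-1 *+ p]mulr_natl mulKf// lt0r_neq0.
  have jensen (F : 'I_p -> R) : (p%:R^-1 * \sum_k F k) ^+ 2 <= p%:R^-1 * \sum_k F k ^+ 2.
    pose t := p%:R^-1 * \sum_k F k.
    have : 0 <= p%:R^-1 * \sum_k (F k - t) ^+ 2.
      by rewrite mulr_ge0 ?invr_ge0 ?ler0n//; apply: sumr_ge0 => k _; exact: sqr_ge0.
    rewrite (eq_bigr (fun k => F k ^+ 2 - (2 * t) * F k + t ^+ 2)); last by move=> k _; ring.
    rewrite big_split/= sumrB -mulr_sumr sumr_const card_ord -[t ^+ 2 *+ p]mulr_natr.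
    set A := \sum_k F k ^+ 2; rewrite -/t.
    have -> : p%:R^-1 * (A - 2 * t * \sum_k F k + t ^+ 2 * p%:R) = p%:R^-1 * A - t ^+ 2.
      by rewrite /t; field; exact: lt0r_neq0.
    by rewrite subr_ge0.
  apply: le_trans (jensen _) _; rewrite ler_wpM2l ?invr_ge0 ?ler0n//.
  apply: ler_sum => k _.
  have th0 : 0 <= theta k z by exact: loo_quad_ge0.
  have aM0 : 0 <= a * MQ z by rewrite mulr_ge0.
  apply: (@le_trans _ _ ((theta k z - a * MQ z) ^+ 2)).
    have -> : (1 + theta k z)^-1 - (1 + a * MQ z)^-1 =
       (a * MQ z - theta k z) / ((1 + theta k z) * (1 + a * MQ z)).
      by field; rewrite !lt0r_neq0// ltr_wpDr.
    rewrite exprMn -[(_ - _) ^+ 2]sqrrN opprB ler_piMr ?sqr_ge0//.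
    rewrite exprVn invf_le1 ?exprn_gt0 ?mulr_gt0 ?ltr_wpDr//.
    have : 1 <= (1 + theta k z) * (1 + a * MQ z) by nra.
    exact: exprn_ege1.
  have h : (a / n%:R * \tr (Qk k z) - a * MQ z) ^+ 2 <= K ^+ 2.
    have := tr_resolvent_loo (Ymx z) x0 k; rewrite -/(Qk k z).
    set t1 := \tr (Qk k z); set t2 := \tr (resolvent (Ymx z *m (Ymx z)^T) x) => /andP[h1 h2].
    have -> : a / n%:R * t1 - a * MQ z = K * (x * (t1 - t2)).
      by rewrite /MQ /K; field; rewrite !lt0r_neq0.
    by rewrite exprMn ler_piMr ?sqr_ge0// -[1](expr1n _ 2) lerXn2r// nnegrE.
  rewrite /U; set A := theta k z - a / n%:R * _; set B := a / n%:R * _ - _ in h.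
  have -> : theta k z - a * MQ z = A + B by rewrite /A /B; ring.
  have := sqr_ge0 (A - B); nra.
have iS : itg mu (fun z => p%:R^-1 * \sum_k U k z) by apply: itgZ; apply: itg_sum.
have iL : itg mu (fun z => (x * gram_m z - (1 + a * MQ z)^-1) ^+ 2).
  apply: itg_le iS; last by move=> z; rewrite ger0_norm ?sqr_ge0.
  apply: measurable_funX; apply: measurable_funB.
    by apply: measurable_funM => //; exact: measurable_gram_m.
  apply: measurable_funV; apply: measurable_funD => //; exact: measurable_funM.
split => //; apply: le_trans (EE_le iL iS bnd) _.
have iS0 : itg mu (fun z => \sum_k U k z) by exact: itg_sum.
rewrite (EEZ _ _ (itg_mfun iS0)).
rewrite EE_sum//.
apply: (@le_trans _ _ (p%:R^-1 * \sum_(k < p) (8 * d%:R ^+ 2 * g4 / (n%:R * x ^+ 2) + 2 * K ^+ 2))).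
  rewrite ler_wpM2l ?invr_ge0 ?ler0n//; apply: ler_sum => k _.
  have [i1 h1] := EE_theta k.
  rewrite (EED (itgZ 2 i1) (itg_cst _ _)) (EEZ _ _ (itg_mfun i1)) EE_cst lerD2r; lra.
pose X := 8 * d%:R ^+ 2 * g4 / (n%:R * x ^+ 2) + 2 * K ^+ 2; rewrite -/X.
by rewrite sumr_const card_ord -[X *+ p]mulr_natr mulrCA mulVf ?mulr1// lt0r_neq0.
Qed.

Lemma EE_gram_m (al q ms : R) : 0 <= al -> 0 <= q -> 0 < ms ->
  al * q * x * ms ^+ 2 + (x + al * (1 - q)) * ms = 1 ->
  E (fun z => (gram_m z - ms) ^+ 2) <= 2 * ms ^+ 2 *
    ((1 + a / x) ^+ 2 * (8 * d%:R ^+ 2 * g4 / (n%:R * x ^+ 2) + 2 * (a / (n%:R * x)) ^+ 2)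
     + ((al * `|q - p%:R / n%:R| + `|al - a|) / x) ^+ 2).
Proof.
move=> al0 q0 ms0 root.
have pr : 0 < p%:R :> R by rewrite ltr0n.
have nr : 0 < n%:R :> R by rewrite ltr0n.
have a0 : 0 <= a by rewrite mulr_ge0 ?ler0n// s2_ge0.
have [iR hR] := EE_gram_residual.
have bnd z := @mp_root_stable R x al q ms a (p%:R / n%:R) (gram_m z) (MQ z) x0 al0 q0 ms0 a0.
have iB : itg mu (fun z => 2 * ms ^+ 2 * ((1 + a / x) ^+ 2 * (x * gram_m z - (1 + a * MQ z)^-1) ^+ 2
    + ((al * `|q - p%:R / n%:R| + `|al - a|) / x) ^+ 2)).
  by apply: itgZ; apply: itgD; [exact: itgZ|exact: itg_cst].
have iC := itgD (itgZ ((1 + a / x) ^+ 2) iR) (itg_cst mu (((al * `|q - p%:R / n%:R| + `|al - a|) / x) ^+ 2)).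
have im : itg mu (fun z => (gram_m z - ms) ^+ 2).
  apply: mom1_sqr; apply: momB; last exact: mom_cst.
  apply: (@mom_bounded _ _ _ _ _ _ x^-1); first exact: measurable_gram_m.
  move=> z; have [h1 h2] := gram_m_bounds z; rewrite ger0_norm//.
  by rewrite -[leLHS](mulKf (lt0r_neq0 x0)) ler_piMr// invr_ge0 ltW.
apply: le_trans (EE_le im iB _) _.
  move=> z; have [h1 h2] := gram_m_bounds z; apply: bnd => //.
  - by rewrite divr_ge0 ?ler0n ?tr_resolvent_ge0//; exact: psd_gramT.
  - rewrite /MQ [LHS]mulrA (tr_resolvent_gramT (Ymx z) x0) /gram_m; field.
    by rewrite !lt0r_neq0.
rewrite (EEZ _ _ (itg_mfun iC)).
rewrite (EED (itgZ _ iR) (itg_cst _ _)) (EEZ _ _ (itg_mfun iR)) EE_cst.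
apply: ler_wpM2l; first by rewrite mulr_ge0// sqr_ge0.
by rewrite lerD2r; apply: ler_wpM2l => //; exact: sqr_ge0.
Qed.

(** The diagonal entry is [d / n] times the quadratic form of the identity matrix, which depends on
    no coordinate. *)
Lemma EE_lin_diag k : mom mu 1 (fun z => lin_cov idx nu phi k k z - a) /\
  E (fun z => (lin_cov idx nu phi k k z - a) ^+ 2) <= 4 * d%:R ^+ 2 * g4 / n%:R.
Proof.
have nr : 0 < n%:R :> R by rewrite ltr0n.
pose Q (i j : 'I_n) (z : T) : R := (i == j)%:R.
have [] := @EE_quad_form _ _ _ _ _ _ _ _ hmu idx idx_inj _ _ hnu d2 _ mphi aphi phi8 k pred0 Q 1.
- by [].
- by move=> i j z; rewrite /Q eq_sym.
- by move=> i j; exact: measurable_cst.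
- by move=> i j z; rewrite /Q normr_nat; case: eqP.
- by move=> i j.
set F := (fun z => _) => iF hF.
have eqf : (fun z => (lin_cov idx nu phi k k z - a) ^+ 2) = (fun z => (d%:R / n%:R) ^+ 2 * F z).
  apply/funext => z; rewrite /F -exprMn; congr (_ ^+ 2).
  rewrite /quad_form /lin_cov mulrBr; congr (_ * _ - _).
    apply: eq_bigr => i _; rewrite (bigD1 i)//= big1 ?addr0 /Q ?eqxx ?mul1r// => j ji.
    by rewrite eq_sym (negbTE ji) mul0r.
  have -> : \sum_i Q i i z = n%:R.
    by rewrite /Q; under eq_bigr do rewrite eqxx; rewrite sumr_const card_ord.
  by field; exact: lt0r_neq0.
split.
  split; last by rewrite eqf; exact: itgZ.
  apply: measurable_funB => //; apply: measurable_funM => //; apply: measurable_fun_sum => i.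
  by apply: measurable_funM; exact: (mom_yi hmu idx hnu d2 mphi phi8 k i).1.
rewrite eqf (EEZ _ _ (itg_mfun iF)); apply: le_trans (ler_wpM2l (sqr_ge0 _) hF) _.
rewrite (eq_bigr (fun=> 1)); last first.
  move=> i _; rewrite (bigD1 i)//= big1 ?addr0; last first.
    by move=> j ji; rewrite /Q eq_sym (negbTE ji) expr0n/= EE_cst.
  by rewrite /Q eqxx expr1n EE_cst.
rewrite sumr_const card_ord le_eqVlt; apply/orP; left; apply/eqP; field; exact: lt0r_neq0.
Qed.

Lemma EE_lin_off k l : k != l -> itg mu (fun z => lin_cov idx nu phi k l z ^+ 2) /\
  E (fun z => lin_cov idx nu phi k l z ^+ 2) = a ^+ 2 / n%:R.
Proof.
move=> kl; have nr : 0 < n%:R :> R by rewrite ltr0n.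
have dY r i : depends_on (pos idx r predT) (y r i).
  by apply: depends_onS (@dep_yi _ _ _ _ _ _ _ idx_inj _ _ _ r i); exact: posS.
have mY r i : mom mu 1 (y r i) by apply: momS; exact: (mom_yi hmu idx hnu d2 mphi phi8).
have [] := @EE_sqr_bilinear _ _ _ _ _ _ hmu 'I_n predT (fun=> d%:R / n%:R) (y k) (y l) _ _
  (pos_col idx_inj kl) (fun i _ => @dY k i) (fun i _ => @dY l i) (fun i _ => mY k i) (fun i _ => mY l i).
have -> : (fun z => (\sum_i d%:R / n%:R * (y k i z * y l i z)) ^+ 2) =
  (fun z => lin_cov idx nu phi k l z ^+ 2).
  by apply/funext => z; rewrite /lin_cov mulr_sumr.
move=> iL ->; split => //.
rewrite (eq_bigr (fun=> (d%:R / n%:R) ^+ 2 * s ^+ 2)); last first.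
  move=> i _; rewrite (bigD1 i)//= big1 ?addr0.
    by rewrite !(EE_yi2 hmu idx nu mphi) !expr2.
  by move=> j ji; rewrite (EE_yiyj hmu idx_inj hnu d2 mphi aphi phi8 k) 1?eq_sym// mul0r mulr0.
by rewrite sumr_const card_ord -[LHS]mulr_natr; field; exact: lt0r_neq0.
Qed.

(** Bessel's inequality for the kernel against its [d] one-coordinate projections, orthogonal and of
    square norm [s2]. In the limit it gives [alpha <= beta], so that the shift by [beta - alpha]
    preserves psd matrices. *)
Lemma bessel (k : 'I_p) : (d <= n)%N -> a <= b2 nu phi.
Proof.
move=> dn.
have [I sI] : exists I : d.-tuple 'I_n, inc I.
  apply/existsP; rewrite -[X in is_true X]negbK negb_exists; apply/forallP => h.
  have := card_inc n d; rewrite eq_card0; first by move/esym/eqP; rewrite -leqn0 leqNgt bin_gt0 dn.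
  by move=> I; rewrite !inE; apply: negbTE; exact: h.
pose e (j : 'I_d) : R := coord_sign j.
pose A := aI idx phi k I; pose B j := y k (tnth I j).
have phi4 := momS phi8.
have mA : mom mu 2 A by exact: (mom_aI hmu idx_inj hnu mphi k sI phi4).
have mB j : mom mu 2 (B j) by exact: (mom_yi hmu idx hnu d2 mphi phi8).
have iA2 : itg mu (fun z => A z ^+ 2) by apply: mom1_sqr; exact: momS.
have iAB j : itg mu (fun z => A z * B j z) by apply/mom0; apply: momM; exact: momS.
have iBB i j : itg mu (fun z => B i z * B j z) by apply/mom0; apply: momM; exact: momS.
have iS1 : itg mu (fun z => \sum_j (- 2 * e j) * (A z * B j z)) by apply: itg_sum => j _; exact: itgZ.
have iS2 : itg mu (fun z => \sum_i \sum_j (e i * e j) * (B i z * B j z)).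
  by apply: itg_sum => i _; apply: itg_sum => j _; exact: itgZ.
have : 0 <= E (fun z => A z ^+ 2 + \sum_j (- 2 * e j) * (A z * B j z)
    + \sum_i \sum_j (e i * e j) * (B i z * B j z)).
  apply: EE_ge0 => z; rewrite (_ : _ + _ = (A z - \sum_j e j * B j z) ^+ 2) ?sqr_ge0//.
  rewrite sqrrB -[A z * _ *+ 2]mulr_natr; congr (_ + _ + _).
    by rewrite mulr_sumr !mulr_suml -sumrN; apply: eq_bigr => j _; ring.
  rewrite expr2 mulr_suml; apply: eq_bigr => i _; rewrite mulr_sumr.
  by apply: eq_bigr => j _; ring.
rewrite (EED (itgD iA2 iS1) iS2) (EED iA2 iS1).
rewrite (EE_aI hmu idx_inj hnu mphi k sI (exprn_measurable 2)) -/(b2 nu phi).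
rewrite EE_sum; last by move=> j _; exact: itgZ.
rewrite (eq_bigr (fun=> - 2 * s)); last first.
  move=> j _; rewrite (EEZ _ _ (itg_mfun (iAB j))).
  rewrite (EE_aI_yi_mem hmu idx_inj hnu d2 mphi aphi phi8 k j sI) -/(e j).
  have -> : -2 * e j * (e j * s) = -2 * e j ^+ 2 * s by ring.
  by rewrite coord_sign_sqr mulr1.
rewrite EE_sum; last by move=> i _; apply: itg_sum => j _; exact: itgZ.
rewrite [X in _ + X](eq_bigr (fun=> s)); last first.
  move=> i _; rewrite EE_sum; last by move=> j _; exact: itgZ.
  rewrite (bigD1 i)//= big1 ?addr0.
    by rewrite (EEZ _ _ (itg_mfun (iBB i i))) (EE_yi2 hmu idx nu mphi) -expr2 coord_sign_sqr mul1r.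
  move=> j ji; rewrite (EEZ _ _ (itg_mfun (iBB i j))).
  rewrite (EE_yiyj hmu idx_inj hnu d2 mphi aphi phi8 k) ?mulr0//.
  by apply: contra ji => /eqP/(inc_tuple_inj sI) ->.
by rewrite !sumr_const card_ord -[_ *+ d]mulr_natl -[s *+ d]mulr_natl; lra.
Qed.

End gram_stieltjes.

(** * Comparison of the matrices *)

Section deterministic_comparison.
Context {R : rcfType}.

Lemma psd_diag_ge0 p (A : 'M[R]_p) k : psd A -> 0 <= A k k.
Proof.
move=> [_ pA]; have := pA _ (delta_mx k (ord0 : 'I_1)).
rewrite /frob mulmxA trmx_delta -rowE -colE /mxtrace big_ord1 !mxE.
by [].
Qed.

Definition cor_mx p (A : 'M[R]_p) : 'M[R]_p :=
  \matrix_(k, l) (A k l / Num.sqrt (A k k * A l l)).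

(** The correlation matrix is the congruence [D *m A *m D]. With the inverse of 0 equal to 0 this
    holds even when a diagonal entry vanishes, so no exceptional event has to be removed. *)
Lemma psd_cor p (A : 'M[R]_p) : psd A -> psd (cor_mx A).
Proof.
move=> pA; pose D : 'M[R]_p := diag_mx (\row_k (Num.sqrt (A k k))^-1).
have -> : cor_mx A = D *m A *m D.
  apply/matrixP => k l; rewrite mul_mx_diag mul_diag_mx !mxE.
  by rewrite sqrtrM ?psd_diag_ge0// invfM mulrCA mulrA.
have sD : D^T = D by rewrite tr_diag_mx.
split; first by rewrite !trmx_mul sD pA.1 mulmxA.
move=> m V; have := pA.2 _ (D *m V); rewrite /frob trmx_mul sD !mulmxA.
by [].
Qed.

Lemma normalized_trace_resolvent_diff p (A B : 'M[R]_p) (x : R) :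
  (0 < p)%N -> psd A -> psd B -> 0 < x ->
  (\tr (resolvent A x) / p%:R - \tr (resolvent B x) / p%:R) ^+ 2
  <= p%:R^-1 * frob (A - B) (A - B) / x ^+ 4.
Proof.
move=> p0 pA pB x0; have pr : 0 < p%:R :> R by rewrite ltr0n.
rewrite -mulrBl exprMn exprVn ler_pdivlMr ?exprn_gt0// mulrC mulrA ler_pdivrMr ?exprn_gt0//.
apply: le_trans (tr_resolvent_diff pA pB x0) _; rewrite le_eqVlt; apply/orP; left.
by apply/eqP; field; exact: lt0r_neq0.
Qed.

Lemma frob_sub_split p (A B : 'M[R]_p) :
  frob (A - B) (A - B) =
  \sum_k (A k k - B k k) ^+ 2 + \sum_k \sum_(l | l != k) (A k l - B k l) ^+ 2.
Proof.
rewrite frobE -big_split; apply: eq_bigr => k _ /=; rewrite (bigD1 k)//= !mxE expr2.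
by congr (_ + _); apply: eq_bigr => l _; rewrite !mxE expr2.
Qed.

Lemma resolvent_shift p (A : 'M[R]_p) (c x : R) :
  resolvent (c%:M + A) x = resolvent A (x + c).
Proof. by rewrite /resolvent [_%:M + A]addrC -addrA -raddfD/= [c + x]addrC. Qed.

Lemma tr_resolvent_scale p (A : 'M[R]_p) (c x : R) : psd A -> 0 < c -> 0 < x ->
  \tr (resolvent (c *: A) x) = c^-1 * \tr (resolvent A (x / c)).
Proof.
move=> pA c0 x0; rewrite /resolvent; have cn0 := lt0r_neq0 c0.
have -> : c *: A + x%:M = c *: (A + (x / c)%:M).
  by rewrite scalerDr scale_scalar_mx mulrCA divff ?mulr1.
by rewrite invmxZ ?mxtraceZ// unitmxZ ?unitfE// resolvent_unit// divr_gt0.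
Qed.

Variables (p n : nat) (A L : 'M[R]_p) (a b al be : R).
Hypotheses (p0 : (0 < p)%N) (n0 : (0 < n)%N) (pA : psd A) (pL : psd L).
Hypotheses (al0 : 0 <= al) (albe : al <= be).

Definition off_err := p%:R^-1 * \sum_k \sum_(l | l != k) (A k l - L k l) ^+ 2.
Definition off_lin := p%:R^-1 * \sum_k \sum_(l | l != k) L k l ^+ 2.
Definition diag4_err := p%:R^-1 * \sum_k (A k k - b) ^+ 4.
Definition diag_lin_err := p%:R^-1 * \sum_k (L k k - a) ^+ 2.

Let pr : 0 < p%:R :> R. Proof. by rewrite ltr0n. Qed.

Let be_al : 0 <= be - al. Proof. by rewrite subr_ge0. Qed.

(** The comparison matrix [(be - al)%:M + L] has at [x] the resolvent of [L] at [x + (be - al)]. The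
    3 comes from [(t - u + v) ^ 2 <= 3 (t ^ 2 + u ^ 2 + v ^ 2)] on the diagonal. *)
Lemma cov_comparison (x : R) : 0 < x ->
  (\tr (resolvent A x) / p%:R - \tr (resolvent L (x + (be - al))) / p%:R) ^+ 2 <=
  (off_err + 3 * (n%:R^-1 + n%:R * diag4_err) + 3 * diag_lin_err
    + 3 * (b - be + (al - a)) ^+ 2) / x ^+ 4.
Proof.
move=> x0; rewrite -resolvent_shift.
apply: le_trans (normalized_trace_resolvent_diff p0 pA (psdD_scalar pL be_al) x0) _.
rewrite ler_wpM2r ?invr_ge0 ?exprn_ge0 ?(ltW x0)// frob_sub_split mulrDr addrC.
set c := (b - be + _) ^+ 2.
rewrite -!addrA; apply: lerD.
  rewrite ler_wpM2l ?invr_ge0 ?(ltW pr)//; apply: ler_sum => k _; apply: ler_sum => l lk.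
  by rewrite !mxE eq_sym (negbTE lk) mulr0n add0r.
have cE : c = p%:R^-1 * \sum_(k < p) c.
  by rewrite sumr_const card_ord -[c *+ p]mulr_natl mulKf// lt0r_neq0.
have nE : n%:R^-1 = p%:R^-1 * \sum_(k < p) n%:R^-1 :> R.
  by rewrite sumr_const card_ord -[n%:R^-1 *+ p]mulr_natl mulKf// lt0r_neq0.
rewrite [in leRHS]cE {1}nE /diag4_err /diag_lin_err.
have -> : forall u v w t : R, 3 * (p%:R^-1 * u + n%:R * (p%:R^-1 * v)) + (3 * (p%:R^-1 * w) + 3 * (p%:R^-1 * t))
  = p%:R^-1 * (3 * (u + n%:R * v) + 3 * w + 3 * t) by move=> *; ring.
rewrite ler_wpM2l ?invr_ge0 ?(ltW pr)// mulr_sumr -big_split/= !mulr_sumr -!big_split/=.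
apply: ler_sum => k _; rewrite !mxE eqxx mulr1n /c.
set t := A k k - b; set u := L k k - a; set v := b - be + _.
have -> : A k k - (be - al + L k k) = t - u + v by rewrite /t /u /v; ring.
have nr : 0 < n%:R :> R by rewrite ltr0n.
(* This reduces the diagonal to its fourth moment, of order [n ^ -2], so that no separate second
   moment bound is required. *)
have h : t ^+ 2 <= n%:R^-1 + n%:R * t ^+ 4.
  have := sqr_ge0 (1 - n%:R * t ^+ 2); have := sqr_ge0 t.
  set s := t ^+ 2; have -> : t ^+ 4 = s ^+ 2 by rewrite /s -exprM.
  move=> s0 hh; rewrite -(ler_pM2l nr) mulrDr divff ?lt0r_neq0//.
  have := sqr_ge0 (n%:R * s); nra.
have := sqr_ge0 (t + u); have := sqr_ge0 (t - v); have := sqr_ge0 (u + v); nra.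
Qed.

(** Markov's inequality and the union bound in pointwise form: the right side dominates the
    indicator of the event that some diagonal entry is off by [eps]. *)
Lemma diag4_event (eps : R) k : 0 < eps -> eps < `|A k k - b| ->
  1 <= p%:R * diag4_err / eps ^+ 4.
Proof.
move=> e0 ek; rewrite ler_pdivlMr ?exprn_gt0// mul1r /diag4_err mulrA divff ?lt0r_neq0// mul1r.
rewrite (bigD1 k)//= ler_wpDr//.
  by apply: sumr_ge0 => l _; rewrite (exprM _ 2 2) sqr_ge0.
have -> : (A k k - b) ^+ 4 = `|A k k - b| ^+ 4.
  by rewrite (exprM _ 2 2) [in RHS](exprM _ 2 2) real_normK ?num_real.
by rewrite lerXn2r// ?nnegrE// ltW.
Qed.

(** If some diagonal entry is off by more than [eps], both normalised traces still lie in
    [[0, 1 / x]], and [diag4_event] pays for their difference. Otherwise every [A k k] is within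
    [2 eps] of [be], hence at least [be / 2], and the normalisation may be replaced by division by
    [be]; the factor [be] before the trace is the scaling of the resolvent. *)
Lemma cor_comparison (x eps : R) : 0 < x -> 0 < eps -> eps <= be / 4 -> `|b - be| <= eps ->
  (\tr (resolvent (cor_mx A) x) / p%:R
    - be * (\tr (resolvent L (be * x + (be - al))) / p%:R)) ^+ 2 <=
  p%:R * diag4_err / eps ^+ 4 / x ^+ 2 +
  (4 * (4 * eps / be ^+ 2) ^+ 2 * (off_lin + off_err) + 2 / be ^+ 2 * off_err
   + 2 / be ^+ 2 * diag_lin_err + 2 * ((al - a) / be) ^+ 2) / x ^+ 4.
Proof.
move=> x0 e0 ebe bbe.
have be0 : 0 < be by lra.
have pC := psd_cor pA.
have pB := psdD_scalar pL be_al.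
have pB' : psd (be^-1 *: ((be - al)%:M + L)) by apply: psdZ => //; rewrite invr_ge0 ltW.
have -> : be * (\tr (resolvent L (be * x + (be - al))) / p%:R) =
    \tr (resolvent (be^-1 *: ((be - al)%:M + L)) x) / p%:R.
  by rewrite tr_resolvent_scale ?invr_gt0// !invrK resolvent_shift [x * be]mulrC mulrA.
set B' := be^-1 *: _ in pB' *.
have ge0s (F : 'I_p -> 'I_p -> R) : 0 <= p%:R^-1 * \sum_k \sum_(l | l != k) F k l ^+ 2.
  rewrite mulr_ge0 ?invr_ge0 ?(ltW pr)//.
  by apply: sumr_ge0 => k _; apply: sumr_ge0 => l _; exact: sqr_ge0.
have f0 : 0 <= off_err := ge0s _.
have l0 : 0 <= off_lin := ge0s _.
have d0 : 0 <= diag_lin_err.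
  by rewrite mulr_ge0 ?invr_ge0 ?(ltW pr)//; apply: sumr_ge0 => k _; exact: sqr_ge0.
have g0 : 0 <= diag4_err.
  by rewrite mulr_ge0 ?invr_ge0 ?(ltW pr)//; apply: sumr_ge0 => k _; rewrite (exprM _ 2 2) sqr_ge0.
have [/existsP[k ek]|] := boolP [exists k, eps < `|A k k - b|].
  have g1 := diag4_event e0 ek.
  rewrite ler_wpDr//.
    have c0 : 0 <= 2 / be ^+ 2 by rewrite divr_ge0 ?sqr_ge0.
    rewrite divr_ge0 ?exprn_ge0 ?(ltW x0)// !addr_ge0 ?(mulr_ge0 c0)//.
      by rewrite mulr_ge0 ?addr_ge0// mulr_ge0 ?sqr_ge0.
    by rewrite mulr_ge0 ?sqr_ge0.
  apply: (@le_trans _ _ (1 / x ^+ 2)); last by rewrite ler_wpM2r ?invr_ge0 ?sqr_ge0.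
  have bnd (M : 'M[R]_p) : psd M -> 0 <= \tr (resolvent M x) / p%:R /\ x * (\tr (resolvent M x) / p%:R) <= 1.
    move=> pM; rewrite divr_ge0 ?ler0n ?tr_resolvent_ge0//; split => //.
    by rewrite mulrA ler_pdivrMr// mul1r tr_resolvent_le.
  have [u0 u1] := bnd _ pC; have [v0 v1] := bnd _ pB'.
  rewrite ler_pdivlMr ?exprn_gt0// -exprMn -real_normK ?num_real// -[leRHS](expr1n _ 2) lerXn2r ?nnegrE//.
  rewrite mulrBl ler_norml; apply/andP; split; nra.
rewrite negb_exists => /forallP good.
rewrite ler_wpDl ?(divr_ge0 (divr_ge0 (mulr_ge0 (ltW pr) g0) (exprn_ge0 4 (ltW e0))) (sqr_ge0 x))//.
apply: le_trans (normalized_trace_resolvent_diff p0 pC pB' x0) _.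
rewrite ler_wpM2r ?invr_ge0 ?exprn_ge0 ?(ltW x0)// frob_sub_split mulrDr addrC -addrA.
have D k : be / 2 <= A k k /\ `|A k k - be| <= 2 * eps.
  have := good k; rewrite -leNgt => h.
  have : `|A k k - be| <= 2 * eps.
    have -> : A k k - be = (A k k - b) + (b - be) by ring.
    by apply: le_trans (ler_normD _ _) _; lra.
  by move=> h2; split => //; move: h2; rewrite ler_norml => /andP[? ?]; lra.
have D0 k : 0 < A k k by have [h _] := D k; lra.
(* The bound [2 eps / (be / 2 * be)] for [|1 / s - 1 / be|], where [s] is within [2 eps] of [be] and
   at least [be / 2]. *)
set ka := 4 * eps / be ^+ 2.
have -> : 2 / be ^+ 2 * diag_lin_err + 2 * ((al - a) / be) ^+ 2 =
    p%:R^-1 * \sum_k (2 / be ^+ 2 * (L k k - a) ^+ 2 + 2 * ((al - a) / be) ^+ 2).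
  rewrite big_split/= sumr_const card_ord -mulr_sumr -[2 * ((al - a) / be) ^+ 2 *+ p]mulr_natl mulrDr mulrCA.
  by rewrite mulKf// lt0r_neq0.
apply: lerD; last first.
  rewrite ler_wpM2l ?invr_ge0 ?(ltW pr)//; apply: ler_sum => k _; rewrite !mxE eqxx mulr1n.
  rewrite -expr2 sqrtr_sqr gtr0_norm// divff ?lt0r_neq0//.
  have -> : 1 - be^-1 * (be - al + L k k) = (al - a) / be - (L k k - a) / be.
    by field; exact: lt0r_neq0.
  have -> : 2 / be ^+ 2 * (L k k - a) ^+ 2 = 2 * ((L k k - a) / be) ^+ 2.
    by field; exact: lt0r_neq0.
  set u := _ / be; set v := _ / be; have := sqr_ge0 (u + v); nra.
rewrite /off_lin /off_err.
have -> : forall u v c1 c2 : R, c1 * (p%:R^-1 * u + p%:R^-1 * v) + c2 * (p%:R^-1 * v) =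
  p%:R^-1 * (c1 * u + (c1 + c2) * v) by move=> *; ring.
rewrite ler_wpM2l ?invr_ge0 ?(ltW pr)// !mulr_sumr -big_split/=; apply: ler_sum => k _.
rewrite !mulr_sumr -big_split/=; apply: ler_sum => l lk.
rewrite !mxE eq_sym (negbTE lk) mulr0n add0r.
set s := Num.sqrt _; have sE : be - 2 * eps <= s <= be + 2 * eps.
  have [_] := D k; have [_] := D l; rewrite !ler_norml => /andP[l1 l2] /andP[k1 k2].
  have hp : 0 <= be - 2 * eps by lra.
  have hq : 0 <= be + 2 * eps by lra.
  apply/andP; split.
    rewrite -[leLHS]ger0_norm// -sqrtr_sqr ler_wsqrtr// expr2 ler_pM//; lra.
  rewrite -[leRHS]ger0_norm// -sqrtr_sqr ler_wsqrtr// expr2; have := D0 k; have := D0 l.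
  by move=> ? ?; apply: ler_pM; lra.
have s0 : be / 2 <= s by case/andP: sE => ? _; lra.
have s00 : 0 < s by lra.
have kaE : (s^-1 - be^-1) ^+ 2 <= ka ^+ 2.
  have -> : s^-1 - be^-1 = (be - s) / (s * be) by field; rewrite !lt0r_neq0.
  have -> : ka = (2 * eps) / (be / 2 * be) by rewrite /ka; field; exact: lt0r_neq0.
  rewrite !exprMn !exprVn; apply: ler_pM; rewrite ?sqr_ge0 ?invr_ge0 ?sqr_ge0//.
    by rewrite -exprMn; case/andP: sE => ? ?; nra.
  rewrite lef_pV2 ?posrE ?exprn_gt0 ?mulr_gt0 ?divr_gt0//.
  by rewrite lerXn2r ?nnegrE ?mulr_ge0 ?(ltW be0) ?(ltW s00)// ?divr_ge0 ?(ltW be0)// ler_wpM2r// ltW.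
set Akl := A k l; set Lkl := L k l.
(* Error of the normalisation, plus error of the linearisation divided by [be]. *)
have -> : Akl / s - be^-1 * Lkl = Akl * (s^-1 - be^-1) + (Akl - Lkl) / be by ring.
set u := s^-1 - be^-1 in kaE *; set v := Akl - Lkl.
have -> : Akl = Lkl + v by rewrite /v; ring.
have h1 : ((Lkl + v) * u + v / be) ^+ 2 <= 2 * ((Lkl + v) ^+ 2 * u ^+ 2) + 2 * (v / be) ^+ 2.
  by rewrite -exprMn; set r1 := _ * u; set r2 := v / be; have := sqr_ge0 (r1 - r2); nra.
have h2 : (Lkl + v) ^+ 2 * u ^+ 2 <= (2 * Lkl ^+ 2 + 2 * v ^+ 2) * ka ^+ 2.
  apply: ler_pM; rewrite ?sqr_ge0//; have := sqr_ge0 (Lkl - v); nra.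
have h3 : 2 / be ^+ 2 * v ^+ 2 = 2 * (v / be) ^+ 2 by field; exact: lt0r_neq0.
by apply: le_trans h1 _; rewrite [(_ + 2 / _) * _]mulrDl h3; lra.
Qed.

End deterministic_comparison.

(** * Expectations of the comparison errors *)

Section covariance_model.
Context {dS : measure_display} {S : measurableType dS} {R : realType}.
Variables (m : probability S R) (N n p : nat) (mu : probability (N.-tuple S) R).
Hypothesis hmu : iid_map m mu id.
Variable idx : 'I_n -> 'I_p -> 'I_N.
Hypothesis idx_inj : forall i k i' k', idx i k = idx i' k' -> i = i' /\ k = k'.
Variables (d : nat) (nu : probability (d.-tuple S) R).
Hypothesis hnu : iid_map m nu id.
Hypothesis d2 : (2 <= d)%N.
Variable phi : d.-tuple S -> R.
Hypothesis mphi : measurable_fun [set: d.-tuple S] phi.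
Hypothesis aphi : antisymmetric_fun phi.
Hypothesis phi8 : mom nu 3 phi.
Hypotheses (dn : (d <= n)%N) (p0 : (0 < p)%N).
Local Notation T := (N.-tuple S).
Local Notation E := (EE mu).
Local Notation a := (d%:R * s2 m nu phi).
Local Notation b := (b2 nu phi).

Let n0 : (0 < n)%N. Proof. by apply: leq_trans dn; exact: leq_trans d2. Qed.
Let pr : 0 < p%:R :> R. Proof. by rewrite ltr0n. Qed.
Let nr : 0 < n%:R :> R. Proof. by rewrite ltr0n. Qed.

Definition Amx (z : T) : 'M[R]_p := \matrix_(k, l) cov_sum idx phi k l z.
Definition Lmx (z : T) : 'M[R]_p := (Ymx idx nu phi z)^T *m Ymx idx nu phi z.

Lemma psd_Lmx z : psd (Lmx z). Proof. exact: psd_gram. Qed.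

(** A Gram matrix over all [d]-tuples, with weight zero on those that are not increasing. *)
Lemma psd_Amx z : psd (Amx z).
Proof.
pose W : 'M[R]_(p, #|{: d.-tuple 'I_n}|) :=
  \matrix_(k, I) ((inc (enum_val I))%:R * aI idx phi k (enum_val I) z).
have -> : Amx z = 'C(n, d)%:R^-1 *: (W *m W^T).
  apply/matrixP => k l; rewrite !mxE /cov_sum; congr (_ * _).
  rewrite big_mkcond/= (reindex (@enum_val _ {: d.-tuple 'I_n}))/=; last first.
    exact/onW_bij/enum_val_bij.
  apply: eq_bigr => I _; rewrite !mxE.
  by case: (inc _); rewrite ?mul1r// !mul0r.
by apply: psdZ; rewrite ?invr_ge0//; exact: psd_gramT.
Qed.

Lemma mx_measurable_Amx : mx_measurable Amx.
Proof.
move=> k l; under eq_fun do rewrite mxE; apply: measurable_funM => //.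
have mA k' I : measurable_fun setT (aI idx phi k' I).
  apply: (measurableT_comp mphi); apply/measurable_fun_tnthP => j.
  rewrite (_ : _ \o _ = fun z => tnth z (idx (tnth I j) k')); first exact: measurable_tnth.
  by apply/funext => z; rewrite /= tnth_mktuple.
under eq_fun do rewrite big_mkcond.
by apply: measurable_fun_sum => I; case: (inc I) => //; exact: measurable_funM.
Qed.

Lemma mx_measurable_cor (A : T -> 'M[R]_p) : mx_measurable A ->
  mx_measurable (fun z => cor_mx (A z)).
Proof.
move=> mA k l; under eq_fun do rewrite mxE; apply: measurable_funM => //.
apply: measurable_funV; apply: (@measurableT_comp _ _ _ _ _ _ (@Num.sqrt R)).
  by apply: continuous_measurable_fun; exact: sqrt_continuous.
exact: measurable_funM.
Qed.

Let off z := off_err (Amx z) (Lmx z).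
Let offl z := off_lin (Lmx z).
Let dg4 z := diag4_err (Amx z) b.
Let dgl z := diag_lin_err (Lmx z) a.

Lemma EE_average (F : 'I_p -> T -> R) (c : R) :
  (forall k, itg mu (F k) /\ E (F k) <= c) ->
  itg mu (fun z => p%:R^-1 * \sum_k F k z) /\ E (fun z => p%:R^-1 * \sum_k F k z) <= c.
Proof.
move=> hF; have iS : itg mu (fun z => \sum_k F k z) by apply: itg_sum => k _; exact: (hF k).1.
split; first exact: itgZ.
rewrite (EEZ _ _ (itg_mfun iS)) EE_sum; last by move=> k _; exact: (hF k).1.
rewrite ler_pdivrMl// (le_trans (ler_sum _ (fun k _ => (hF k).2)))//.
by rewrite sumr_const card_ord mulr_natl.
Qed.

Lemma EE_off_sum (F : 'I_p -> 'I_p -> T -> R) (c : R) : 0 <= c ->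
  (forall k l, k != l -> itg mu (F k l) /\ E (F k l) <= c) ->
  itg mu (fun z => p%:R^-1 * \sum_k \sum_(l | l != k) F k l z) /\
  E (fun z => p%:R^-1 * \sum_k \sum_(l | l != k) F k l z) <= p%:R * c.
Proof.
move=> c0 hF; apply: EE_average => k.
have hk l : l != k -> itg mu (F k l) /\ E (F k l) <= c by rewrite eq_sym; exact: hF.
split; first by apply: itg_sum => l /hk[].
rewrite EE_sum; last by move=> l /hk[].
apply: (@le_trans _ _ (\sum_(l < p | l != k) c)); first by apply: ler_sum => l /hk[].
apply: (@le_trans _ _ (\sum_(l < p) c)); last by rewrite sumr_const card_ord mulr_natl.
by rewrite [leRHS](bigD1 k)//= lerDr.
Qed.

Lemma EE_off_err : itg mu off /\
  E off <= p%:R * (b ^+ 2 * ((d%:R * (d%:R - 1)) ^+ 2 / (n%:R * (n%:R - 1)))).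
Proof.
rewrite /off /off_err; under eq_fun do under eq_bigr do under eq_bigr do rewrite Ymx_gram mxE.
apply: EE_off_sum => [|k l kl].
  by rewrite mulr_ge0 ?sqr_ge0// divr_ge0 ?sqr_ge0// mulr_ge0 ?ler0n// subr_ge0 ler1n.
exact: (EE_cov_lin hmu idx_inj hnu d2 mphi aphi phi8 kl dn).
Qed.

Lemma EE_off_lin : itg mu offl /\ E offl <= p%:R * (a ^+ 2 / n%:R).
Proof.
rewrite /offl /off_lin; under eq_fun do under eq_bigr do under eq_bigr do rewrite Ymx_gram.
apply: EE_off_sum => [|k l kl]; first by rewrite divr_ge0 ?sqr_ge0.
by have [i1 ->] := EE_lin_off hmu idx_inj hnu d2 mphi aphi phi8 n0 kl; split.
Qed.

Lemma EE_diag4_err : itg mu dg4 /\ E dg4 <= 9 * h4 nu phi * d%:R ^+ 4 / n%:R ^+ 2.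
Proof.
rewrite /dg4 /diag4_err; under eq_fun do under eq_bigr do rewrite mxE.
apply: EE_average => k.
by have [[_ i4] h] := EE_cov_diag4 hmu idx_inj hnu d2 mphi phi8 k dn; split.
Qed.

Lemma EE_diag_lin_err : itg mu dgl /\ E dgl <= 4 * d%:R ^+ 2 * gg4 m nu phi / n%:R.
Proof.
rewrite /dgl /diag_lin_err; under eq_fun do under eq_bigr do rewrite Ymx_gram.
apply: EE_average => k.
by have [[_ i4] h] := EE_lin_diag hmu idx_inj hnu d2 mphi aphi phi8 n0 k; split.
Qed.

End covariance_model.

(** * Stieltjes transforms and weak convergence *)

Section weierstrass.
Context {R : realType}.

(* A recursion instead of binomials: the mean and the variance of the binomial
   distribution then follow by induction on [N]. *)
Fixpoint bernstein (N : nat) (f : nat -> R) : {poly R} :=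
  if N is N'.+1 then
    (1 - 'X) * bernstein N' f + 'X * bernstein N' (fun k => f k.+1)
  else (f 0%N)%:P.

Lemma bernsteinS N f y : (bernstein N.+1 f).[y] =
  (1 - y) * (bernstein N f).[y] + y * (bernstein N (fun k => f k.+1)).[y].
Proof. by rewrite /= !hornerE. Qed.

Lemma bernstein_lin N f g (a c y : R) :
  (bernstein N (fun k => a * f k + c * g k)).[y] =
  a * (bernstein N f).[y] + c * (bernstein N g).[y].
Proof.
elim: N f g => [|N ih] f g; first by rewrite /= !hornerC.
by rewrite !bernsteinS !ih; ring.
Qed.

Lemma bernstein_le N f g y : 0 <= y <= 1 -> (forall k, (k <= N)%N -> f k <= g k) ->
  (bernstein N f).[y] <= (bernstein N g).[y].
Proof.
move=> /andP[y0 y1]; elim: N f g => [|N ih] f g fg; first by rewrite /= !hornerC fg.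
rewrite !bernsteinS lerD// ler_wpM2l ?subr_ge0// ih// => k kN; apply: fg => //.
exact: leqW.
Qed.

Lemma bernstein_cst N (c y : R) : (bernstein N (fun=> c)).[y] = c.
Proof. by elim: N => [|N ih]; rewrite ?bernsteinS ?ih /= ?hornerC//; ring. Qed.

(** The second moment of a shifted binomial variable. The free [c] absorbs the shift of [k] in the
    recursion, which makes the induction close; [c = - N y] gives the variance. *)
Lemma bernstein_sqr N (c y : R) : (bernstein N (fun k => (k%:R + c) ^+ 2)).[y] =
  (N%:R * y + c) ^+ 2 + N%:R * (y * (1 - y)).
Proof.
elim: N c => [|N ih] c; first by rewrite /= hornerC !mul0r addr0.
rewrite bernsteinS ih (_ : (fun k => (k.+1%:R + c) ^+ 2) = (fun k => (k%:R + (1 + c)) ^+ 2)).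
  by rewrite ih -natr1; ring.
by apply/funext => k; rewrite -natr1 addrA.
Qed.

Lemma unif_continuous_01 (h : R -> R) (e : R) : continuous h -> 0 < e ->
  exists2 de : R, 0 < de & forall x y, 0 <= x <= 1 -> `|y - x| < de -> `|h y - h x| <= e.
Proof.
move=> ch e0.
have H := iffLR (compact_near_coveringP `[0 : R, 1]) (@segment_compact R 0 1).
have {}H : \forall de \near 0^'+, `[0 : R, 1] `<=` [set x : R |
    forall y, `|y - x| < de -> `|h y - h x| <= e].
  apply: H => x _; have e2 : 0 < e / 2 by rewrite divr_gt0.
  have /cvgrPdist_lt/(_ _ e2) := ch x; rewrite -nbhs_nearE => /nbhs_ballP[r /= r0 br].
  have r2 : 0 < r / 2 by rewrite divr_gt0.
  exists (ball x (r / 2), [set de | de < r / 2]) => /=.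
    by split; [exact: nbhsx_ballx|exact: nbhs_right_lt].
  move=> [x' de]/= [xx' der] y yx'.
  have bx' : ball x r x' by apply: le_ball xx'; lra.
  have bxy : ball x r y.
    move: xx'; rewrite /ball/= => xx'.
    have -> : x - y = (x - x') - (y - x') by ring.
    by apply: le_lt_trans (ler_normB _ _) _; lra.
  have := br _ bx'; have := br _ bxy => /= h1 h2.
  have -> : h y - h x' = (h x - h x') - (h x - h y) by ring.
  by apply: le_trans (ler_normB _ _) _; lra.
have [de [de0 hde]] := filter_ex (filterI (nbhs_right_gt 0) H).
by exists de => // x y x01; apply: hde; rewrite /= in_itv.
Qed.

Lemma weierstrass (h : R -> R) (e : R) : continuous h -> 0 < e ->
  exists q : {poly R}, forall y, 0 <= y <= 1 -> `|h y - q.[y]| <= e.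
Proof.
move=> ch e0; have [de de0 hde] := unif_continuous_01 ch (divr_gt0 e0 (ltr0n R 2)).
have [M M0 hM] : exists2 M : R, 0 < M & forall y, 0 <= y <= 1 -> `|h y| <= M.
  have cn : {within `[0 : R, 1], continuous (fun y => `|h y|)}.
    by apply: continuous_subspaceT => y; apply: cvg_norm; exact: ch.
  have [c _ hc] := EVT_max ler01 cn.
  exists (1 + `|h c|); first by rewrite ltr_pwDl.
  move=> y y01; apply: le_trans (hc y _) _; first by rewrite in_itv.
  by rewrite lerDr.
have [N0 hN0] : exists N, 4 * M / (de ^+ 2 * e) < N%:R.
  by exists (Num.bound (4 * M / (de ^+ 2 * e))); rewrite archi_boundP// divr_ge0 ?mulr_ge0 ?sqr_ge0 ?ltW.
pose N := N0.+1; have N0r : 0 < N%:R :> R by rewrite ltr0n.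
have hN : 4 * M / (de ^+ 2 * e) < N%:R by apply: lt_trans hN0 _; rewrite ltr_nat.
exists (bernstein N (fun k => h (k%:R / N%:R))) => y y01; case/andP: (y01) => y0 y1.
pose K := 2 * M / de ^+ 2 / N%:R ^+ 2.
have K0 : 0 <= K by apply: divr_ge0 (sqr_ge0 _); apply: divr_ge0 (sqr_ge0 _); rewrite mulr_ge0// ltW.
(* Chebyshev's argument in pointwise form: nodes within [de] of [y] cost [e / 2], and for the others
   the quadratic term is at least [2 * M]. Its Bernstein average is a multiple of the binomial
   variance. *)
pose B k : R := K * (k%:R + - (N%:R * y)) ^+ 2 + e / 2 * 1.
have near_h k : (k <= N)%N -> `|h (k%:R / N%:R) - h y| <= B k.
  move=> kN; have [near_y|far_y] := ltP `|k%:R / N%:R - y| de.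
    apply: le_trans (hde _ _ y01 near_y) _.
    by rewrite /B mulr1 lerDr mulr_ge0// sqr_ge0.
  have k01 : 0 <= (k%:R / N%:R : R) <= 1.
    by rewrite divr_ge0 ?ler0n//= ler_pdivrMr// mul1r ler_nat.
  apply: (@le_trans _ _ (2 * M)).
    apply: le_trans (ler_normB _ _) _; have := hM _ k01; have := hM _ y01; lra.
  have -> : B k = 2 * M * ((k%:R / N%:R - y) / de) ^+ 2 + e / 2.
    by rewrite /B /K; field; rewrite !lt0r_neq0.
  apply: ler_wpDr; first by rewrite divr_ge0 ?ltW.
  rewrite ler_peMr ?mulr_ge0 ?(ltW M0)// -real_normK ?num_real// exprn_ege1//.
  by rewrite normrM normfV (gtr0_norm de0) ler_pdivlMr// mul1r.
have BE : (bernstein N B).[y] <= e.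
  rewrite /B bernstein_lin bernstein_sqr bernstein_cst subrr expr0n/= add0r mulr1.
  have h1 : y * (1 - y) <= 4^-1 by have := sqr_ge0 (y - 2^-1); lra.
  have h2 : K * (N%:R * (y * (1 - y))) <= K * (N%:R * 4^-1).
    by rewrite ler_wpM2l// ler_wpM2l// ltW.
  have h3 : K * (N%:R * 4^-1) <= e / 2; last by lra.
  have -> : K * (N%:R * 4^-1) = (M / (2 * de ^+ 2)) / N%:R.
    by rewrite /K; field; rewrite !lt0r_neq0.
  rewrite ler_pdivrMr//.
  have -> : M / (2 * de ^+ 2) = (4 * M / (de ^+ 2 * e)) * (e / 8).
    by field; rewrite !lt0r_neq0.
  by move: hN; set x := _ / (_ * e) => hN; nra.
rewrite ler_norml; apply/andP; split.
  have : (bernstein N (fun k => h (k%:R / N%:R))).[y] <= (bernstein N (fun k => 1 * h y + 1 * B k)).[y].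
    apply: bernstein_le => // k /near_h; rewrite ler_norml !mul1r => /andP[_]; lra.
  by rewrite bernstein_lin bernstein_cst; lra.
have : (bernstein N (fun k => 1 * h y + - 1 * B k)).[y] <= (bernstein N (fun k => h (k%:R / N%:R))).[y].
  apply: bernstein_le => // k /near_h; rewrite ler_norml mulN1r mul1r => /andP[]; lra.
by rewrite bernstein_lin bernstein_cst; lra.
Qed.

End weierstrass.

Section to_zero.
Context {R : realType}.
Implicit Types u v : nat -> R.

Definition to0 u := forall e, 0 < e -> \forall n \near \oo, u n <= e.

Lemma to0_le u v : (\forall n \near \oo, u n <= v n) -> to0 v -> to0 u.
Proof.
by move=> uv v0 e /v0 h; apply: filterS2 uv h => n; exact: le_trans.
Qed.

Lemma to0D u v : to0 u -> to0 v -> to0 (fun n => u n + v n).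
Proof.
move=> u0 v0 e e0; have e2 : 0 < e / 2 by rewrite divr_gt0.
by apply: filterS2 (u0 _ e2) (v0 _ e2) => n; lra.
Qed.

Lemma to0Z c u : 0 <= c -> to0 u -> to0 (fun n => c * u n).
Proof.
move=> c0 u0 e e0; have c1 : 0 < c + 1 by lra.
apply: filterS (u0 _ (divr_gt0 e0 c1)) => n; rewrite ler_pdivlMr// => h.
have [?|/ltW ?] := leP (u n) 0; nra.
Qed.

Lemma to0_cst : to0 (fun=> 0).
Proof. by move=> e /ltW e0; exact: nearW. Qed.

End to_zero.

Lemma cvge0_near {R : realType} (u : nat -> \bar R) : (forall n, (0 <= u n)%E) ->
  (forall e, 0 < e -> \forall n \near \oo, (u n <= e%:E)%E) -> u n @[n --> \oo] --> 0%E.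
Proof.
move=> u0 ue; apply/fine_cvgP; split.
  apply: filterS (ue 1 ltr01) => n h; rewrite ge0_fin_numE//.
  exact: le_lt_trans h (ltry _).
apply/cvgr0Pnorm_le => e e0; apply: filterS (ue e e0) => n h.
rewrite ger0_norm ?fine_ge0// -lee_fin fineK// ge0_fin_numE//.
exact: le_lt_trans h (ltry _).
Qed.

(** * Test functions averaged over random spectra *)

Section spectral_average.
Context {R : realType} {dT : nat -> measure_display} {T : forall n, measurableType (dT n)}.
Variables (P : forall n, probability (T n) R) (p : nat -> nat) (p0 : forall n, (0 < p n)%N).
Variable Lam : forall n, T n -> seq R.
Hypothesis size_Lam : forall n z, size (@Lam n z) = p n.
Hypothesis Lam_ge0 : forall n z l, l \in @Lam n z -> 0 <= l.
Variable nu : probability (measurableTypeR R) R.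
Variable top : R.
Hypotheses (top0 : 0 <= top) (nu_top : nu (~` `[0, top]) = 0%E).

Implicit Types f g : R -> R.

Definition avg (f : R -> R) n (z : T n) : R := (p n)%:R^-1 * \sum_(l <- Lam z) f l.
Definition avg_err f n := EE (P n) (fun z => (avg f z - EE nu f) ^+ 2).

(* Absolute values make the test functions bounded on the whole line; only
   their values on [0, +oo[ matter. *)
Definition stieltjes_fun (x t : R) := (`|t| + x)^-1.

(** In the application [Lam] is an unspecified choice of eigenvalues, so measurability of its
    averages cannot be read off. It is part of the class and propagates, together with mean square
    convergence, through linear combinations and uniform limits. *)
Definition test_fun f := [/\ measurable_fun [set: R] f,
  exists C, forall t, `|f t| <= C, forall n, measurable_fun [set: T n] (@avg f n)
  & to0 (avg_err f)].

Hypothesis test_stieltjes : forall x, 0 < x -> test_fun (stieltjes_fun x).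

Lemma avg_bounded f C n z : (forall t, `|f t| <= C) -> `|@avg f n z| <= C.
Proof.
move=> fC; have pr : 0 < (p n)%:R :> R by rewrite ltr0n.
rewrite normrM gtr0_norm ?invr_gt0// ler_pdivrMl// -[p n](size_Lam z).
apply: le_trans (ler_norm_sum _ _ _) _; apply: le_trans (ler_sum _ (fun t _ => fC t)) _.
by rewrite big_const_seq count_predT iter_addr_0 mulr_natl.
Qed.

Lemma avg_linE f g a c n :
  @avg (fun t => a * f t + c * g t) n = (fun z => a * avg f z + c * avg g z).
Proof. by apply/funext => z; rewrite /avg big_split/= -!mulr_sumr; ring. Qed.

Lemma avg_cstE c n : @avg (fun=> c) n = (fun=> c).
Proof.
apply/funext => z; have pr : 0 < (p n)%:R :> R by rewrite ltr0n.
by rewrite /avg big_const_seq count_predT iter_addr_0 size_Lam -[c *+ _]mulr_natl mulKf// lt0r_neq0.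
Qed.

Lemma itg_test f C : measurable_fun [set: R] f -> (forall t, `|f t| <= C) -> itg nu f.
Proof. by move=> mf fC; exact: (@itg_bounded _ (measurableTypeR R) R nu f C mf fC). Qed.

Lemma EE_bounded f C : measurable_fun [set: R] f -> (forall t, `|f t| <= C) -> `|EE nu f| <= C.
Proof.
move=> mf fC; have i := itg_test mf fC.
have h t : - C <= f t <= C by rewrite -ler_norml.
have h1 : EE nu (fun=> - C) <= EE nu f.
  by apply: EE_le => [||t]; [exact: itg_cst| |case/andP: (h t)].
have h2 : EE nu f <= EE nu (fun=> C).
  by apply: EE_le => [||t]; [|exact: itg_cst|case/andP: (h t)].
by rewrite !EE_cst in h1 h2; rewrite ler_norml h1 h2.
Qed.

Lemma itg_avg_err f C n : (forall t, `|f t| <= C) -> measurable_fun [set: T n] (@avg f n) ->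
  itg (P n) (fun z => (avg f z - EE nu f) ^+ 2).
Proof.
move=> fC mf; apply: mom1_sqr; apply: momB; last exact: mom_cst.
by apply: (@mom_bounded _ _ _ _ _ _ C) => // z; exact: avg_bounded fC.
Qed.

Lemma test_cst c : test_fun (fun=> c).
Proof.
split => //; first by exists `|c|.
  by move=> n; rewrite avg_cstE.
apply: to0_le to0_cst; apply: nearW => n; rewrite /avg_err EE_cst avg_cstE.
by under eq_fun do rewrite subrr expr0n/=; rewrite EE_cst.
Qed.

Lemma avg_err_lin f g a c n :
  (exists C, forall t, `|f t| <= C) -> (exists C, forall t, `|g t| <= C) ->
  measurable_fun [set: R] f -> measurable_fun [set: R] g ->
  measurable_fun [set: T n] (@avg f n) -> measurable_fun [set: T n] (@avg g n) ->
  avg_err (fun t => a * f t + c * g t) n <= 2 * a ^+ 2 * avg_err f n + 2 * c ^+ 2 * avg_err g n.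
Proof.
move=> [C fC] [D gD] mf mg maf mag.
have i1 := itg_avg_err fC maf; have i2 := itg_avg_err gD mag.
have iF := itg_test mf fC; have iG := itg_test mg gD.
rewrite /avg_err -(EEZ _ _ (itg_mfun i1)) -(EEZ _ _ (itg_mfun i2)) -EED; [|exact: itgZ..].
apply: EE_le; last first.
- move=> z; rewrite avg_linE (EED (itgZ a iF) (itgZ c iG)) !EEZ//.
  set u := avg f z; set v := avg g z; set u' := EE nu f; set v' := EE nu g.
  have := sqr_ge0 (a * (u - u') - c * (v - v')); nra.
- by apply: itgD; exact: itgZ.
- apply: (@itg_avg_err _ (`|a| * C + `|c| * D)).
    move=> t; apply: le_trans (ler_normD _ _) _; rewrite !normrM.
    by apply: lerD; apply: ler_wpM2l.
  by rewrite avg_linE; apply: measurable_funD; exact: measurable_funM.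
Qed.

Lemma test_lin a c f g : test_fun f -> test_fun g -> test_fun (fun t => a * f t + c * g t).
Proof.
move=> [mf bf maf f0] [mg bg mag g0]; split.
- by apply: measurable_funD; exact: measurable_funM.
- have [[C fC] [D gD]] := (bf, bg); exists (`|a| * C + `|c| * D) => t.
  apply: le_trans (ler_normD _ _) _; rewrite !normrM.
  by apply: lerD; apply: ler_wpM2l.
- move=> n; rewrite avg_linE.
  by apply: measurable_funD; exact: measurable_funM.
- apply: (to0_le (v := fun n => 2 * a ^+ 2 * avg_err f n + 2 * c ^+ 2 * avg_err g n)).
    by apply: nearW => n; exact: avg_err_lin.
  by apply: to0D; apply: to0Z => //; rewrite mulr_ge0 ?sqr_ge0.
Qed.

Lemma test_unif f : measurable_fun [set: R] f ->
  (forall e, 0 < e -> exists2 g, test_fun g & forall t, `|f t - g t| <= e) -> test_fun f.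
Proof.
move=> mf fg.
have bf : exists C, forall t, `|f t| <= C.
  have [g [_ [C gC] _ _] h] := fg 1 ltr01; exists (1 + C) => t.
  by rewrite -(subrK (g t) (f t)); apply: le_trans (ler_normD _ _) _; exact: lerD.
have maf n : measurable_fun [set: T n] (@avg f n).
  have hk k : exists g, test_fun g /\ forall t, `|f t - g t| <= k.+1%:R^-1.
    by have [g ? ?] := fg _ (ltac:(by rewrite invr_gt0 ltr0n) : 0 < k.+1%:R^-1); exists g.
  have [G hG] := choice hk.
  apply: (@measurable_fun_cvg _ _ _ _ (fun k => @avg (G k) n)).
    by move=> k; have [[_ _ h _] _] := hG k; exact: h.
  move=> z _; apply/cvgrPdist_le => e e0; near=> k.
  have [_ hGk] := hG k.
  have -> : avg f z - avg (G k) z = avg (fun t => f t - G k t) z.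
    by rewrite /avg sumrB mulrBr.
  apply: le_trans (avg_bounded z hGk) _; near: k.
by apply: filterS (near_infty_natSinv_lt (PosNum e0)) => k /ltW.
split => // e e0.
(* With [r = sqrt(e / 16)] the two approximation errors contribute [2 (2 r) ^ 2 = e / 2]; the error
   of [g] contributes [2 (e / 4)]. *)
have e1 : 0 < Num.sqrt (e / 16) by rewrite sqrtr_gt0 divr_gt0.
have [g tg hg] := fg _ e1; have [mg bg mag g0] := tg.
have e2 : 0 < e / 4 by rewrite divr_gt0.
apply: filterS (g0 _ e2) => n hn.
have [[C fC] [D gD]] := (bf, bg).
have iE := itg_avg_err gD (mag n).
have iS : itg (P n) (fun z => 2 * (avg g z - EE nu g) ^+ 2 + 2 * e / 4).
  by apply: itgD; [exact: itgZ|exact: itg_cst].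
apply: le_trans (EE_le (itg_avg_err fC (maf n)) iS _) _; last first.
  by rewrite (EED (itgZ 2 iE) (itg_cst _ _)) (EEZ _ _ (itg_mfun iE)) EE_cst -/(avg_err g n); lra.
move=> z; have mfg : measurable_fun [set: R] (fun t => f t - g t) by exact: measurable_funB.
have h1 := avg_bounded z hg; have h2 := EE_bounded mfg hg.
have i1 := itg_test mf fC; have i2 := itg_test mg gD.
have E1 : EE nu (fun t => f t - g t) = EE nu f - EE nu g by exact: EEB.
have E2 : avg (fun t => f t - g t) z = avg f z - avg g z by rewrite /avg sumrB mulrBr.
rewrite E1 in h2; rewrite E2 in h1; move: h1 h2.
have := sqr_sqrtr (ltW (divr_gt0 e0 (ltr0n R 16))); move: (Num.sqrt _) e1 => r r0 rE.
set u := avg f z; set v := avg g z; set u' := EE nu f; set v' := EE nu g.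
rewrite !ler_norml => /andP[h1 h2] /andP[h3 h4].
have hB : ((u - v) - (u' - v')) ^+ 2 <= (2 * r) ^+ 2.
  have : `|(u - v) - (u' - v')| <= 2 * r by rewrite ler_norml; apply/andP; split; lra.
  by move=> h; rewrite -real_normK ?num_real// lerXn2r ?nnegrE// mulr_ge0// ltW.
have := sqr_ge0 ((v - v') - ((u - v) - (u' - v'))); nra.
Unshelve. all: by end_near. Qed.

(** Mean value bounds tailored to [u = 1 / (t + x)] and [v = 1 / (t + x + h)], for which
    [u - v = h u v]; no derivative is taken. *)
Lemma pow_sub_bounds (u v h : R) k : 0 <= v -> v <= u -> 0 <= h -> u - v = h * (u * v) ->
  k%:R * h * v ^+ k.+1 <= u ^+ k - v ^+ k <= k%:R * h * u ^+ k.+1.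
Proof.
move=> v0 vu h0 uv; have u0 := le_trans v0 vu.
elim: k => [|k /andP[ih1 ih2]]; first by rewrite !expr0 subrr !mul0r lexx.
have vk : v ^+ k <= u ^+ k by apply: lerXn2r; rewrite ?nnegrE.
have vk0 : 0 <= v ^+ k := exprn_ge0 k v0.
have -> : u ^+ k.+1 - v ^+ k.+1 = u * (u ^+ k - v ^+ k) + v ^+ k * (h * (u * v)).
  by rewrite -uv !exprS; ring.
have e1 w : k.+1%:R * h * w ^+ k.+2 = w * (k%:R * h * w ^+ k.+1) + w ^+ k * (h * (w * w)).
  by rewrite !exprS -natr1; ring.
have kh : 0 <= k%:R * h by rewrite mulr_ge0.
rewrite !e1; apply/andP; split; apply: lerD.
- by apply: ler_pM => //; rewrite mulr_ge0// exprn_ge0.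
- by apply: ler_wpM2l => //; apply: ler_wpM2l => //; apply: ler_wpM2r.
- exact: ler_wpM2l.
- apply: ler_pM => //; first by rewrite !mulr_ge0.
  by apply: ler_wpM2l => //; apply: ler_wpM2l.
Qed.

Lemma stieltjes_fun_bounds x t : 0 < x -> 0 < stieltjes_fun x t <= x^-1.
Proof.
move=> x0; have tx : 0 < `|t| + x by rewrite ltr_wpDl.
by rewrite /stieltjes_fun invr_gt0 tx lef_pV2 ?posrE// lerDr normr_ge0.
Qed.

(* The difference quotient in [x] of a [k]-th power converges uniformly to the
   [k.+1]-th power. *)
Lemma test_stieltjes_pow k x : 0 < x -> test_fun (fun t => stieltjes_fun x t ^+ k).
Proof.
have mpow j y : 0 < y -> measurable_fun [set: R] (fun t => stieltjes_fun y t ^+ j).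
  by move=> y0; apply: measurable_funX; have [] := test_stieltjes y0.
elim: k x => [|k ih] x x0; first exact: test_cst.
case: k ih => [|k] ih; first by under eq_fun do rewrite expr1; exact: test_stieltjes.
apply: test_unif => [|e e0]; first exact: mpow.
(* [K] bounds the slope in [x] of the [k.+2]-th power, uniformly in [t]. A step [h = e / K] changes
   that power by at most [e], and the difference quotient is trapped between its two values. *)
pose K := k.+2%:R * (x^-1) ^+ k.+3.
have K0 : 0 < K by rewrite mulr_gt0// exprn_gt0// invr_gt0.
pose h := e / K; have h0 : 0 < h by rewrite divr_gt0.
have xh : 0 < x + h by rewrite addr_gt0.
pose c := (k.+1%:R * h)^-1; have c0 : 0 < k.+1%:R * h by rewrite mulr_gt0.
exists (fun t => c * stieltjes_fun x t ^+ k.+1 + (- c) * stieltjes_fun (x + h) t ^+ k.+1).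
  by apply: test_lin; exact: ih.
move=> t; have /andP[u0 u1] := stieltjes_fun_bounds t x0.
have /andP[v0 _] := stieltjes_fun_bounds t xh.
set u := stieltjes_fun x t in u0 u1 *; set v := stieltjes_fun (x + h) t in v0 *.
have tx : 0 < `|t| + x by rewrite ltr_wpDl.
have txh : 0 < `|t| + (x + h) by rewrite ltr_wpDl.
have uv : u - v = h * (u * v).
  by rewrite /u /v /stieltjes_fun; field; rewrite !lt0r_neq0// -addrA.
have vu : v <= u by have := mulr_ge0 (ltW h0) (mulr_ge0 (ltW u0) (ltW v0)); lra.
have /andP[l1 l2] := pow_sub_bounds k.+1 (ltW v0) vu (ltW h0) uv.
have /andP[_ l3] := pow_sub_bounds k.+2 (ltW v0) vu (ltW h0) uv.
have l4 : k.+2%:R * h * u ^+ k.+3 <= e.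
  have -> : e = k.+2%:R * h * (x^-1) ^+ k.+3 by rewrite -{1}(divfK (lt0r_neq0 K0) e) -/h /K mulrCA mulrA.
  apply: ler_wpM2l; first by rewrite mulr_ge0// ltW.
  by rewrite lerXn2r// nnegrE ?invr_ge0 ltW.
have -> : u ^+ k.+2 - (c * u ^+ k.+1 + - c * v ^+ k.+1) =
   (u ^+ k.+2 - c * (u ^+ k.+1 - v ^+ k.+1)) by ring.
have l5 : c * (u ^+ k.+1 - v ^+ k.+1) <= u ^+ k.+2 by rewrite mulrC ler_pdivrMr// mulrC.
have l6 : v ^+ k.+2 <= c * (u ^+ k.+1 - v ^+ k.+1) by rewrite mulrC ler_pdivlMr// mulrC.
by rewrite ler_norml; apply/andP; split; lra.
Qed.

Lemma test_poly (q : {poly R}) : test_fun (fun t => q.[stieltjes_fun 1 t]).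
Proof.
rewrite (_ : (fun t => _) = (fun t => \sum_(i <- index_enum 'I_(size q)) q`_i * stieltjes_fun 1 t ^+ i)); last first.
  by apply/funext => t; rewrite horner_coef.
elim: (index_enum _) => [|i r ih].
  by under eq_fun do rewrite big_nil; exact: test_cst.
under eq_fun do rewrite big_cons -[X in _ + X]mul1r.
exact: test_lin (test_stieltjes_pow i ltr01) ih.
Qed.

(** In the variable [s = 1 / (1 + t)] the clamped function is [f (1 / max(s, 1 / (M + 1)) - 1)],
    continuous at [s = 0] too, so polynomials in [s] approximate it uniformly. *)
Lemma test_clamp (f : R -> R) (M : R) : continuous f -> 0 < M ->
  test_fun (fun t => f (Num.min `|t| M)).
Proof.
move=> cf M0; have M1 : 0 < (M + 1)^-1 by rewrite invr_gt0 addr_gt0.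
pose h y := f ((Num.max y (M + 1)^-1)^-1 - 1).
have hE t : f (Num.min `|t| M) = h (stieltjes_fun 1 t).
  rewrite /h /stieltjes_fun; congr f; have t0 := normr_ge0 t.
  have [tM|Mt] := leP `|t| M.
    by rewrite max_l ?invrK ?addrK// lef_pV2 ?posrE ?lerD2r//; lra.
  by rewrite max_r ?invrK ?addrK// lef_pV2 ?posrE ?lerD2r ?(ltW Mt)//; lra.
have ch : continuous h.
  move=> y; apply: (@continuous_comp _ _ _ (fun y => (Num.max y (M + 1)^-1)^-1 - 1) f); last exact: cf.
  apply: (@cvgD _ _ _ _ _ (fun y => (Num.max y (M + 1)^-1)^-1) (fun=> -1)); last exact: cvg_cst.
  apply: cvgV; first by rewrite lt0r_neq0// lt_max M1 orbT.
  by apply: (@continuous_max _ _ id (fun=> (M + 1)^-1)); [exact: cvg_id|exact: cvg_cst].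
have me : measurable_fun [set: R] (fun t => f (Num.min `|t| M)).
  apply: continuous_measurable_fun => y.
  apply: (@continuous_comp _ _ _ (fun t => Num.min `|t| M) f); last exact: cf.
  by apply: (@continuous_min _ _ (fun t : R => `|t|) (fun=> M)); [exact: norm_continuous|exact: cvg_cst].
apply: test_unif => // e e0; have [q hq] := weierstrass ch e0.
exists (fun t => q.[stieltjes_fun 1 t]); first exact: test_poly.
move=> t; rewrite hE; apply: hq.
by have /andP[/ltW -> ] := stieltjes_fun_bounds t (@ltr01 R); rewrite invr1.
Qed.

Lemma EE_nu_eq f g : measurable_fun [set: R] f -> measurable_fun [set: R] g ->
  (forall t, 0 <= t <= top -> f t = g t) -> EE nu f = EE nu g.
Proof.
move=> mf mg fg; rewrite /EE /Rintegral; congr fine; apply: ae_eq_integral => //.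
- exact/measurable_EFinP.
- exact/measurable_EFinP.
exists (~` `[0, top]); split => //; first exact: measurableC.
move=> t /= nt; rewrite /= in_itv/= => t0; apply: nt => _; rewrite fg//.
Qed.

Lemma avg_clamp f M n (z : T n) : (forall l, l \in Lam z -> l <= M) ->
  avg (fun t => f (Num.min `|t| M)) z = avg f z.
Proof.
move=> lM; congr (_ * _); apply: eq_big_seq => l lz.
by rewrite ger0_norm ?(Lam_ge0 lz)// min_l// lM.
Qed.

(** Tightness is derived, not assumed: on nonnegative reals [g1] vanishes up to [top] and equals 1
    beyond [top + 1]. It is a clamped test function of mean 0 under [nu], and it dominates the error
    made by clamping [f]. *)
Lemma test_continuous f : continuous f -> bounded_fun f -> test_fun f.
Proof.
move=> cf bf.
have [C C0 fC] : exists2 C, 0 < C & forall t, `|f t| <= C.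
  case: bf => B [_ hB]; exists (`|B| + 1) => [|t]; first by rewrite ltr_wpDl.
  by apply: hB => //; apply: le_lt_trans (ler_norm B) _; rewrite ltrDl.
have mf : measurable_fun [set: R] f by exact: continuous_measurable_fun.
have maf n : measurable_fun [set: T n] (@avg f n).
  (* For fixed [z] the clamp is inactive once [k] exceeds the sum of the finitely many nonnegative
     eigenvalues. *)
  apply: (@measurable_fun_cvg _ _ _ _ (fun k => @avg (fun t => f (Num.min `|t| k.+1%:R)) n)).
    by move=> k; have [] := test_clamp (M := k.+1%:R) cf (ltr0Sn _ _).
  move=> z _; apply: cvg_near_cst; near=> k; apply: avg_clamp => l lz.
  have : \sum_(l <- Lam z) l <= k%:R.
    by near: k; exact: nbhs_infty_ger.
  rewrite (big_rem l lz)/=; have : 0 <= \sum_(y <- rem l (Lam z)) y.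
    rewrite big_seq_cond; apply: sumr_ge0 => y /andP[yz _].
    exact/Lam_ge0/(mem_rem yz).
  by rewrite -natr1; lra.
pose M := top + 1; have M0 : 0 < M by rewrite ltr_wpDl.
pose f1 (t : R) := f (Num.min `|t| M).
pose g (t : R) := Num.max 0 (t - top); pose g1 (t : R) := g (Num.min `|t| M).
have [mf1 _ maf1 tf1] := test_clamp cf M0.
have cg : continuous g.
  move=> t; apply: (@continuous_max _ _ (fun=> 0) (fun t => t - top)); first exact: cvg_cst.
  by apply: cvgB; [exact: cvg_id|exact: cvg_cst].
have [mg1 [D gD] mag1 tg1] := test_clamp cg M0.
have g10 : EE nu g1 = 0.
  rewrite -(EE_cst nu 0); apply: EE_nu_eq => // t /andP[t0 tt].
  rewrite /g1 ger0_norm// min_l; last by rewrite /M; lra.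
  by rewrite /g max_l// subr_le0.
have f1f : EE nu f1 = EE nu f.
  apply: EE_nu_eq => // t /andP[t0 tt].
  by rewrite /f1 ger0_norm// min_l//; rewrite /M; lra.
have fC1 t : `|f1 t| <= C by exact: fC.
have fg t : 0 <= t -> `|f t - f1 t| <= 2 * C * g1 t.
  move=> t0; rewrite /f1 /g1 (ger0_norm t0); have [tM|Mt] := leP t M.
    by rewrite subrr normr0 !mulr_ge0 ?(ltW C0)// /g le_max lexx.
  have -> : g M = 1 by rewrite /g /M addrAC subrr add0r max_r.
  by rewrite mulr1; apply: le_trans (ler_normB _ _) _; have := fC t; have := fC M; lra.
have afg n (z : T n) : `|avg f z - avg f1 z| <= 2 * C * avg g1 z.
  have pr : 0 < (p n)%:R :> R by rewrite ltr0n.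
  rewrite /avg -mulrBr -sumrB normrM gtr0_norm ?invr_gt0// mulrCA ler_wpM2l ?invr_ge0 ?(ltW pr)//.
  apply: le_trans (ler_norm_sum _ _ _) _; rewrite mulr_sumr big_seq [leRHS]big_seq.
  by apply: ler_sum => l /Lam_ge0; exact: fg.
split; [exact: mf|by exists C|exact: maf|].
apply: (to0_le (v := fun n => 2 * avg_err f1 n + 2 * (2 * C) ^+ 2 * avg_err g1 n)); last first.
  have c0 : 0 <= 2 * (2 * C) ^+ 2 by rewrite mulr_ge0 ?sqr_ge0.
  exact: to0D (to0Z (ler0n R 2) tf1) (to0Z c0 tg1).
apply: nearW => n.
have i1 := itg_avg_err fC1 (maf1 n); have i2 := itg_avg_err gD (mag1 n).
rewrite /avg_err -(EEZ _ _ (itg_mfun i1)) -(EEZ _ _ (itg_mfun i2)) -EED; [|exact: itgZ..].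
apply: EE_le.
- exact: itg_avg_err fC (maf n).
- by apply: itgD; exact: itgZ.
move=> z; rewrite -f1f g10 subr0; have := afg n z.
set u := avg f z; set v := avg f1 z; set u' := EE nu f1; set w := avg g1 z => uv.
have h : (u - v) ^+ 2 <= (2 * C) ^+ 2 * w ^+ 2.
  rewrite -exprMn -real_normK ?num_real// lerXn2r ?nnegrE//.
  exact: le_trans (normr_ge0 _) uv.
by have := sqr_ge0 ((u - v) - (v - u')); nra.
Unshelve. all: by end_near. Qed.

Lemma cvg_in_probability_avg f : continuous f -> bounded_fun f ->
  cvg_in_probability P (fun n z => avg f z) (EE nu f).
Proof.
move=> cf bf e e0; have [mf [C fC] maf tf] := test_continuous cf bf.
have e20 : 0 < e ^+ 2 by rewrite exprn_gt0.
apply: cvge0_near => [n|de de0]; first exact: measure_ge0.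
apply: filterS (tf _ (mulr_gt0 e20 de0)) => n hn.
have := EE_markov (itg_avg_err fC (maf n)) (fun z => sqr_ge0 _) e20.
have -> : [set z : T n | e ^+ 2 < (avg f z - EE nu f) ^+ 2] = [set z : T n | e < `|avg f z - EE nu f|].
  apply/seteqP; split => z /=; rewrite -[(avg f z - EE nu f) ^+ 2]real_normK ?num_real//.
    by rewrite ltr_pXn2r ?nnegrE ?(ltW e0).
  by move=> h; rewrite ltr_pXn2r ?nnegrE ?(ltW e0).
by move=> h; apply: le_trans h _; rewrite lee_fin ler_pdivrMl.
Qed.

End spectral_average.

Lemma Rintegral_esd {R : realType} p (A : 'M[R]_p) (f : R -> R) :
  measurable_fun [set: R] f ->
  \int[esd A]_x f x = p%:R^-1 * \sum_(l <- eigenvalues A) f l.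
Proof.
move=> mf; set s := eigenvalues A.
have H (g : R -> \bar R) : measurable_fun [set: R] g -> (forall x, (0 <= g x)%E) ->
    (\int[esd A]_x g x = (p%:R^-1)%:E * \sum_(l <- s) g l)%E.
  move=> mg g0; rewrite /esd ge0_integral_mscale//; congr (_ * _)%E.
  rewrite ge0_integral_measure_sum// (big_nth 0) big_mkord; apply: eq_bigr => i _.
  by rewrite integral_dirac// diracE in_setT mul1e.
rewrite /Rintegral integralE !H; last 4 first.
- by apply: measurable_funeneg; exact/measurable_EFinP.
- by move=> x; exact: funeneg_ge0.
- by apply: measurable_funepos; exact/measurable_EFinP.
- by move=> x; exact: funepos_ge0.
have E (g : R -> R) : \sum_(l <- s) (Num.max (g l) 0)%:E = (\sum_(l <- s) Num.max (g l) 0)%:E.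
  by rewrite sumEFin.
have -> : (\sum_(l <- s) (EFin \o f)^\+%E l = (\sum_(l <- s) Num.max (f l) 0)%:E)%E.
  by rewrite -E; apply: eq_bigr => l _; rewrite funeposE EFin_max.
have -> : (\sum_(l <- s) (EFin \o f)^\-%E l = (\sum_(l <- s) Num.max (- f l) 0)%:E)%E.
  by rewrite -(E (fun l => - f l)); apply: eq_bigr => l _; rewrite funenegE EFin_max.
rewrite -!EFinM -EFinB /= -mulrBr -sumrB; congr (_ * _); apply: eq_bigr => l _.
by have [h|h] := leP (f l) 0; [rewrite max_l|rewrite max_r]; lra.
Qed.

Theorem weak_cvg_resolvent {R : realType} (dT : nat -> measure_display)
    (T : forall n, measurableType (dT n)) (P : forall n, probability (T n) R)
    (p : nat -> nat) (A : forall n, T n -> 'M[R]_(p n))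
    (nu : probability (measurableTypeR R) R) (top : R) :
  (forall n, (0 < p n)%N) -> (forall n z, psd (A n z)) ->
  0 <= top -> nu (~` `[0, top]) = 0%E ->
  (forall x, 0 < x ->
    (forall n, measurable_fun [set: T n] (fun z => \tr (resolvent (A n z) x))) /\
    to0 (fun n => EE (P n) (fun z =>
      (\tr (resolvent (A n z) x) / (p n)%:R - EE nu (stieltjes_fun x)) ^+ 2))) ->
  weak_cvg_in_probability P (fun n z => esd (A n z)) nu.
Proof.
move=> p0 pA top0 nu_top hres f cf bf.
have mf : measurable_fun [set: R] f by exact: continuous_measurable_fun.
pose Lam n (z : T n) := eigenvalues (A n z).
have sL n (z : T n) : size (Lam n z) = p n by apply: size_eigenvalues; have [] := pA n z.
have L0 n (z : T n) l : l \in Lam n z -> 0 <= l by exact: (psd_eigenvalues_ge0 (pA n z)).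
have ts x : 0 < x -> test_fun P p Lam nu (stieltjes_fun x).
  move=> x0; have [mr cr] := hres x x0.
  have aE n (z : T n) : avg p Lam (stieltjes_fun x) z = \tr (resolvent (A n z) x) / (p n)%:R.
    rewrite /avg -(sum_inv_eigenvalues (pA n z) x0) mulrC; congr (_ * _).
    by apply: eq_big_seq => l /L0 l0; rewrite /stieltjes_fun ger0_norm.
  split.
  - apply: continuous_measurable_fun => t; apply: cvgV; first by rewrite lt0r_neq0// ltr_wpDl.
    by apply: cvgD; [exact: norm_continuous|exact: cvg_cst].
  - exists x^-1 => t; have /andP[t0 t1] := stieltjes_fun_bounds t x0.
    by rewrite gtr0_norm.
  - move=> n; rewrite (_ : @avg _ _ _ _ _ _ _ = fun z => \tr (resolvent (A n z) x) / (p n)%:R).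
      exact: measurable_funM.
    by apply/funext => z; exact: aE.
  - rewrite (_ : avg_err _ _ _ _ _ = fun n => EE (P n) (fun z =>
      (\tr (resolvent (A n z) x) / (p n)%:R - EE nu (stieltjes_fun x)) ^+ 2))//.
    by apply/funext => n; congr EE; apply/funext => z; rewrite aE.
have := cvg_in_probability_avg p0 sL L0 top0 nu_top ts cf bf.
move=> H e e0; have := H e e0.
rewrite (_ : (fun n => P n [set w | e < `|avg p Lam f w - EE nu f|]) =
  (fun n => P n [set w | e < `|\int[esd (A n w)]_x f x - EE nu f|]))//.
by apply/funext => n; congr (P n _); apply/seteqP; split => w /=; rewrite Rintegral_esd.
Qed.

(** * The Marchenko-Pastur law *)

Section density.
Local Open Scope ereal_scope.
Context {d : measure_display} {T : measurableType d} {R : realType}.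
Variables (mu : {measure set T -> \bar R}) (g : T -> R).
Let h x := (g x)%:E.
Hypotheses (mh : measurable_fun [set: T] g) (h0 : forall x, (0 <= g x)%R).

(** The two proofs are arguments so that the measure structure attached below can be inferred from
    the term itself. *)
Definition mdensity of measurable_fun [set: T] g & (forall x, (0 <= g x)%R) :=
  fun A : set T => \int[mu]_(x in A) h x.

Let mh' : measurable_fun [set: T] h. Proof. exact/measurable_EFinP. Qed.
Let h0' x : 0 <= h x. Proof. by rewrite lee_fin. Qed.

Let md := mdensity mh h0.

Let md0 : md set0 = 0. Proof. exact: integral_set0. Qed.

Let md_ge0 A : 0 <= md A. Proof. exact: integral_ge0. Qed.

Let md_sigma_additive : semi_sigma_additive md.
Proof.
move=> F mF tF mUF; rewrite /md /mdensity ge0_integral_bigcup//=; last exact: measurable_funTS.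
by apply: is_cvg_ereal_nneg_natsum_cond => n _ _; exact: integral_ge0.
Qed.

HB.instance Definition _ := isMeasure.Build _ T R (mdensity mh h0)
  md0 md_ge0 md_sigma_additive.

Import HBNNSimple.

Let integral_mdensity_nnsfun (f : {nnsfun T >-> R}) :
  \int[mdensity mh h0]_x (f x)%:E = \int[mu]_x ((f x)%:E * h x).
Proof.
rewrite integralT_nnsfun sintegralE.
transitivity (\sum_(r \in range f) \int[mu]_x ((r * \1_(f @^-1` [set r]) x)%:E * h x)).
  apply: eq_fsbigr => r rf; have r0 : (0 <= r)%R by case: (set_mem rf) => x _ <-.
  rewrite [X in _ * X](_ : _ = \int[mu]_(x in f @^-1` [set r]) h x)//.
  rewrite integral_mkcond -ge0_integralZl//; last 2 first.
  - apply/(measurable_restrictT _ _).1 => //; exact: measurable_funTS.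
  - by move=> x _; rewrite /patch; case: ifP.
  apply: eq_integral => x _; rewrite /patch indicE; case: ifP => _; rewrite ?mulr1 ?mulr0 ?mule0 ?mul0e//.
rewrite -ge0_integral_fsum//.
- apply: eq_integral => x _; rewrite -ge0_mule_fsuml; last first.
    by move=> r; rewrite nnfun_muleindic_ge0.
  by rewrite fsumEFin// -fimfunE.
- by move=> r; apply: emeasurable_funM => //; exact/measurable_EFinP/measurable_funM.
- by move=> r x _; rewrite mule_ge0// nnfun_muleindic_ge0.
Qed.

Lemma ge0_integral_mdensity (f : T -> \bar R) : measurable_fun [set: T] f ->
  (forall x, 0 <= f x) -> \int[mdensity mh h0]_x f x = \int[mu]_x (f x * h x).
Proof.
move=> mf f0; pose f_ := nnsfun_approx measurableT mf.
transitivity (limn (fun n => \int[mdensity mh h0]_x (f_ n x)%:E)).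
  rewrite -monotone_convergence//.
  - by apply: eq_integral => y _; apply/esym/cvg_lim => //; exact: cvg_nnsfun_approx.
  - by move=> n; exact/measurable_EFinP/measurable_funP.
  - by move=> n y _; rewrite lee_fin.
  - by move=> y _ m n mn; rewrite lee_fin; exact/lefP/nd_nnsfun_approx.
under eq_fun do rewrite integral_mdensity_nnsfun.
rewrite -monotone_convergence//.
- apply: eq_integral => y _; apply/cvg_lim => //.
  by apply: cvgeZr => //; exact: cvg_nnsfun_approx.
- by move=> n; apply: emeasurable_funM => //; exact/measurable_EFinP/measurable_funP.
- by move=> n y _; rewrite mule_ge0// lee_fin.
- move=> y _ m n mn; rewrite lee_wpmul2r// lee_fin; exact/lefP/nd_nnsfun_approx.
Qed.

End density.

(** * Explicit integrals of the square-root density *)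

Section semicircle_integral.
Context {R : realType}.
Local Notation leb := (@lebesgue_measure R).

(** [acos] inverts the continuous [cos] on [[0, pi]]. Continuity up to the points -1 and 1, where it
    is not differentiable, is needed at both ends of the integral. *)
Lemma cvg_acos (T : Type) (F : set_system T) (FF : Filter F) (u : T -> R) (l : R) :
  -1 <= l <= 1 -> u @ F --> l -> (\forall s \near F, -1 <= u s <= 1) ->
  acos (u s) @[s --> F] --> acos l.
Proof.
move=> l1 ul u1.
have cc : {within `[0 : R, pi], continuous (@cos R)}.
  by apply: continuous_subspaceT; exact: continuous_cos.
have := segment_can_ge_continuous (pi_ge0 R) cc (@cosK R).
rewrite cospi cos0 => /subspace_continuousP/(_ l) H.
have := H _; rewrite /= in_itv/= => /(_ l1) {}H.
apply: (cvg_comp u (@acos R) _ H) => A /= hA.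
have := ul _ hA; rewrite /= => h.
by apply: filterS2 u1 h => s h1; apply; rewrite /= in_itv.
Qed.

Variables (A B c : R).
Hypotheses (A0 : 0 <= A) (AB : A < B) (c0 : 0 < c).
Let a := A + c.
Let b := B + c.
Let a0 : 0 < a. Proof. by rewrite /a ltr_wpDl. Qed.
Let ab : a < b. Proof. by rewrite ltrD2r. Qed.
Let b0 : 0 < b. Proof. exact: lt_trans ab. Qed.
Let rad s := (B - s) * (s - A).
(** [u] is affine in [s] and [v] is affine in [(s + c)^-1]; both map [A] to -1 and [B] to 1. The
    derivatives of [acos (u s)] and [acos (v s)] are [-1 / sqrt(rad)] and
    [- sqrt(a b) / ((s + c) sqrt(rad))]: besides the derivative of [sqrt(rad)], these are the pieces
    obtained by dividing [rad] by [s + c]. *)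
Let u s := (2 * s - A - B) / (B - A).
Let v s := (a + b - 2 * a * b * (s + c)^-1) / (B - A).
Let G s := Num.sqrt (rad s) + - ((a + b) / 2) * acos (u s) + Num.sqrt (a * b) * acos (v s).
Let BA : 0 < B - A. Proof. by rewrite subr_gt0. Qed.

Let u1 s : s \in `[A, B] -> -1 <= u s <= 1.
Proof.
rewrite in_itv/= => /andP[s1 s2]; rewrite /u ler_pdivrMr// ler_pdivlMr//.
by apply/andP; split; lra.
Qed.

Let sub_sqr_u s : 1 - u s ^+ 2 = rad s * (2 / (B - A)) ^+ 2.
Proof. by rewrite /u /rad; field; exact: lt0r_neq0. Qed.

Let sub_sqr_v s : 0 < s + c -> 1 - v s ^+ 2 = rad s * (a * b) * (2 / ((s + c) * (B - A))) ^+ 2.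
Proof. by move=> sc; rewrite /v /rad /a /b; field; rewrite !lt0r_neq0. Qed.

Let rad_ge0 s : s \in `[A, B] -> 0 <= rad s.
Proof. by rewrite in_itv/= => /andP[s1 s2]; rewrite /rad mulr_ge0 ?subr_ge0. Qed.

Let rad_gt0 s : s \in `]A, B[ -> 0 < rad s.
Proof. by rewrite in_itv/= => /andP[s1 s2]; rewrite /rad mulr_gt0 ?subr_gt0. Qed.

Let sc_gt0 s : s \in `[A, B] -> 0 < s + c.
Proof. by rewrite in_itv/= => /andP[s1 s2]; rewrite ltr_wpDl// (le_trans A0). Qed.

Let sqr_le1 (w : R) : 0 <= 1 - w ^+ 2 -> -1 <= w <= 1.
Proof. by move=> h; apply/andP; split; nra. Qed.

Let sqr_lt1 (w : R) : 0 < 1 - w ^+ 2 -> -1 < w < 1.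
Proof. by move=> h; apply/andP; split; nra. Qed.

Let v1 s : s \in `[A, B] -> -1 <= v s <= 1.
Proof.
move=> sAB; apply: sqr_le1; rewrite sub_sqr_v ?sc_gt0//.
apply: mulr_ge0 (sqr_ge0 _); apply: mulr_ge0; first exact: rad_ge0.
by rewrite mulr_ge0 ?ltW.
Qed.

Let inoo s : s \in `]A, B[ -> s \in `[A, B].
Proof. exact: subset_itv_oo_cc. Qed.

Let sqrt_u s : s \in `]A, B[ -> Num.sqrt (1 - u s ^+ 2) = Num.sqrt (rad s) * (2 / (B - A)).
Proof.
move=> sAB; rewrite sub_sqr_u sqrtrM ?rad_ge0 ?inoo// sqrtr_sqr ger0_norm//.
by rewrite divr_ge0 ?ltW.
Qed.

Let sqrt_v s : s \in `]A, B[ ->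
  Num.sqrt (1 - v s ^+ 2) = Num.sqrt (rad s) * Num.sqrt (a * b) * (2 / ((s + c) * (B - A))).
Proof.
move=> sAB; have sc := sc_gt0 (inoo sAB).
have r0 := rad_ge0 (inoo sAB); have ab0 : 0 <= a * b by rewrite mulr_ge0 ?ltW.
rewrite sub_sqr_v// sqrtrM ?(mulr_ge0 r0)// sqrtrM// sqrtr_sqr ger0_norm//.
by rewrite divr_ge0 ?mulr_ge0 ?ltW.
Qed.

Lemma is_derive_semicircle s : s \in `]A, B[ ->
  is_derive s 1 G (Num.sqrt (rad s) / (s + c)).
Proof.
move=> sAB; have sc := sc_gt0 (inoo sAB); have r0 := rad_gt0 sAB.
have rt0 : 0 < Num.sqrt (rad s) by rewrite sqrtr_gt0.
have q0 : 0 < Num.sqrt (a * b) by rewrite sqrtr_gt0 mulr_gt0.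
have ud : is_derive s 1 u (2 / (B - A)).
  rewrite /u; apply: is_derive_eq.
  by rewrite scaler0 add0r !subr0 /GRing.scale/= mulr1 mulrC.
have u11 : -1 < u s < 1.
  by apply: sqr_lt1; rewrite sub_sqr_u mulr_gt0// exprn_gt0// divr_gt0.
have v11 : -1 < v s < 1.
  apply: sqr_lt1; rewrite sub_sqr_v//; apply: mulr_gt0; last by rewrite exprn_gt0// divr_gt0// mulr_gt0.
  by rewrite mulr_gt0// mulr_gt0.
have vd : is_derive s 1 v (2 * a * b / (s + c) ^+ 2 / (B - A)).
  have scn := lt0r_neq0 sc.
  have i1 : is_derive s 1 (fun s => s + c) 1 by apply: is_derive_eq; rewrite addr0.
  have i2 := @is_deriveV R (fun s => s + c) s _ _ scn i1.
  rewrite /v; apply: is_derive_eq.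
  by rewrite !scaler0 /GRing.scale/=; field; rewrite scn lt0r_neq0.
have rd : is_derive s 1 rad (A + B - 2 * s).
  rewrite /rad; apply: is_derive_eq.
  by rewrite /GRing.scale/=; ring.
have d1 : is_derive s 1 (Num.sqrt \o rad) ((2 * Num.sqrt (rad s))^-1 * (A + B - 2 * s)).
  by apply: is_derive1_comp; exact: is_derive1_sqrt.
have d2 : is_derive s 1 (acos \o u) (- (Num.sqrt (1 - u s ^+ 2))^-1 * (2 / (B - A))).
  exact: is_derive1_comp.
have d3 : is_derive s 1 (acos \o v) (- (Num.sqrt (1 - v s ^+ 2))^-1 * (2 * a * b / (s + c) ^+ 2 / (B - A))).
  exact: is_derive1_comp.
have -> : Num.sqrt (rad s) / (s + c) = (2 * Num.sqrt (rad s))^-1 * (A + B - 2 * s)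
  + - ((a + b) / 2) * (- (Num.sqrt (1 - u s ^+ 2))^-1 * (2 / (B - A)))
  + Num.sqrt (a * b) * (- (Num.sqrt (1 - v s ^+ 2))^-1 * (2 * a * b / (s + c) ^+ 2 / (B - A))).
  rewrite sqrt_u// sqrt_v//.
  have rE : Num.sqrt (rad s) ^+ 2 = rad s by rewrite sqr_sqrtr// ltW.
  have rE' : Num.sqrt (rad s) / (s + c) = rad s / Num.sqrt (rad s) / (s + c).
    by rewrite -{2}rE; field; rewrite !lt0r_neq0.
  rewrite rE' /rad; move: (Num.sqrt (rad s)) rt0 => rt rt0.
  have qE : Num.sqrt (a * b) ^+ 2 = a * b by rewrite sqr_sqrtr// mulr_ge0 ?ltW.
  move: (Num.sqrt (a * b)) q0 qE => q q0 qE; rewrite /a /b.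
  by field; rewrite !lt0r_neq0.
exact: (is_deriveD (is_deriveD d1 (is_deriveZ (- ((a + b) / 2)) d2)) (is_deriveZ (Num.sqrt (a * b)) d3)).
Qed.

Let u_cont s : {for s, continuous u}.
Proof.
apply: cvgM; last exact: cvg_cst.
apply: cvgB; last exact: cvg_cst.
apply: cvgB; last exact: cvg_cst.
by apply: cvgM; [exact: cvg_cst|exact: cvg_id].
Qed.

Let v_cont s : s \in `[A, B] -> {for s, continuous v}.
Proof.
move=> /sc_gt0 sc; apply: cvgM; last exact: cvg_cst.
apply: cvgB; first exact: cvg_cst.
apply: cvgM; first exact: cvg_cst.
apply: cvgV; first exact: lt0r_neq0.
by apply: cvgD; [exact: cvg_id|exact: cvg_cst].
Qed.

Let rad_cont s : {for s, continuous (fun s => Num.sqrt (rad s))}.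
Proof.
apply: (@continuous_comp _ _ _ rad Num.sqrt); last exact: sqrt_continuous.
by apply: cvgM; apply: cvgB; first [exact: cvg_cst|exact: cvg_id].
Qed.

Let G_cvg (F : set_system R) (FF : Filter F) s : s \in `[A, B] -> F `=>` nbhs s ->
  (\forall t \near F, t \in `[A, B]) -> G t @[t --> F] --> G s.
Proof.
move=> sAB Fs FAB.
have tr (f : R -> R) : {for s, continuous f} -> f @ F --> f s.
  by move=> fs; apply: cvg_trans fs; exact: cvg_app.
apply: cvgD; first apply: cvgD; first exact: tr.
- apply: cvgM; first exact: cvg_cst.
  by apply: cvg_acos; [exact: u1|exact: tr|apply: filterS FAB => t; exact: u1].
- apply: cvgM; first exact: cvg_cst.
  by apply: cvg_acos; [exact: v1|exact/tr/v_cont|apply: filterS FAB => t; exact: v1].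
Qed.

Lemma integral_semicircle_shift :
  (\int[leb]_(s in `[A, B]) (Num.sqrt (rad s) / (s + c))%:E =
   (pi * ((a + b) / 2 - Num.sqrt (a * b)))%:E)%E.
Proof.
rewrite (@continuous_FTC2 _ _ G)//.
- have uA : u A = -1 by rewrite /u; field; exact: lt0r_neq0.
  have uB : u B = 1 by rewrite /u; field; exact: lt0r_neq0.
  have vA : v A = -1 by rewrite /v /a /b; field; rewrite -/a !lt0r_neq0.
  have vB : v B = 1 by rewrite /v /a /b; field; rewrite -/b !lt0r_neq0.
  rewrite /G uA uB vA vB acos1 acosN1 /rad !subrr !mulr0 !mul0r sqrtr0 -EFinB.
  by congr EFin; ring.
- apply: continuous_in_subspaceT => s /set_mem sAB; apply: cvgM; first exact: rad_cont.
  apply: cvgV; first exact/lt0r_neq0/sc_gt0.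
  by apply: cvgD; [exact: cvg_id|exact: cvg_cst].
- split.
  + by move=> s /is_derive_semicircle[].
  + apply: G_cvg; first by rewrite bound_itvE ltW.
      exact: cvg_within.
    near=> t; rewrite in_itv/=; apply/andP; split; near: t.
      by apply: filterS (nbhs_right_gt A) => t /ltW.
    by apply: filterS (nbhs_right_lt AB) => t /ltW.
  + apply: G_cvg; first by rewrite bound_itvE ltW.
      exact: cvg_within.
    near=> t; rewrite in_itv/=; apply/andP; split; near: t.
      by apply: filterS (nbhs_left_gt AB) => t /ltW.
    by apply: filterS (nbhs_left_lt B) => t /ltW.
- move=> s /is_derive_semicircle sd; rewrite derive1E; exact: derive_val.
Unshelve. all: by end_near. Qed.

End semicircle_integral.

Section semicircle_mass.
Context {R : realType}.
Local Notation leb := (@lebesgue_measure R).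
Variables (A B : R).
Hypotheses (A0 : 0 <= A) (AB : A < B).

Let rt s := Num.sqrt ((B - s) * (s - A)).

Let rt_eq0 s : A <= s -> s = 0 -> rt s = 0.
Proof.
move=> + s0; rewrite s0 => A0'; have -> : rt 0 = Num.sqrt (B * - A) by rewrite /rt subr0 sub0r.
have -> : A = 0 by apply/le_anti; rewrite A0 A0'.
by rewrite oppr0 mulr0 sqrtr0.
Qed.

Lemma measurable_semicircle c : measurable_fun [set: R] (fun s => rt s / (s + c)).
Proof.
apply: measurable_funM; last by apply: measurable_funV; exact: measurable_funD.
apply: continuous_measurable_fun => s.
apply: (@continuous_comp _ _ _ (fun s => (B - s) * (s - A)) Num.sqrt); last exact: sqrt_continuous.
by apply: cvgM; apply: cvgB; first [exact: cvg_cst|exact: cvg_id].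
Qed.

(* The integrand may be singular at 0 when [A = 0]; it is the increasing limit
   of its shifts. *)
Lemma integral_semicircle :
  (\int[leb]_(s in `[A, B]) (rt s / s)%:E = (pi * ((A + B) / 2 - Num.sqrt (A * B)))%:E)%E.
Proof.
pose g (k : nat) s := (rt s / (s + k.+1%:R^-1))%:E.
have k0 (k : nat) : 0 < k.+1%:R^-1 :> R by rewrite invr_gt0.
have g0 k s : `[A, B]%classic s -> (0 <= g k s)%E.
  rewrite /= in_itv/= => /andP[As sB]; rewrite lee_fin divr_ge0 ?sqrtr_ge0//.
  by rewrite addr_ge0 ?(ltW (k0 k))// (le_trans A0).
have gnd s : `[A, B]%classic s -> {homo g^~ s : n m / (n <= m)%N >-> (n <= m)%E}.
  rewrite /= in_itv/= => /andP[As sB] n m nm; rewrite lee_fin ler_wpM2l ?sqrtr_ge0//.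
  have s0 := le_trans A0 As.
  rewrite lef_pV2 ?posrE ?(ltr_wpDl s0)// lerD2l lef_pV2 ?posrE// ler_nat.
  exact: leq_trans nm _.
have mg k : measurable_fun `[A, B] (g k).
  by apply/measurable_EFinP/measurable_funTS; exact: measurable_semicircle.
have := @cvg_monotone_convergence _ _ _ leb `[A, B] (measurable_itv _) g mg g0 gnd.
have -> : (\int[leb]_(s in `[A, B]) limn (g^~ s) = \int[leb]_(s in `[A, B]) (rt s / s)%:E)%E.
  apply: eq_integral => s; rewrite inE/= in_itv/= => /andP[As sB]; apply/cvg_lim => //.
  (* The point 0 lies in the interval only if [A = 0]; the root then vanishes there, so all the
     quotients are 0. *)
  have [s0|s0] := eqVneq s 0.
    have r0 := rt_eq0 As s0; rewrite /g r0 mul0r; apply: cvg_near_cst; apply: nearW => k.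
    by rewrite mul0r.
  apply: cvg_EFin; first exact: nearW.
  apply: cvgM; first exact: cvg_cst.
  apply: cvgV => //; rewrite -[X in _ --> X]addr0; apply: cvgD; first exact: cvg_cst.
  exact: cvg_harmonic.
move=> /cvg_unique; apply => //.
have -> : (fun k => \int[leb]_(s in `[A, B]) g k s)%E =
   (fun k => (pi * (((A + k.+1%:R^-1) + (B + k.+1%:R^-1)) / 2
      - Num.sqrt ((A + k.+1%:R^-1) * (B + k.+1%:R^-1))))%:E).
  by apply/funext => k; exact: integral_semicircle_shift.
apply: cvg_EFin; first exact: nearW.
have ck (x : R) : x + k.+1%:R^-1 @[k --> \oo] --> x.
  by rewrite -[X in _ --> X]addr0; apply: cvgD; [exact: cvg_cst|exact: cvg_harmonic].
apply: cvgM; first exact: cvg_cst.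
apply: cvgB; first by apply: cvgM; [exact: cvgD|exact: cvg_cst].
apply: (cvg_comp (fun k : nat => (A + k.+1%:R^-1) * (B + k.+1%:R^-1)) Num.sqrt); first exact: cvgM.
exact: sqrt_continuous.
Qed.

(** Partial fractions, [y / (s (s + y)) = 1 / s - 1 / (s + y)], reduce it to the two previous
    integrals. The identity is kept as a sum of extended reals, which also excludes an infinite
    value. *)
Lemma integral_semicircle_stieltjes y : 0 < y ->
  (\int[leb]_(s in `[A, B]) (rt s / s / (s + y))%:E =
   (pi * (Num.sqrt ((A + y) * (B + y)) - Num.sqrt (A * B) - y) / y)%:E)%E.
Proof.
move=> y0; set J := integral _ _ _.
have rt0 s : 0 <= rt s := sqrtr_ge0 _.
have s0 s : `[A, B]%classic s -> 0 <= s.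
  by rewrite /= in_itv/= => /andP[As sB]; exact: le_trans As.
have mJ : measurable_fun `[A, B] (fun s => (rt s / s / (s + y))%:E).
  apply/measurable_EFinP/measurable_funTS; apply: measurable_funM.
    by have := measurable_semicircle 0; under eq_fun do rewrite addr0.
  by apply: measurable_funV; exact: measurable_funD.
have mS : measurable_fun `[A, B] (fun s => (rt s / (s + y))%:E).
  by apply/measurable_EFinP/measurable_funTS; exact: measurable_semicircle.
have J0 s : `[A, B]%classic s -> (0 <= (rt s / s / (s + y))%:E)%E.
  by move=> /s0 ?; rewrite lee_fin !divr_ge0// addr_ge0// ltW.
have S0 s : `[A, B]%classic s -> (0 <= (rt s / (s + y))%:E)%E.
  by move=> /s0 ?; rewrite lee_fin !divr_ge0// addr_ge0// ltW.
have E : (y%:E * J + (pi * ((A + y + (B + y)) / 2 - Num.sqrt ((A + y) * (B + y))))%:E =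
          (pi * ((A + B) / 2 - Num.sqrt (A * B)))%:E)%E.
  rewrite -integral_semicircle -(integral_semicircle_shift A0 AB y0) /J -ge0_integralZl//; last first.
    by rewrite lee_fin ltW.
  rewrite -ge0_integralD//; last 2 first.
    by move=> s /J0 ?; rewrite mule_ge0// lee_fin ltW.
    by apply: emeasurable_funM => //; exact: measurable_cst.
  apply: eq_integral => s; rewrite inE => sAB; rewrite -EFinM -EFinD; congr EFin.
  rewrite -/(rt s); have [s00|sn0] := eqVneq s 0; last first.
    by field; rewrite sn0/= lt0r_neq0// ltr_wpDl// s0.
  by rewrite rt_eq0// ?mul0r ?mulr0 ?addr0//; move: sAB; rewrite /= in_itv/= => /andP[].
case: J E mJ J0 => [r| |].
- rewrite -EFinM -EFinD => -[] E _ _; congr EFin.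
  have : y * r = pi * (Num.sqrt ((A + y) * (B + y)) - Num.sqrt (A * B) - y) by lra.
  by move=> <-; rewrite mulrAC divff ?mul1r// lt0r_neq0.
- by rewrite gt0_muley.
- by rewrite gt0_muleNy.
Qed.

End semicircle_mass.

(** * Mass, support and Stieltjes transform of the limit laws *)

Section marchenko_pastur_integral.
Context {R : realType}.
Implicit Types q : R.
Local Notation leb := (@lebesgue_measure R).

Lemma ge0_integral_marchenko_pastur q (f : R -> R) : 0 < q ->
  measurable_fun [set: R] f -> (forall x, 0 <= f x) ->
  (\int[marchenko_pastur q]_x (f x)%:E =
   \int[leb]_x (f x * mp_density q x)%:E + (mp_atom q * f 0)%:E)%E.
Proof.
move=> q0 mf f0.
have mh := measurable_mp_density q; have h0 x := mp_density_ge0 x q0.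
rewrite (@eq_measure_integral _ _ _ _ (measure_add (mdensity leb mh h0)
   (mscale (NngNum (mp_atom_ge0 q)) (dirac (0%R : measurableTypeR R)))))//; last first.
  move=> A mA _; apply/esym; apply: (etrans (measure_addE _ _ A)).
  by rewrite /= /marchenko_pastur leNgt q0.
rewrite ge0_integral_measure_add//; last 2 first.
  by move=> x _; rewrite lee_fin.
  exact/measurable_EFinP.
rewrite ge0_integral_mdensity; [|exact/measurable_EFinP|by move=> x; rewrite lee_fin].
congr (_ + _)%E.
rewrite ge0_integral_mscale; [|by []|exact/measurable_EFinP|by move=> x _; rewrite lee_fin].
by rewrite integral_dirac ?diracT ?mul1e//; exact/measurable_EFinP.
Qed.

Lemma mp_lower_upper q : 0 < q -> [/\ 0 <= mp_lower q, mp_lower q < mp_upper q,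
  mp_lower q + mp_upper q = 2 * (1 + q) & mp_lower q * mp_upper q = (1 - q) ^+ 2].
Proof.
move=> q0; have r0 : 0 < Num.sqrt q by rewrite sqrtr_gt0.
have := sqr_sqrtr (ltW q0); rewrite /mp_lower /mp_upper; move: (Num.sqrt q) r0 => r r0 <-.
by split; [exact: sqr_ge0|nra|ring|ring].
Qed.

Let c q : R := 2 * pi * q.
Let c_gt0 q : 0 < q -> 0 < c q.
Proof. by move=> q0; rewrite /c !mulr_gt0// pi_gt0. Qed.

Let integral_density q (f : R -> R) : 0 < q ->
  measurable_fun [set: R] f -> (forall x, 0 <= f x) ->
  (\int[leb]_x (f x * mp_density q x)%:E = ((c q)^-1)%:E *
   \int[leb]_(x in `[mp_lower q, mp_upper q])
     (Num.sqrt ((mp_upper q - x) * (x - mp_lower q)) / x * f x)%:E)%E.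
Proof.
move=> q0 mf f0; have [l0 lu _ _] := mp_lower_upper q0.
rewrite -ge0_integralZl//; last 3 first.
- apply/measurable_EFinP/measurable_funTS; apply: measurable_funM => //.
  by have := measurable_semicircle (mp_lower q) (mp_upper q) 0; under eq_fun do rewrite addr0.
- move=> x; rewrite /= in_itv/= => /andP[lx _]; rewrite lee_fin mulr_ge0// divr_ge0 ?sqrtr_ge0//.
  exact: le_trans lx.
- by rewrite lee_fin invr_ge0 ltW ?c_gt0.
rewrite [RHS]integral_mkcond; apply: eq_integral => x _.
rewrite /patch /mp_density indicE; case: ifP => _; last by rewrite !mulr0.
rewrite mulr1 -EFinM; congr EFin; rewrite -/(c q) invfM; ring.
Qed.

(** For [q > 0] the continuous part has mass [(1 + q - |1 - q|) / (2 q)], that is 1 or [1 / q]; the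
    atom supplies the rest when [q > 1]. *)
Lemma marchenko_pastur_setT q : marchenko_pastur q [set: measurableTypeR R] = 1%E.
Proof.
have [q0|q0] := leP q 0; first by rewrite /marchenko_pastur q0 diracT.
rewrite /marchenko_pastur leNgt q0/= diracT mule1.
have -> : (\int[leb]_x (mp_density q x)%:E = \int[leb]_x (1 * mp_density q x)%:E)%E.
  by apply: eq_integral => x _; rewrite mul1r.
rewrite integral_density//.
have [l0 lu lD lM] := mp_lower_upper q0.
have -> : (\int[leb]_(x in `[mp_lower q, mp_upper q])
     (Num.sqrt ((mp_upper q - x) * (x - mp_lower q)) / x * 1)%:E =
   \int[leb]_(x in `[mp_lower q, mp_upper q])
     (Num.sqrt ((mp_upper q - x) * (x - mp_lower q)) / x)%:E)%E.
  by apply: eq_integral => x _; rewrite mulr1.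
rewrite integral_semicircle// lD lM sqrtr_sqr -EFinM -EFinD; congr EFin.
have qn0 := lt0r_neq0 q0; rewrite /c; have := lt0r_neq0 (pi_gt0 R); move: (@pi R) => c' pin0.
rewrite /mp_atom; case: ltP => q1.
  by rewrite ler0_norm; [field; rewrite ?qn0 ?pin0|rewrite subr_le0 ltW].
by rewrite ger0_norm; [field; rewrite ?qn0 ?pin0|rewrite subr_ge0].
Qed.

Lemma marchenko_pastur_support q : 0 <= q ->
  marchenko_pastur q (~` `[0, mp_upper q]) = 0%E.
Proof.
rewrite le_eqVlt => /predU1P[<-|q0].
  rewrite /marchenko_pastur lexx diracE memNset// => -[]/=; rewrite in_itv/=.
  by rewrite /mp_upper sqrtr0 addr0 expr1n lexx ler01.
have [l0 lu _ _] := mp_lower_upper q0.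
rewrite /marchenko_pastur leNgt q0/= diracE memNset; last first.
  by move=> []/=; rewrite in_itv/= lexx (le_trans l0)// ltW.
rewrite mule0 adde0; apply: integral0_eq => x /= nx.
rewrite /mp_density indicE memNset ?mulr0// => /= h; apply: nx; move: h.
by rewrite !in_itv/= => /andP[lx ->]; rewrite (le_trans l0).
Qed.

Let measurable_stieltjes y : 0 < y -> measurable_fun [set: R] (stieltjes_fun y).
Proof.
move=> y0; apply: continuous_measurable_fun => t; apply: cvgV; first by rewrite lt0r_neq0// ltr_wpDl.
by apply: cvgD; [exact: norm_continuous|exact: cvg_cst].
Qed.

(** For [q > 0], [(mp_lower q + y) * (mp_upper q + y)] is the discriminant
    [(y + 1 - q) ^ 2 + 4 q y], so the explicit integral is the positive root. The sign of [1 - q]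
    decides whether the atom contributes, with the same final formula. *)
Lemma marchenko_pastur_stieltjes q y : 0 <= q -> 0 < y ->
  exists2 S : R, (\int[marchenko_pastur q]_x (stieltjes_fun y x)%:E)%E = S%:E &
    0 < S /\ q * y * S ^+ 2 + (y + 1 - q) * S = 1.
Proof.
move=> q0 y0; have ms := measurable_stieltjes y0.
have f0 x : 0 <= stieltjes_fun y x by have /andP[/ltW] := stieltjes_fun_bounds x y0.
suff [S SE E] : exists2 S : R, (\int[marchenko_pastur q]_x (stieltjes_fun y x)%:E)%E = S%:E &
    q * y * S ^+ 2 + (y + 1 - q) * S = 1.
  exists S => //; split => //; rewrite lt_neqAle; apply/andP; split.
    apply/eqP => S0; move: E; rewrite -S0 expr0n/= !mulr0 addr0 => /eqP.
    by rewrite eq_sym oner_eq0.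
  by rewrite -lee_fin -SE; apply: integral_ge0 => x _; rewrite lee_fin.
move: q0; rewrite le_eqVlt => /predU1P[q0|q0].
  exists (1 + y)^-1; last by rewrite -q0; field; rewrite lt0r_neq0// addr_gt0.
  rewrite (@eq_measure_integral _ _ _ _ (dirac (1 : measurableTypeR R)))//.
    by rewrite integral_dirac ?diracT ?mul1e /stieltjes_fun ?normr1//; exact/measurable_EFinP.
  by move=> A mA _; rewrite /= /marchenko_pastur -q0 lexx.
have [l0 lu lD lM] := mp_lower_upper q0.
rewrite ge0_integral_marchenko_pastur// integral_density//.
have -> : (\int[leb]_(x in `[mp_lower q, mp_upper q])
     (Num.sqrt ((mp_upper q - x) * (x - mp_lower q)) / x * stieltjes_fun y x)%:E =
   \int[leb]_(x in `[mp_lower q, mp_upper q])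
     (Num.sqrt ((mp_upper q - x) * (x - mp_lower q)) / x / (x + y))%:E)%E.
  apply: eq_integral => x; rewrite inE/= in_itv/= => /andP[lx _].
  by rewrite /stieltjes_fun ger0_norm// (le_trans l0).
rewrite integral_semicircle_stieltjes// lM sqrtr_sqr.
have -> : (mp_lower q + y) * (mp_upper q + y) = (y + 1 - q) ^+ 2 + 4 * q * y.
  have -> : (mp_lower q + y) * (mp_upper q + y) =
    mp_lower q * mp_upper q + (mp_lower q + mp_upper q) * y + y ^+ 2 by ring.
  by rewrite lM lD; ring.
have D0 : 0 <= (y + 1 - q) ^+ 2 + 4 * q * y.
  by rewrite addr_ge0 ?sqr_ge0// !mulr_ge0// ltW.
have := sqr_sqrtr D0; move: (Num.sqrt _) => r rE.
rewrite -EFinM -EFinD; set S := (X in X%:E); exists S => //.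
have qn0 := lt0r_neq0 q0; have yn0 := lt0r_neq0 y0.
have SE : S = (r - (y + 1 - q)) / (2 * q * y).
  rewrite /S /mp_atom /stieltjes_fun normr0 add0r /c; have := lt0r_neq0 (pi_gt0 R); move: (@pi R) => c' pin0; case: ltP => q1.
    by rewrite ler0_norm; [field; rewrite ?qn0 ?yn0 ?pin0|rewrite subr_le0 ltW].
  by rewrite ger0_norm; [field; rewrite ?qn0 ?yn0 ?pin0|rewrite subr_ge0].
have -> : q * y * S ^+ 2 + (y + 1 - q) * S = (r ^+ 2 - (y + 1 - q) ^+ 2) / (4 * q * y).
  by rewrite SE; field; rewrite ?qn0 ?yn0.
by rewrite rE; field; rewrite ?qn0 ?yn0.
Qed.

Lemma marchenko_pastur_affine_setT q a b :
  marchenko_pastur_affine q a b [set: measurableTypeR R] = 1%E.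
Proof. by rewrite /marchenko_pastur_affine /pushforward preimage_setT marchenko_pastur_setT. Qed.

HB.instance Definition _ q a b := Measure_isProbability.Build _ _ _
  (@marchenko_pastur_affine R q a b) (marchenko_pastur_affine_setT q a b).

Lemma marchenko_pastur_affine_support q a b : 0 <= q -> 0 <= a -> 0 <= b ->
  marchenko_pastur_affine q a b (~` `[0, a * mp_upper q + b]) = 0%E.
Proof.
move=> q0 a0 b0; rewrite /marchenko_pastur_affine /pushforward.
have mI : measurable (`[0, mp_upper q] : set (measurableTypeR R)) by exact: measurable_itv.
apply: (subset_measure0 _ _ _ (marchenko_pastur_support q0)).
- rewrite -[X in measurable X]setTI; apply: measurable_affine_map => //.
  by apply: measurableC; exact: measurable_itv.
- exact: measurableC.
move=> x /= h hx; apply: h; move: hx; rewrite !in_itv/= /affine_map => /andP[x0 xu].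
by rewrite addr_ge0 ?mulr_ge0//= lerD2r ler_wpM2l.
Qed.

(** For [a > 0] the transform at [x] is [1 / a] times that of the unscaled law at [y / a]. Clearing
    denominators gives an equation that remains valid for [a = 0], where the law is a point mass at
    [b]. *)
Lemma marchenko_pastur_affine_stieltjes q a b x : 0 <= q -> 0 <= a -> 0 <= b -> 0 < x ->
  let S := EE (@marchenko_pastur_affine R q a b) (stieltjes_fun x) in let y := x + b in
  0 < S /\ a * q * y * S ^+ 2 + (y + a * (1 - q)) * S = 1.
Proof.
move=> q0 a0 b0 x0 S y; have y0 : 0 < y by rewrite ltr_wpDr.
pose g (t : R) := (a * `|t| + y)^-1.
have mg : measurable_fun [set: R] g.
  have mn : measurable_fun [set: R] (fun t : R => `|t|) by exact: normr_measurable.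
  by apply: measurable_funV; apply: measurable_funD => //; exact: measurable_funM.
have SE : S = fine (\int[marchenko_pastur q]_t (g t)%:E)%E.
  rewrite /S /EE /Rintegral; congr fine.
  rewrite (@ge0_integral_pushforward _ _ _ _ _ _ (measurable_affine_map a b) (marchenko_pastur q))//;
    last 2 first.
  - by apply/measurable_EFinP; exact: (measurable_stieltjes x0).
  - by move=> t _; rewrite lee_fin; have /andP[/ltW] := stieltjes_fun_bounds t x0.
  rewrite preimage_setT; apply: ae_eq_integral => //.
  - apply/measurable_EFinP; apply: measurableT_comp; last exact: measurable_affine_map.
    exact: measurable_stieltjes.
  - exact/measurable_EFinP.
  exists (~` `[0, mp_upper q]); split.
  - by apply: measurableC; exact: measurable_itv.
  - exact: marchenko_pastur_support.
  move=> t /= nt; rewrite /= in_itv/= => /andP[t0 _]; apply: nt => _.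
  rewrite /= /g /stieltjes_fun /affine_map (ger0_norm t0) ger0_norm; last by rewrite addr_ge0 ?mulr_ge0.
  by congr (_^-1)%:E; rewrite /y; ring.
move: a0; rewrite le_eqVlt => /predU1P[a0|a0].
  have -> : S = y^-1.
    rewrite SE /g -a0 (_ : \int[_]_t _ = \int[marchenko_pastur q]_t (y^-1)%:E)%E; last first.
      by apply: eq_integral => t _; rewrite mul0r add0r.
    by rewrite integral_cst//= marchenko_pastur_setT mule1.
  by rewrite invr_gt0 -a0; split => //; field; exact: lt0r_neq0.
have yn0 := lt0r_neq0 y0; have an0 := lt0r_neq0 a0.
have ya0 : 0 < y / a by rewrite divr_gt0.
have [T TE [T0 Teq]] := marchenko_pastur_stieltjes q0 ya0.
have {}SE : S = a^-1 * T.
  rewrite SE (_ : \int[_]_t _ = (a^-1)%:E * T%:E)%E//.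
  rewrite -TE -ge0_integralZl//; last 3 first.
  - by apply/measurable_EFinP; exact: (measurable_stieltjes ya0).
  - by move=> t _; rewrite lee_fin; have /andP[/ltW] := stieltjes_fun_bounds t ya0.
  - by rewrite lee_fin invr_ge0 ltW.
  apply: eq_integral => t _; rewrite /g /stieltjes_fun -EFinM -invfM; congr (_^-1)%:E.
  by field.
rewrite SE; split; first by rewrite mulr_gt0// invr_gt0.
by rewrite -[RHS]Teq; field.
Qed.

End marchenko_pastur_integral.

(** * Limits *)

Lemma EE_sqr_triangle {dT} {T : measurableType dT} {R : realType} (P : probability T R)
    (f g F : T -> R) (c C : R) :
  measurable_fun [set: T] f -> measurable_fun [set: T] g ->
  (forall z, `|f z| <= C) -> (forall z, `|g z| <= C) -> itg P F ->
  (forall z, (f z - g z) ^+ 2 <= F z) ->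
  EE P (fun z => (f z - c) ^+ 2) <= 2 * EE P F + 2 * EE P (fun z => (g z - c) ^+ 2).
Proof.
move=> mf mg fC gC iF fgF.
have isq (h : T -> R) : measurable_fun [set: T] h -> (forall z, `|h z| <= C) ->
    itg P (fun z => (h z - c) ^+ 2).
  move=> mh hC; apply: mom1_sqr; apply: momB; last exact: mom_cst.
  exact: mom_bounded mh hC.
have ig := isq _ mg gC.
rewrite -(EEZ _ _ (itg_mfun iF)) -(EEZ _ _ (itg_mfun ig)) -EED; [|exact: itgZ..].
apply: EE_le => [||z]; first exact: isq; first by apply: itgD; exact: itgZ.
have := fgF z; set u := f z; set v := g z => uv.
have := sqr_ge0 ((u - v) - (v - c)); nra.
Qed.

Section limits.
Context {R : realType} (dS : nat -> measure_display) (S : forall n, measurableType (dS n)).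
Variables (m : forall n, probability (S n) R) (N p : nat -> nat).
Variable mu : forall n, probability ((N n).-tuple (S n)) R.
Hypothesis hmu : forall n, iid_map (m n) (mu n) id.
Variable idx : forall n, 'I_n -> 'I_(p n) -> 'I_(N n).
Hypothesis idx_inj : forall n i k i' k', @idx n i k = @idx n i' k' -> i = i' /\ k = k'.
Variables (d : nat) (nu : forall n, probability (d.-tuple (S n)) R).
Hypothesis hnu : forall n, iid_map (m n) (nu n) id.
Hypothesis d2 : (2 <= d)%N.
Variable phi : forall n, d.-tuple (S n) -> R.
Hypothesis mphi : forall n, measurable_fun [set: d.-tuple (S n)] (@phi n).
Hypothesis aphi : forall n, antisymmetric_fun (@phi n).
Hypothesis phi8 : forall n, mom (nu n) 3 (@phi n).
Hypothesis p0 : forall n, (0 < p n)%N.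
Local Notation a n := (d%:R * s2 (m n) (nu n) (@phi n)).
Local Notation b n := (b2 (nu n) (@phi n)).
Variables (al be q K : R).
Hypothesis hp : (p n)%:R / n%:R @[n --> \oo] --> q.
Hypothesis ha : a n @[n --> \oo] --> al.
Hypothesis hb : b n @[n --> \oo] --> be.
Hypothesis hh4 : forall n, h4 (nu n) (@phi n) <= K.
Hypothesis hg4 : forall n, gg4 (m n) (nu n) (@phi n) <= K.
Hypothesis be0 : 0 < be.

(** One sequence dominating [1 / n] and the three convergence rates of the hypotheses, so that
    errors can be compared with constant multiples of it. *)
Let V n : R := n%:R^-1 + (`|a n - al| + (`|b n - be| + `|q - (p n)%:R / n%:R|)).

Let V0 n : 0 <= V n. Proof. by rewrite !addr_ge0. Qed.

Let VE n : [/\ n%:R^-1 <= V n, `|a n - al| <= V n, `|b n - be| <= V n & `|q - (p n)%:R / n%:R| <= V n].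
Proof.
have h1 : 0 <= n%:R^-1 :> R by rewrite invr_ge0.
have h2 := normr_ge0 (a n - al); have h3 := normr_ge0 (b n - be).
have h4' := normr_ge0 (q - (p n)%:R / n%:R).
by rewrite /V; split; lra.
Qed.

Let to0_V : to0 V.
Proof.
apply: to0D.
  move=> e e0; near=> n.
  have n0 : 0 < n%:R :> R by rewrite ltr0n; near: n; exact: nbhs_infty_gt.
  rewrite -[e]invrK lef_pV2 ?posrE ?invr_gt0//; near: n; exact: nbhs_infty_ger.
have h (u : nat -> R) l : u n @[n --> \oo] --> l -> to0 (fun n => `|u n - l|).
  by move=> /cvgrPdist_le ul e /ul; apply: filterS => n; rewrite distrC.
apply: to0D; first exact: h.
apply: to0D; first exact: h.
by move=> e e0; apply: filterS (h _ _ hp e e0) => n; rewrite distrC.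
Unshelve. all: by end_near. Qed.

Let al0 : 0 <= al.
Proof. by apply: (cvgr_to_ge ha); apply: nearW => n; rewrite mulr_ge0 ?ler0n ?s2_ge0. Qed.

Definition dominated (u : nat -> R) :=
  exists2 C, 0 <= C & \forall n \near \oo, u n <= C * V n.

Lemma dominated_to0 u : dominated u -> to0 u.
Proof. by move=> [C C0 h]; apply: to0_le h (to0Z C0 to0_V). Qed.

Lemma dominatedD u v : dominated u -> dominated v -> dominated (fun n => u n + v n).
Proof.
move=> [C C0 hu] [D D0 hv]; exists (C + D); first exact: addr_ge0.
by apply: filterS2 hu hv => n; rewrite mulrDl; exact: lerD.
Qed.

Lemma dominatedZ c u : 0 <= c -> dominated u -> dominated (fun n => c * u n).
Proof.
move=> c0 [C C0 hu]; exists (c * C); first exact: mulr_ge0.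
by apply: filterS hu => n h; rewrite -mulrA ler_wpM2l.
Qed.

Lemma near_good : \forall n \near \oo, (d <= n)%N /\ V n <= 1.
Proof. by apply: filterS2 (nbhs_infty_ge d) (to0_V ltr01) => n. Qed.

Let domin_of u C : 0 <= C -> (forall n, (d <= n)%N -> (2 <= n)%N -> V n <= 1 ->
  [/\ a n <= al + 1, b n <= be + 1, (p n)%:R / n%:R <= q + 1, 0 <= a n & 0 <= b n] ->
  u n <= C * V n) -> dominated u.
Proof.
move=> C0 h; exists C => //; apply: filterS near_good => n [dn v1].
apply: h => //; first exact: leq_trans dn.
have [_ ] := VE n; rewrite !ler_norml => /andP[_ h1] /andP[_ h2] /andP[h3 _].
split; try lra.
  by rewrite mulr_ge0 ?ler0n ?s2_ge0.
exact: b2_ge0.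
Qed.

Let q0 : 0 <= q.
Proof. by apply: (cvgr_to_ge hp); apply: nearW => n; rewrite divr_ge0. Qed.

Let albe : al <= be.
Proof.
apply: (ler_cvg_to ha hb); apply: filterS (nbhs_infty_ge d) => n dn.
exact: (bessel (hmu n) (@idx_inj n) (hnu n) d2 (@mphi n) (@aphi n) (phi8 n) (Ordinal (p0 n)) dn).
Qed.

Let q1 : 0 <= q + 1. Proof. by rewrite addr_ge0. Qed.
Let be1 : 0 <= be + 1. Proof. by rewrite addr_ge0 ?ltW. Qed.
Let al1 : 0 <= al + 1. Proof. by rewrite addr_ge0. Qed.

Let K0 : 0 <= K.
Proof. exact: le_trans (h4_ge0 _ _) (hh4 0). Qed.

Let offE n := EE (mu n) (fun z => off_err (Amx (@idx n) (@phi n) z) (Lmx (@idx n) (nu n) (@phi n) z)).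
Let offlE n := EE (mu n) (fun z => off_lin (Lmx (@idx n) (nu n) (@phi n) z)).
Let dg4E n := EE (mu n) (fun z => diag4_err (Amx (@idx n) (@phi n) z) (b n)).
Let dglE n := EE (mu n) (fun z => diag_lin_err (Lmx (@idx n) (nu n) (@phi n) z) (a n)).

Lemma dominated_off : dominated offE.
Proof.
pose D : R := (d%:R * (d%:R - 1)) ^+ 2.
apply: (domin_of (C := 2 * (q + 1) * (be + 1) ^+ 2 * D)).
  exact: mulr_ge0 (mulr_ge0 (mulr_ge0 (ler0n R 2) q1) (sqr_ge0 _)) (sqr_ge0 _).
move=> n dn n2 v1 [ha1 hb1 hq1 a0 b0].
have [_ hE] := EE_off_err (hmu n) (@idx_inj n) (hnu n) d2 (@mphi n) (@aphi n) (phi8 n) dn (p0 n).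
apply: le_trans hE _; rewrite -/D.
have nr : 2 <= n%:R :> R by rewrite (ler_nat R 2).
have [hi _ _ _] := VE n.
have -> : (p n)%:R * (b n ^+ 2 * (D / (n%:R * (n%:R - 1)))) =
   (p n)%:R / n%:R * (b n ^+ 2) * D * (n%:R - 1)^-1.
  by field; apply/andP; split; apply: lt0r_neq0; lra.
have h1 : (n%:R - 1)^-1 <= 2 * V n.
  apply: (@le_trans _ _ (2 * n%:R^-1)); last by rewrite ler_wpM2l.
  rewrite -[leLHS]mul1r ler_pdivrMr; last by lra.
  have nn : n%:R^-1 * n%:R = 1 :> R by rewrite mulVf// lt0r_neq0//; lra.
  have ni : 0 <= n%:R^-1 :> R by rewrite invr_ge0.
  nra.
have h2 : (p n)%:R / n%:R * b n ^+ 2 * D <= (q + 1) * (be + 1) ^+ 2 * D.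
  apply: ler_wpM2r; first exact: sqr_ge0.
  apply: ler_pM; [by rewrite divr_ge0|exact: sqr_ge0|exact: hq1|].
  by rewrite lerXn2r ?nnegrE.
apply: (@le_trans _ _ ((q + 1) * (be + 1) ^+ 2 * D * (2 * V n))); last by rewrite le_eqVlt; apply/orP; left; apply/eqP; ring.
apply: ler_pM => //.
  by apply: mulr_ge0 (sqr_ge0 _); apply: mulr_ge0 (sqr_ge0 _); rewrite divr_ge0.
by rewrite invr_ge0; lra.
Qed.

Lemma dominated_diag4 : dominated (fun n => (p n)%:R * dg4E n).
Proof.
pose D : R := 9 * K * d%:R ^+ 4.
have D0 : 0 <= D by rewrite !mulr_ge0 ?exprn_ge0.
apply: (domin_of (C := (q + 1) * D)); first by rewrite mulr_ge0.
move=> n dn n2 v1 [ha1 hb1 hq1 a0 b0].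
have [_ hE] := EE_diag4_err (hmu n) (@idx_inj n) (hnu n) d2 (@mphi n) (phi8 n) dn (p0 n).
have nr : 2 <= n%:R :> R by rewrite (ler_nat R 2).
have [hi _ _ _] := VE n; have n0 : 0 < n%:R :> R by lra.
have hD : 9 * h4 (nu n) (@phi n) * d%:R ^+ 4 <= D.
  by apply: ler_wpM2r; [exact: exprn_ge0|rewrite ler_wpM2l].
apply: le_trans (ler_wpM2l (ler0n _ _) hE) _.
have -> : forall x : R, (p n)%:R * (x / n%:R ^+ 2) = (p n)%:R / n%:R * x * n%:R^-1.
  by move=> x; field; exact: lt0r_neq0.
apply: ler_pM => //; last apply: ler_pM => //.
- by rewrite !mulr_ge0 ?h4_ge0 ?exprn_ge0 ?invr_ge0.
- by rewrite !mulr_ge0 ?h4_ge0 ?exprn_ge0.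
Qed.

Lemma dominated_ndiag4 : dominated (fun n => n%:R * dg4E n).
Proof.
pose D : R := 9 * K * d%:R ^+ 4.
have D0 : 0 <= D by rewrite !mulr_ge0 ?exprn_ge0.
apply: (domin_of (C := D)) => // n dn n2 v1 [ha1 hb1 hq1 a0 b0].
have [_ hE] := EE_diag4_err (hmu n) (@idx_inj n) (hnu n) d2 (@mphi n) (phi8 n) dn (p0 n).
have nr : 2 <= n%:R :> R by rewrite (ler_nat R 2).
have [hi _ _ _] := VE n; have n0 : 0 < n%:R :> R by lra.
have hD : 9 * h4 (nu n) (@phi n) * d%:R ^+ 4 <= D.
  by apply: ler_wpM2r; [exact: exprn_ge0|rewrite ler_wpM2l].
apply: le_trans (ler_wpM2l (ler0n _ _) hE) _.
have -> : forall x : R, n%:R * (x / n%:R ^+ 2) = x * n%:R^-1.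
  by move=> x; field; exact: lt0r_neq0.
apply: ler_pM => //.
by rewrite !mulr_ge0 ?h4_ge0 ?exprn_ge0 ?invr_ge0.
Qed.

Lemma dominated_diag_lin : dominated dglE.
Proof.
pose D : R := 4 * d%:R ^+ 2 * K.
have D0 : 0 <= D by rewrite !mulr_ge0 ?exprn_ge0.
apply: (domin_of (C := D)) => // n dn n2 v1 [ha1 hb1 hq1 a0 b0].
have [_ hE] := EE_diag_lin_err (hmu n) (@idx_inj n) (hnu n) d2 (@mphi n) (@aphi n) (phi8 n) dn (p0 n).
apply: le_trans hE _; have [hi _ _ _] := VE n.
have c0 : 0 <= 4 * d%:R ^+ 2 :> R by rewrite mulr_ge0 ?exprn_ge0.
have g0 : 0 <= gg4 (m n) (nu n) (@phi n) by apply: EE_ge0 => ?; rewrite (exprM _ 2 2) sqr_ge0.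
apply: ler_pM => //; first exact: mulr_ge0.
exact: ler_wpM2l.
Qed.

(** This mass need not vanish: about [p ^ 2] entries may have mean square of order [1 / n].
    Boundedness is enough because it gets multiplied by [eps ^+ 2]. *)
Lemma bounded_off_lin : \forall n \near \oo, offlE n <= (q + 1) * (al + 1) ^+ 2.
Proof.
apply: filterS near_good => n [dn v1].
have [_ hE] := EE_off_lin (hmu n) (@idx_inj n) (hnu n) d2 (@mphi n) (@aphi n) (phi8 n) dn (p0 n).
apply: le_trans hE _; have [_ ] := VE n; rewrite !ler_norml => /andP[_ h1] _ /andP[h3 _].
have n0 : 0 < n%:R :> R by rewrite ltr0n; apply: leq_trans dn; exact: leq_trans d2.
rewrite mulrCA mulrC; apply: ler_pM.
- by rewrite divr_ge0.
- exact: sqr_ge0.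
- lra.
- by rewrite lerXn2r ?nnegrE ?mulr_ge0 ?ler0n ?s2_ge0//; lra.
Qed.

Lemma dominated_sqr (u : nat -> R) c : 0 <= c -> (forall n, 0 <= u n <= c * V n) ->
  dominated (fun n => u n ^+ 2).
Proof.
move=> c0 h; exists (c ^+ 2); first exact: sqr_ge0.
apply: filterS near_good => n [_ v1]; have /andP[u0 uV] := h n.
apply: (@le_trans _ _ ((c * V n) ^+ 2)); first by rewrite lerXn2r ?nnegrE// mulr_ge0.
rewrite exprMn ler_wpM2l ?sqr_ge0// expr2 ler_piMl//.
Qed.

Lemma dominated_gram (y ms : R) : 0 < y -> 0 < ms ->
  al * q * y * ms ^+ 2 + (y + al * (1 - q)) * ms = 1 ->
  dominated (fun n => EE (mu n) (fun z => (gram_m (@idx n) (nu n) (@phi n) y z - ms) ^+ 2)).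
Proof.
move=> y0 ms0 root.
pose D1 : R := 8 * d%:R ^+ 2 * K / y ^+ 2.
pose D2 : R := 2 * ((al + 1) / y) ^+ 2.
pose D3 : R := (1 + (al + 1) / y) ^+ 2.
pose D4 : R := ((al + 1) / y) ^+ 2.
have d80 : 0 <= 8 * d%:R ^+ 2 :> R by rewrite mulr_ge0 ?exprn_ge0.
have D10 : 0 <= D1 := divr_ge0 (mulr_ge0 d80 K0) (sqr_ge0 y).
have D20 : 0 <= D2 by rewrite mulr_ge0 ?sqr_ge0.
apply: (domin_of (C := 2 * ms ^+ 2 * (D3 * (D1 + D2) + D4))).
  exact: mulr_ge0 (mulr_ge0 (ler0n R 2) (sqr_ge0 _)) (addr_ge0 (mulr_ge0 (sqr_ge0 _) (addr_ge0 D10 D20)) (sqr_ge0 _)).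
move=> n dn n2 v1 [ha1 hb1 hq1 a0 b0].
have n0 : (0 < n)%N by exact: leq_trans n2.
apply: le_trans (EE_gram_m (hmu n) (@idx_inj n) (hnu n) d2 (@mphi n) (@aphi n) (phi8 n)
  n0 (p0 n) y0 al0 q0 ms0 root) _.
rewrite -[leRHS]mulrA; apply: ler_wpM2l; first by rewrite mulr_ge0 ?sqr_ge0.
have [hi hA _ hq] := VE n.
have nr : 0 < n%:R :> R by rewrite ltr0n.
have ni0 : 0 <= n%:R^-1 :> R by rewrite invr_ge0 ltW.
rewrite [leRHS]mulrDl; apply: lerD.
  rewrite -[leRHS]mulrA; apply: ler_pM.
  - exact: sqr_ge0.
  - have g0 : 0 <= gg4 (m n) (nu n) (@phi n) by apply: EE_ge0 => ?; rewrite (exprM _ 2 2) sqr_ge0.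
    apply: addr_ge0; last by rewrite mulr_ge0 ?sqr_ge0.
    exact: divr_ge0 (mulr_ge0 d80 g0) (mulr_ge0 (ltW nr) (sqr_ge0 y)).
  - rewrite lerXn2r ?nnegrE ?addr_ge0 ?divr_ge0 ?(ltW y0)//.
    by rewrite lerD2l ler_wpM2r// invr_ge0 ltW.
  rewrite [leRHS]mulrDl; apply: lerD.
    have -> : forall x : R, x / (n%:R * y ^+ 2) = x / y ^+ 2 * n%:R^-1.
      by move=> x; field; rewrite !lt0r_neq0.
    have g0 : 0 <= gg4 (m n) (nu n) (@phi n) by apply: EE_ge0 => ?; rewrite (exprM _ 2 2) sqr_ge0.
    apply: ler_pM => //; first exact: divr_ge0 (mulr_ge0 d80 g0) (sqr_ge0 y).
    apply: ler_wpM2r; first by rewrite invr_ge0 sqr_ge0.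
    by rewrite ler_wpM2l ?mulr_ge0 ?exprn_ge0.
  rewrite /D2 -[leRHS]mulrA ler_wpM2l//.
  have -> : a n / (n%:R * y) = a n / y * n%:R^-1 by field; rewrite !lt0r_neq0.
  rewrite exprMn; apply: ler_pM; rewrite ?sqr_ge0//.
    rewrite lerXn2r ?nnegrE ?divr_ge0 ?(ltW y0)//.
    by rewrite ler_wpM2r// invr_ge0 ltW.
  apply: (@le_trans _ _ (V n ^+ 2)); first by rewrite lerXn2r ?nnegrE.
  by rewrite expr2 ler_piMl.
rewrite /D4; apply: (@le_trans _ _ (((al + 1) / y * V n) ^+ 2)).
  have w1 : 0 <= (al * `|q - (p n)%:R / n%:R| + `|al - a n|) / y.
    by rewrite divr_ge0 ?(ltW y0)// addr_ge0// mulr_ge0.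
  have w2 : 0 <= (al + 1) / y * V n by rewrite mulr_ge0// divr_ge0 ?(ltW y0).
  rewrite lerXn2r ?nnegrE// [leRHS]mulrAC; apply: ler_wpM2r; first by rewrite invr_ge0 ltW.
  by rewrite mulrDl mul1r lerD ?ler_wpM2l// distrC.
by rewrite exprMn ler_wpM2l ?sqr_ge0// expr2 ler_piMl.
Qed.

Lemma dominated_le u v : (\forall n \near \oo, u n <= v n) -> dominated v -> dominated u.
Proof.
by move=> uv [C C0 h]; exists C => //; apply: filterS2 uv h => n; exact: le_trans.
Qed.

Lemma dominated_V u : (forall n, u n <= V n) -> dominated u.
Proof. by move=> h; exists 1 => //; apply: nearW => n; rewrite mul1r. Qed.

Let A n z := Amx (@idx n) (@phi n) z.
Let L n z := Lmx (@idx n) (nu n) (@phi n) z.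
Let pA n z : psd (@A n z). Proof. exact: psd_Amx. Qed.
Let pL n z : psd (@L n z). Proof. exact: psd_Lmx. Qed.
Let be_al : 0 <= be - al. Proof. by rewrite subr_ge0. Qed.

Let trace_bound n (M : 'M[R]_(p n)) x : psd M -> 0 < x ->
  `|\tr (resolvent M x) / (p n)%:R| <= x^-1.
Proof.
move=> pM x0; have pr : 0 < (p n)%:R :> R by rewrite ltr0n.
rewrite ger0_norm ?divr_ge0 ?tr_resolvent_ge0// ler_pdivrMr//.
by rewrite ler_pdivlMl// tr_resolvent_le.
Qed.

Lemma measurable_trace_cov n x : 0 < x ->
  measurable_fun setT (fun z => \tr (resolvent (@A n z) x)).
Proof.
move=> x0; apply: measurable_trace; apply: mx_measurable_resolvent => //.
exact: mx_measurable_Amx.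
Qed.

Lemma measurable_trace_cor n x : 0 < x ->
  measurable_fun setT (fun z => \tr (resolvent (cor_mx (@A n z)) x)).
Proof.
move=> x0; apply: measurable_trace; apply: mx_measurable_resolvent => //.
  by move=> z; exact: psd_cor.
by apply: mx_measurable_cor; exact: mx_measurable_Amx.
Qed.

(** Triangle inequality through [gram_m] at [y := x + (be - al)]: the transform of the affine law at
    [x] solves precisely the Gram equation at [y]. *)
Lemma cov_trace_limit x (ms := EE (marchenko_pastur_affine q al (be - al)) (stieltjes_fun x)) :
  0 < x -> to0 (fun n => EE (mu n) (fun z => (\tr (resolvent (@A n z) x) / (p n)%:R - ms) ^+ 2)).
Proof.
move=> x0; have [ms0 root] := marchenko_pastur_affine_stieltjes q0 al0 be_al x0.
rewrite -/ms in ms0 root; set y := x + (be - al) in root.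
have y0 : 0 < y by rewrite ltr_wpDr.
have x40 : 0 <= (x ^+ 4)^-1 by rewrite invr_ge0 exprn_ge0// ltW.
apply: dominated_to0.
pose c n := n%:R^-1 + (b n - be + (al - a n)) ^+ 2.
apply: (dominated_le (v := fun n => 2 * ((x ^+ 4)^-1 * (offE n + 3 * (n%:R * dg4E n) + 3 * dglE n + 3 * c n))
   + 2 * EE (mu n) (fun z => (gram_m (@idx n) (nu n) (@phi n) y z - ms) ^+ 2))); last first.
  apply: dominatedD; last by apply: dominatedZ => //; exact: dominated_gram.
  apply: dominatedZ => //; apply: dominatedZ => //.
  apply: dominatedD; last first.
    apply: dominatedZ => //; apply: dominatedD; first by apply: dominated_V => n; have [] := VE n.
    apply: (dominated_le (v := fun n => (`|b n - be| + `|a n - al|) ^+ 2)).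
      apply: nearW => n; rewrite -real_normK ?num_real// lerXn2r ?nnegrE ?addr_ge0//.
      by rewrite (distrC (a n)); exact: ler_normD.
    apply: (dominated_sqr (c := 2)) => // n; rewrite addr_ge0//=.
    by have [_ h1 h2 _] := VE n; lra.
  apply: dominatedD; last by apply: dominatedZ => //; exact: dominated_diag_lin.
  apply: dominatedD; last by apply: dominatedZ => //; exact: dominated_ndiag4.
  exact: dominated_off.
apply: filterS near_good => n [dn v1].
have n0 : (0 < n)%N by apply: leq_trans dn; exact: leq_trans d2.
have [i1 _] := EE_off_err (hmu n) (@idx_inj n) (hnu n) d2 (@mphi n) (@aphi n) (phi8 n) dn (p0 n).
have [i2 _] := EE_diag4_err (hmu n) (@idx_inj n) (hnu n) d2 (@mphi n) (phi8 n) dn (p0 n).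
have [i3 _] := EE_diag_lin_err (hmu n) (@idx_inj n) (hnu n) d2 (@mphi n) (@aphi n) (phi8 n) dn (p0 n).
have j12 := itgD i1 (itgZ 3 (itgZ n%:R i2)); have j123 := itgD j12 (itgZ 3 i3).
have j := itgD j123 (itg_cst (mu n) (3 * c n)).
apply: le_trans (EE_sqr_triangle (C := x^-1) (g := gram_m (@idx n) (nu n) (@phi n) y) _ _ _ _ _
   (itgZ (x ^+ 4)^-1 j) _) _.
- by apply: measurable_funM => //; exact: measurable_trace_cov.
- exact: (measurable_gram_m (hmu n) (@idx n) (hnu n) d2 (@mphi n) (phi8 n) y0).
- by move=> z; exact: trace_bound.
- move=> z; apply: le_trans (trace_bound (@pL n z) y0) _.
  by rewrite lef_pV2 ?posrE// lerDl.
- move=> z; apply: le_trans (cov_comparison (a n) (b n) (p0 n) n0 (@pA n z) (@pL n z) albe x0) _.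
  by rewrite mulrC; apply: ler_wpM2l => //; rewrite /c; lra.
rewrite lerD2r (EEZ _ _ (itg_mfun j)) (EED j123 (itg_cst _ _)) EE_cst (EED j12 (itgZ _ i3)).
rewrite (EED i1 (itgZ _ (itgZ _ i2))) (EEZ _ _ (itg_mfun i3)) (EEZ _ _ (itg_mfun (itgZ _ i2))).
by rewrite (EEZ _ _ (itg_mfun i2)).
Qed.

(** [eps] is fixed before [n] grows. One term, [M * eps ^+ 2], does not decrease with [n] and is
    made at most [e / 2] by the choice of [eps]; all the others tend to 0 for that [eps]. *)
Lemma cor_trace_limit x (t := al / be)
    (ms := EE (marchenko_pastur_affine q t (1 - t)) (stieltjes_fun x)) :
  0 < x -> to0 (fun n => EE (mu n) (fun z =>
    (\tr (resolvent (cor_mx (@A n z)) x) / (p n)%:R - ms) ^+ 2)).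
Proof.
move=> x0; have ben0 := lt0r_neq0 be0.
have t0 : 0 <= t by rewrite divr_ge0// ltW.
have t1 : 0 <= 1 - t by rewrite subr_ge0 ler_pdivrMr// mul1r.
have [ms0 root] := marchenko_pastur_affine_stieltjes q0 t0 t1 x0.
rewrite -/ms in ms0 root; pose y := be * x + (be - al).
have y0 : 0 < y by rewrite ltr_wpDr// mulr_gt0.
have ms10 : 0 < ms / be by rewrite divr_gt0.
(* Rescaling by [be] turns the equation at [x] with parameter [t] into the Gram equation at [y] with
   parameter [al] and solution [ms / be]. *)
have root1 : al * q * y * (ms / be) ^+ 2 + (y + al * (1 - q)) * (ms / be) = 1.
  by rewrite -[RHS]root /y /t; field.
have x40 : 0 <= (x ^+ 4)^-1 by rewrite invr_ge0 exprn_ge0// ltW.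
have x20 : 0 <= (x ^+ 2)^-1 by rewrite invr_ge0 exprn_ge0// ltW.
have be20 : 0 <= 2 / be ^+ 2 by rewrite divr_ge0 ?sqr_ge0.
(* The 64 is [4 * 4 ^ 2], from [4 * (4 * eps / be ^+ 2) ^+ 2] in [cor_comparison]; the last factor
   is the bound of [bounded_off_lin]. *)
pose M : R := 2 * ((x ^+ 4)^-1 * (64 / be ^+ 4 * ((q + 1) * (al + 1) ^+ 2))).
have M0 : 0 <= M.
  by rewrite mulr_ge0// mulr_ge0// mulr_ge0 ?divr_ge0 ?exprn_ge0 ?(ltW be0)// mulr_ge0 ?sqr_ge0.
move=> e e0; pose eps := Num.min (be / 4) (Num.min 1 (e / (2 * (M + 1)))).
have M1 : 0 < M + 1 by lra.
have eps0 : 0 < eps by rewrite !lt_min ltr01 !divr_gt0// mulr_gt0.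
have eps1 : eps <= be / 4 by rewrite ge_min lexx.
have eps2 : eps <= 1 by rewrite !ge_min lexx orbT.
have eps3 : M * eps ^+ 2 <= e / 2.
  apply: (@le_trans _ _ ((M + 1) * eps)).
    by rewrite expr2; apply: ler_pM => //; [rewrite mulr_ge0 ?ltW|lra|rewrite ler_piMl// ltW].
  rewrite mulrC -ler_pdivlMr//; have : eps <= e / (2 * (M + 1)) by rewrite !ge_min lexx !orbT.
  by rewrite invfM mulrA.
pose k1 : R := 64 * eps ^+ 2 / be ^+ 4.
have k10 : 0 <= k1 by rewrite divr_ge0 ?mulr_ge0 ?exprn_ge0 ?ltW.
have e40 : 0 <= (eps ^+ 4)^-1 by rewrite invr_ge0 exprn_ge0// ltW.
pose c n := 2 * ((al - a n) / be) ^+ 2.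
pose v n := 2 * ((x ^+ 2)^-1 * ((eps ^+ 4)^-1 * ((p n)%:R * dg4E n))
   + (x ^+ 4)^-1 * (k1 * offE n + 2 / be ^+ 2 * offE n + 2 / be ^+ 2 * dglE n + c n))
   + 2 * (be ^+ 2 * EE (mu n) (fun z => (gram_m (@idx n) (nu n) (@phi n) y z - ms / be) ^+ 2)).
have v_dom : dominated v.
  apply: dominatedD; last first.
    apply: dominatedZ => //; apply: dominatedZ; first exact: sqr_ge0.
    exact: dominated_gram.
  apply: dominatedZ => //; apply: dominatedD.
    by apply: dominatedZ => //; apply: dominatedZ => //; exact: dominated_diag4.
  apply: dominatedZ => //; apply: dominatedD; last first.
    apply: dominatedZ => //.
    apply: (dominated_le (v := fun n => (`|al - a n| / be) ^+ 2)).
      apply: nearW => n; rewrite -real_normK ?num_real// normrM normfV (gtr0_norm be0).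
      exact: lexx.
    apply: (dominated_sqr (c := be^-1)) => [|n]; first by rewrite invr_ge0 ltW.
    rewrite divr_ge0 ?(ltW be0)//= mulrC ler_wpM2l ?invr_ge0 ?(ltW be0)// distrC.
    by have [] := VE n.
  apply: dominatedD; last by apply: dominatedZ => //; exact: dominated_diag_lin.
  apply: dominatedD; apply: dominatedZ => //; exact: dominated_off.
have bnd : \forall n \near \oo, EE (mu n) (fun z =>
    (\tr (resolvent (cor_mx (@A n z)) x) / (p n)%:R - ms) ^+ 2) <= M * eps ^+ 2 + v n.
  have /cvgrPdist_le/(_ _ eps0) hbe := hb.
  apply: filterS3 near_good hbe bounded_off_lin => n [dn v1] bbe offlB.
  have n0 : (0 < n)%N by apply: leq_trans dn; exact: leq_trans d2.
  have [i1 _] := EE_off_err (hmu n) (@idx_inj n) (hnu n) d2 (@mphi n) (@aphi n) (phi8 n) dn (p0 n).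
  have [i2 _] := EE_diag4_err (hmu n) (@idx_inj n) (hnu n) d2 (@mphi n) (phi8 n) dn (p0 n).
  have [i3 _] := EE_diag_lin_err (hmu n) (@idx_inj n) (hnu n) d2 (@mphi n) (@aphi n) (phi8 n) dn (p0 n).
  have [i4 _] := EE_off_lin (hmu n) (@idx_inj n) (hnu n) d2 (@mphi n) (@aphi n) (phi8 n) dn (p0 n).
  have j4 := itgZ (x ^+ 2)^-1 (itgZ (eps ^+ 4)^-1 (itgZ (p n)%:R i2)).
  have j1 := itgZ k1 (itgD i4 i1); have j2 := itgD j1 (itgZ (2 / be ^+ 2) i1).
  have j3 := itgD j2 (itgZ (2 / be ^+ 2) i3).
  have j5 := itgD j3 (itg_cst (mu n) (c n)); have j6 := itgZ (x ^+ 4)^-1 j5.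
  have mg := measurable_gram_m (hmu n) (@idx n) (hnu n) d2 (@mphi n) (phi8 n) y0.
  have gb z : `|gram_m (@idx n) (nu n) (@phi n) y z| <= y^-1 := trace_bound (@pL n z) y0.
  apply: le_trans (EE_sqr_triangle (C := x^-1)
     (g := fun z => be * gram_m (@idx n) (nu n) (@phi n) y z) _ _ _ _ _ (itgD j4 j6) _) _.
  - by apply: measurable_funM => //; exact: measurable_trace_cor.
  - exact: measurable_funM.
  - by move=> z; apply: trace_bound => //; exact: psd_cor.
  - move=> z; rewrite normrM (gtr0_norm be0); apply: le_trans (ler_wpM2l (ltW be0) (gb z)) _.
    rewrite ler_pdivrMr// ler_pdivlMl// /y mulrC lerDl//.
  - move=> z; have := cor_comparison (a n) (p0 n) (@pA n z) (@pL n z) albe x0 eps0 eps1.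
    move=> /(_ (b n)); rewrite distrC => /(_ bbe) h; apply: le_trans h _.
    have -> : 4 * (4 * eps / be ^+ 2) ^+ 2 = k1 by rewrite /k1; field.
    rewrite [_ / x ^+ 2]mulrC [_ / eps ^+ 4]mulrC [_ / x ^+ 4]mulrC.
    by rewrite lexx.
  have mE : EE (mu n) (fun z => (be * gram_m (@idx n) (nu n) (@phi n) y z - ms) ^+ 2) =
      be ^+ 2 * EE (mu n) (fun z => (gram_m (@idx n) (nu n) (@phi n) y z - ms / be) ^+ 2).
    rewrite -EEZ; last by apply: measurable_funX; exact: measurable_funB.
    by congr EE; apply/funext => z; field.
  rewrite mE (EED j4 j6) (EEZ _ _ (itg_mfun j5)) (EED j3 (itg_cst _ _)) EE_cst.
  rewrite (EED j2 (itgZ _ i3)) (EED j1 (itgZ _ i1)) (EEZ _ _ (itg_mfun i3)) (EEZ _ _ (itg_mfun i1)).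
  rewrite (EEZ _ _ (itg_mfun (itgD i4 i1))) (EED i4 i1).
  rewrite (EEZ _ _ (itg_mfun (itgZ _ (itgZ _ i2)))) (EEZ _ _ (itg_mfun (itgZ _ i2))) (EEZ _ _ (itg_mfun i2)).
  rewrite -/(offE n) -/(dg4E n) -/(dglE n) -/(offlE n) /v.
  have : 2 * ((x ^+ 4)^-1 * (k1 * offlE n)) <= M * eps ^+ 2.
    have -> : M * eps ^+ 2 = 2 * ((x ^+ 4)^-1 * (k1 * ((q + 1) * (al + 1) ^+ 2))).
      by rewrite /M /k1; ring.
    by apply: ler_wpM2l => //; apply: ler_wpM2l => //; exact: ler_wpM2l.
  lra.
have e20 : 0 < e / 2 by rewrite divr_gt0.
apply: filterS2 bnd (dominated_to0 v_dom e20) => n h1 h2; lra.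
Qed.

(** Once [b n >= be / 2], a vanishing diagonal entry is off by more than [be / 4], and [diag4_event]
    applies. *)
Lemma cvg_zero_diag :
  mu n [set z | exists k, @A n z k k = 0] @[n --> \oo] --> 0%E.
Proof.
pose eps := be / 4; have eps0 : 0 < eps by rewrite divr_gt0.
have e40 : 0 <= (eps ^+ 4)^-1 by rewrite invr_ge0 exprn_ge0// ltW.
apply: cvge0_near => [n|e e0]; first exact: measure_ge0.
have dom : to0 (fun n => 2 * ((eps ^+ 4)^-1 * ((p n)%:R * dg4E n))).
  apply: dominated_to0; apply: dominatedZ => //; apply: dominatedZ => //.
  exact: dominated_diag4.
have be20 : 0 < be / 2 by rewrite divr_gt0.
have /cvgrPdist_le/(_ _ be20) hbe := hb.
apply: filterS3 near_good hbe (dom e e0) => n [dn v1] bbe hn.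
have [i2 _] := EE_diag4_err (hmu n) (@idx_inj n) (hnu n) d2 (@mphi n) (phi8 n) dn (p0 n).
pose F z := (eps ^+ 4)^-1 * ((p n)%:R * diag4_err (@A n z) (b n)).
have iF : itg (mu n) F by apply: itgZ; exact: itgZ.
have F0 z : 0 <= F z.
  rewrite mulr_ge0// mulr_ge0// mulr_ge0 ?invr_ge0//; apply: sumr_ge0 => k _.
  by rewrite (exprM _ 2 2) sqr_ge0.
have h2 : 0 < 2^-1 :> R by rewrite invr_gt0.
(* [EE_markov] concerns a strict inequality while [F] is only known to be at least 1 on the event;
   the threshold 1/2 explains the factor 2 in [dom]. *)
apply: (@le_trans _ _ (mu n [set z | 2^-1 < F z])); last first.
  apply: le_trans (EE_markov iF F0 h2) _; rewrite lee_fin invrK.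
  by rewrite (EEZ _ _ (itg_mfun (itgZ _ i2))) (EEZ _ _ (itg_mfun i2)).
apply: le_measure; rewrite ?inE.
- rewrite (_ : [set z | _] = \big[setU/set0]_(k < p n) ((fun z => @A n z k k) @^-1` [set 0])).
    apply: bigsetU_measurable => k _; rewrite -[X in measurable X]setTI.
    by apply: (mx_measurable_Amx (@idx n) (@mphi n) k k) => //; exact: measurable_set1.
  apply/seteqP; split => [z [k Ak]|z]; rewrite -bigcup_seq => /=; first by exists k => //=; rewrite mem_index_enum.
  by move=> [k _ Ak]; exists k.
- rewrite -[X in measurable X]setTI; have := itg_mfun iF measurableT (measurable_itv (`]2^-1, +oo[ : interval R)).
  rewrite (_ : F @^-1` _ = [set z | 2^-1 < F z])//.
  by apply/seteqP; split => z; rewrite /= in_itv/= andbT.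
move=> z [k Ak]; rewrite /=.
have : eps < `|@A n z k k - b n|.
  rewrite Ak sub0r normrN; move: bbe; rewrite ler_norml => /andP[b1 b2'].
  by apply: lt_le_trans (ler_norm _); rewrite /eps; lra.
move=> /(diag4_event (p0 n) eps0); rewrite /F mulrC => h.
by apply: lt_le_trans h; lra.
Qed.

Theorem weak_cvg_cov :
  weak_cvg_in_probability mu (fun n z => esd (@A n z)) (marchenko_pastur_affine q al (be - al)).
Proof.
apply: (weak_cvg_resolvent (nu := marchenko_pastur_affine q al (be - al)) p0 pA
   (top := al * mp_upper q + (be - al))).
- by rewrite addr_ge0// mulr_ge0// sqr_ge0.
- exact: marchenko_pastur_affine_support.
- by move=> x x0; split; [move=> n; exact: measurable_trace_cov|exact: cov_trace_limit].
Qed.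

Theorem weak_cvg_cor :
  weak_cvg_in_probability mu (fun n z => esd (cor_mx (@A n z)))
    (marchenko_pastur_affine q (al / be) (1 - al / be)).
Proof.
have t0 : 0 <= al / be by rewrite divr_ge0// ltW.
have t1 : 0 <= 1 - al / be by rewrite subr_ge0 ler_pdivrMr// mul1r.
apply: (weak_cvg_resolvent (nu := marchenko_pastur_affine q (al / be) (1 - al / be)) p0
   (fun n z => psd_cor (pA z)) (top := al / be * mp_upper q + (1 - al / be))).
- by rewrite addr_ge0// mulr_ge0// sqr_ge0.
- exact: marchenko_pastur_affine_support.
- by move=> x x0; split; [move=> n; exact: measurable_trace_cor|exact: cor_trace_limit].
Qed.

End limits.

(** * Transfer to canonical tuple spaces *)

Section iid_families.
Context {R : realType} {dO dS : measure_display}.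
Context {Omega : measurableType dO} {S : measurableType dS}.
Variables (P : probability Omega R) (I : finType) (X : I -> {RV P >-> S}).
Variable m : probability S R.
Hypothesis X_indep : mutually_independent X.
Hypothesis X_law : forall i A, measurable A -> distribution P (X i) A = m A.
Variables (N : nat) (f : 'I_N -> I) (g : I -> 'I_N).
Hypotheses (fK : cancel f g) (gK : cancel g f).

Definition family_tuple (w : Omega) : N.-tuple S := [tuple X (f j) w | j < N].

Lemma measurable_family_tuple : measurable_fun [set: Omega] family_tuple.
Proof.
apply/measurable_fun_tnthP => j.
rewrite (_ : _ \o _ = X (f j)); first exact: measurable_funP.
by apply/funext => w; rewrite /= tnth_mktuple.
Qed.

HB.instance Definition _ := isMeasurableFun.Build _ _ _ _ family_tuple
  measurable_family_tuple.

Lemma iid_map_family : iid_map m (distribution P family_tuple) id.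
Proof.
split=> [|A mA]; first exact: measurable_id.
have := X_indep [set: I]%SET (A := fun i => A (g i)) (fun i => mA (g i)).
rewrite (_ : \bigcap_(i in _) _ = family_tuple @^-1` box A); last first.
  apply/seteqP; split => [w h j|w h i _].
    by have := h (f j); rewrite /= finset.in_setT fK tnth_mktuple; apply.
  by have := h (g i); rewrite tnth_mktuple gK.
move=> E; rewrite [LHS]E (eq_bigl xpredT); last by move=> i; rewrite finset.in_setT.
rewrite (reindex f) /=; last by apply: onW_bij; exists g.
by apply: eq_bigr => j _; rewrite fK -(X_law (f j)).
Qed.

End iid_families.

Lemma weak_cvg_distribution {R : realType} {dO dT : nat -> measure_display}
    {Omega : forall n, measurableType (dO n)} {T : forall n, measurableType (dT n)}
    (P : forall n, probability (Omega n) R) (h : forall n, {mfun Omega n >-> T n})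
    (M : forall n, T n -> {measure set (measurableTypeR R) -> \bar R})
    (M' : forall n, Omega n -> {measure set (measurableTypeR R) -> \bar R})
    (nu : {measure set (measurableTypeR R) -> \bar R}) :
  weak_cvg_in_probability (fun n => distribution (P n) (h n)) M nu ->
  (forall n w, M' n w = M n (h n w)) -> weak_cvg_in_probability P M' nu.
Proof.
move=> H E f cf bf e e0; have := H f cf bf e e0; set u := (X in X @ _ --> _ -> _).
set v := (X in _ -> X @ _ --> _); suff -> : v = u by [].
apply/funext => n; congr (P n _); apply/seteqP.
by split => w /=; rewrite E.
Qed.

Theorem theorem2p1 (R : realType) (d : nat) (d_ge2 : (2 <= d)%N)
    (p : nat -> nat) (p_gt0 : forall n, (0 < p n)%N)
    (* the spaces S_n and the array X, for each n *)
    (dS : nat -> measure_display) (S : forall n, measurableType (dS n))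
    (dO : nat -> measure_display) (Omega : forall n, measurableType (dO n))
    (P : forall n, probability (Omega n) R)
    (X : forall n, 'I_n -> 'I_(p n) -> {RV (P n) >-> (S n)})
    (X_iid : forall n,
       iid (fun ik : 'I_n * 'I_(p n) => X n ik.1 ik.2))
    (phi : forall n, {mfun (d.-tuple (S n)) >-> R})
    (phi_anti : forall n, antisymmetric_fun (phi n))
    (* the independent copies of X_1(1) *)
    (dO' : nat -> measure_display) (Omega' : forall n, measurableType (dO' n))
    (P' : forall n, probability (Omega' n) R)
    (Y : forall n, 'I_d -> {RV (P' n) >-> (S n)})
    (Y_iid : forall n, iid (Y n))
    (Y_copy : forall n j i k, equal_in_law (Y n j) (X n i k))
    (q alpha beta : R) :
  (p n)%:R / n%:R @[n --> \oo] --> q ->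
  (exists C : R, forall n,
     ('E_(P' n)[fun w => (phi n [tuple Y n j w | j < d] ^+ (2 * d + 4))%R]
       <= C%:E)%E) ->
  (d%:R%:E * 'E_(P' n)[fun w =>
      (phi_bar (phi n) (Y n) (Y n (Ordinal (ltnW d_ge2)) w) ^+ 2)%R])%E
    @[n --> \oo] --> alpha%:E ->
  ('E_(P' n)[fun w => (phi n [tuple Y n j w | j < d] ^+ 2)%R])%E
    @[n --> \oo] --> beta%:E ->
  0 < beta ->
  let sample n w (k : 'I_(p n)) := [tuple X n i k w | i < n] in
  [/\ weak_cvg_in_probability P
        (fun n w => esd (phi_cov_mx (phi n) (sample n w)))
        (marchenko_pastur_affine q alpha (beta - alpha)),
      P n [set w | exists k, phi_cov (phi n) (sample n w k) (sample n w k) = 0]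
        @[n --> \oo] --> 0%E
    & weak_cvg_in_probability P
        (fun n w => esd (phi_cor_mx (phi n) (sample n w)))
        (marchenko_pastur_affine q (alpha / beta) (1 - alpha / beta))].
Proof.
move=> hp [C hC] ha hb beta0 sample.
(* Everything is transported to laws on tuples: [nu n] for the [d] copies, [mu n] for the whole
   array, flattened by an enumeration of the pairs. *)
pose i0 := Ordinal (ltnW d_ge2).
pose m n : probability (S n) R := distribution (P' n) (Y n i0).
pose ht n : {mfun Omega' n >-> (d.-tuple (S n))} := family_tuple (Y n) id.
pose nu n : probability (d.-tuple (S n)) R := distribution (P' n) (ht n).
pose N n := #|{: 'I_n * 'I_(p n)}|.
pose fX n (ik : 'I_n * 'I_(p n)) := X n ik.1 ik.2.
pose h n : {mfun Omega n >-> ((N n).-tuple (S n))} := family_tuple (fX n) (@enum_val _ _).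
pose mu n : probability ((N n).-tuple (S n)) R := distribution (P n) (h n).
pose idx n (i : 'I_n) (k : 'I_(p n)) : 'I_(N n) := enum_rank (i, k).
have idx_inj n i k i' k' : @idx n i k = @idx n i' k' -> i = i' /\ k = k'.
  by move/enum_rank_inj => [-> ->].
have hnu n : iid_map (m n) (nu n) id.
  apply: (@iid_map_family _ _ _ _ _ _ _ (Y n) (m n) (Y_iid n).1 _ d id id) => // j A mA.
  exact: (Y_iid n).2.
have hmu n : iid_map (m n) (mu n) id.
  apply: (@iid_map_family _ _ _ _ _ _ _ (fX n) (m n) (X_iid n).1 _ (N n) (@enum_val _ _) enum_rank).
  - by move=> [i k] A mA; rewrite -(Y_copy n i0 i k)//.
  - exact: enum_valK.
  - exact: enum_rankK.
have lawE n (f : d.-tuple (S n) -> R) : measurable_fun [set: d.-tuple (S n)] f ->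
    ('E_(P' n)[fun w => f [tuple Y n j w | j < d]] = \int[nu n]_t (f t)%:E)%E.
  move=> mf; rewrite unlock -(law_integral (P := P' n) (h := ht n))//.
  exact/measurable_EFinP.
have mphi n : measurable_fun [set: d.-tuple (S n)] (phi n) by exact: measurable_funP.
have lawX n k : ('E_(P' n)[fun w => (phi n [tuple Y n j w | j < d] ^+ k)%R] =
    \int[nu n]_t (phi n t ^+ k)%:E)%E.
  by apply: (lawE n (fun t => phi n t ^+ k)); exact: measurable_funX.
have C0 : 0 <= C.
  rewrite -lee_fin; apply: le_trans (hC 0); rewrite lawX.
  by apply: integral_ge0 => t _; rewrite lee_fin exprn_even_ge0// oddD oddM.
(* The exponent is even, so a finite bound on the extended expectation already yields
   integrability. *)
have iD n : itg (nu n) (fun t => phi n t ^+ (2 * d + 4)) /\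
    EE (nu n) (fun t => phi n t ^+ (2 * d + 4)) <= C.
  have e0 t : 0 <= phi n t ^+ (2 * d + 4) by rewrite exprn_even_ge0// oddD oddM.
  have := hC n; rewrite lawX.
  move=> hn; have iD : itg (nu n) (fun t => phi n t ^+ (2 * d + 4)).
    apply/integrableP; split; first by apply/measurable_EFinP; exact: measurable_funX.
    under eq_integral do rewrite gee0_abs ?lee_fin//.
    by apply: le_lt_trans hn _; exact: ltry.
  by split => //; rewrite -lee_fin EE_EFin.
(* Here [d >= 2] enters through [8 <= 2 * d + 4]: with [y] the square of the kernel,
   [y ^ 4 <= 1 + y ^ (d + 2)]. *)
have p8 n : mom (nu n) 3 (phi n) /\ EE (nu n) (fun t => phi n t ^+ 8) <= 1 + C.
  have [i1 h1] := iD n.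
  have b8 t : phi n t ^+ 8 <= 1 + phi n t ^+ (2 * d + 4).
    rewrite (exprM _ 2 4) (_ : (2 * d + 4 = 2 * (d + 2))%N); last by rewrite mulnDr.
    rewrite (exprM _ 2 (d + 2)); set y := phi n t ^+ 2; have y0 : 0 <= y := sqr_ge0 _.
    have [y1|/ltW y1] := leP y 1.
      by apply: (@le_trans _ _ 1); [rewrite exprn_ile1|rewrite lerDl exprn_ge0].
    apply: (@le_trans _ _ (y ^+ (d + 2))); last by rewrite lerDr.
    by rewrite ler_weXn2l// -[4%N]/(2 + 2)%N leq_add2r.
  have iB : itg (nu n) (fun t => 1 + phi n t ^+ (2 * d + 4)) by apply: itgD => //; exact: itg_cst.
  have i8 : itg (nu n) (fun t => phi n t ^+ 8).
    apply: itg_le iB; first exact: measurable_funX.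
    by move=> t; rewrite ger0_norm// exprn_even_ge0.
  split; first by split.
  apply: le_trans (EE_le i8 iB b8) _.
  by rewrite (EED (itg_cst _ _) i1) EE_cst lerD2l.
have p8m n := (p8 n).1.
have i8 n : itg (nu n) (fun t => phi n t ^+ 8) by case: (p8m n).
have i4 n : itg (nu n) (fun t => phi n t ^+ 4) by case: (momS (p8m n)).
have i2 n : itg (nu n) (fun t => phi n t ^+ 2) by apply: mom1_sqr; apply: momS; exact: momS.
have E4 n : EE (nu n) (fun t => phi n t ^+ 4) <= 2 + C.
  apply: le_trans (EE_le (i4 n) (itgD (itg_cst (nu n) 1) (i8 n)) _) _.
    move=> t; rewrite (exprM _ 4 2); have := sqr_ge0 (phi n t ^+ 4 - 2^-1); nra.
  by rewrite (EED (itg_cst _ _) (i8 n)) EE_cst; have := (p8 n).2; lra.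
have E2 n : b2 (nu n) (phi n) <= 3 + C.
  apply: le_trans (EE_le (i2 n) (itgD (itg_cst (nu n) 1) (i4 n)) _) _.
    move=> t; rewrite (exprM _ 2 2); have := sqr_ge0 (phi n t ^+ 2 - 2^-1); nra.
  by rewrite (EED (itg_cst _ _) (i4 n)) EE_cst; have := E4 n; lra.
(* [(u - v) ^ 4 <= 8 * (u ^ 4 + v ^ 4)] with [u] the squared kernel and [v = b2 <= 3 + C] bounds
   [h4]; the summand [2 + C] bounds the fourth moment of the kernel, hence [gg4]. *)
pose K := 8 * (1 + C + (3 + C) ^+ 4) + (2 + C).
have hh4 n : h4 (nu n) (phi n) <= K.
  have b0 := b2_ge0 (nu n) (phi n).
  have iu : itg (nu n) (fun t => 8 * (phi n t ^+ 8 + b2 (nu n) (phi n) ^+ 4)).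
    by apply: itgZ; apply: itgD => //; exact: itg_cst.
  have u4 t : (phi n t ^+ 2 - b2 (nu n) (phi n)) ^+ 4 <= 8 * (phi n t ^+ 8 + b2 (nu n) (phi n) ^+ 4).
    rewrite (exprM _ 2 2) (exprM (phi n t) 2 4); move: (phi n t ^+ 2) (b2 _ _) => u v.
    rewrite (exprM u 2 2) (exprM v 2 2).
    have h1 : (u - v) ^+ 2 <= 2 * u ^+ 2 + 2 * v ^+ 2 by have := sqr_ge0 (u + v); nra.
    apply: (@le_trans _ _ ((2 * u ^+ 2 + 2 * v ^+ 2) ^+ 2)).
      by rewrite lerXn2r ?nnegrE ?sqr_ge0// addr_ge0// mulr_ge0 ?sqr_ge0.
    by have := sqr_ge0 (u ^+ 2 - v ^+ 2); nra.
  have ih : itg (nu n) (fun t => (phi n t ^+ 2 - b2 (nu n) (phi n)) ^+ 4).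
    apply: itg_le iu; first by apply: measurable_funX; apply: measurable_funB => //; exact: measurable_funX.
    by move=> t; rewrite ger0_norm ?exprn_even_ge0.
  apply: le_trans (EE_le ih iu u4) _.
  rewrite (EEZ _ _ (itg_mfun (itgD (i8 n) (itg_cst _ _)))) (EED (i8 n) (itg_cst _ _)) EE_cst /K.
  have : b2 (nu n) (phi n) ^+ 4 <= (3 + C) ^+ 4 by rewrite lerXn2r ?nnegrE ?addr_ge0.
  have := (p8 n).2; lra.
have hg4 n : gg4 (m n) (nu n) (phi n) <= K.
  apply: le_trans (gbar4_le (hnu n) d_ge2 (mphi n) (momS (p8m n))).2 _.
  apply: le_trans (E4 n) _; rewrite /K lerDr mulr_ge0// addr_ge0 ?exprn_ge0 ?addr_ge0//.
have ha' : d%:R * s2 (m n) (nu n) (phi n) @[n --> \oo] --> alpha.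
  have -> : (fun n => d%:R * s2 (m n) (nu n) (phi n)) = fine \o (fun n => d%:R%:E * 'E_(P' n)[fun w =>
      (phi_bar (phi n) (Y n) (Y n (Ordinal (ltnW d_ge2)) w) ^+ 2)%R])%E; last exact: fine_cvg.
  apply/funext => n /=.
  have bE x : phi_bar (phi n) (Y n) x = gbar (nu n) (phi n) x.
    rewrite /phi_bar /gbar /EE /Rintegral unlock; congr fine.
    rewrite -(law_integral (P := P' n) (h := ht n))//.
      by apply: eq_integral => w _ /=; congr (phi n _)%:E; apply: eq_from_tnth => j; rewrite !tnth_mktuple.
    apply/measurable_EFinP; apply: (measurableT_comp (mphi n)).
    apply/measurable_fun_tnthP => j.
    rewrite (_ : _ \o _ = fun t => if val j == 0%N then x else tnth t j); last first.
      by apply/funext => t; rewrite /= tnth_mktuple.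
    by case: (_ == _); [exact: measurable_cst|exact: measurable_tnth].
  have mg := measurable_gbar (nu n) (mphi n).
  have ig : itg (m n) (fun x => gbar (nu n) (phi n) x ^+ 2).
    exact: mom1_sqr (momS (gbar4_le (hnu n) d_ge2 (mphi n) (momS (p8m n))).1).
  have -> : ('E_(P' n)[fun w => (phi_bar (phi n) (Y n) (Y n (Ordinal (ltnW d_ge2)) w) ^+ 2)%R] =
      (s2 (m n) (nu n) (phi n))%:E)%E.
    rewrite unlock /s2 (EE_EFin ig).
    rewrite -(law_integral (P := P' n) (h := Y n i0))//.
      by apply: eq_integral => w _; rewrite /= bE.
    by apply/measurable_EFinP; exact: measurable_funX.
  by rewrite -EFinM.
have hb' : b2 (nu n) (phi n) @[n --> \oo] --> beta.
  have -> : (fun n => b2 (nu n) (phi n)) = fine \o (fun n =>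
     'E_(P' n)[fun w => (phi n [tuple Y n j w | j < d] ^+ 2)%R])%E; last exact: fine_cvg.
  by apply/funext => n /=; rewrite lawX -EE_EFin.
have AE n w k l : phi_cov (phi n) (sample n w k) (sample n w l) = Amx (@idx n) (phi n) (h n w) k l.
  rewrite mxE /phi_cov /cov_sum; congr (_ * _); apply: eq_bigr => I _.
  have tE k' : map_tuple (tnth (sample n w k')) I =
      [tuple tnth (h n w) (idx n (tnth I j) k') | j < d].
    apply: eq_from_tnth => j; rewrite tnth_map !tnth_mktuple.
    by rewrite /fX /idx enum_rankK.
  by rewrite /aI -!tE.
have covE n w : phi_cov_mx (phi n) (sample n w) = Amx (@idx n) (phi n) (h n w).
  by apply/matrixP => k l; rewrite mxE AE.
have corE n w : phi_cor_mx (phi n) (sample n w) = cor_mx (Amx (@idx n) (phi n) (h n w)).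
  by apply/matrixP => k l; rewrite !mxE /phi_cor !AE !mxE.
split.
- apply: (weak_cvg_distribution (h := h) (M := fun n z => esd (Amx (@idx n) (phi n) z)));
    last by move=> n w; rewrite covE.
  exact: (weak_cvg_cov hmu idx_inj hnu d_ge2 mphi phi_anti p8m p_gt0 hp ha' hb' hh4 hg4 beta0).
- have := cvg_zero_diag hmu idx_inj hnu d_ge2 mphi p8m p_gt0 hp ha' hb' hh4 beta0.
  set u := (X in X @ _ --> _ -> _); set v := (X in _ -> X @ _ --> _); suff -> : v = u by [].
  apply/funext => n; congr (P n _); apply/seteqP.
  by split => w [k Ak]; exists k; [rewrite /= -AE|rewrite AE].
- apply: (weak_cvg_distribution (h := h) (M := fun n z => esd (cor_mx (Amx (@idx n) (phi n) z))));
    last by move=> n w; rewrite corE.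
  exact: (weak_cvg_cor hmu idx_inj hnu d_ge2 mphi phi_anti p8m p_gt0 hp ha' hb' hh4 hg4 beta0).
Qed.
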